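(* Let $\lambda(D)$ be the principal eigenvalue of $$-D\Delta \phi -2\alpha\nabla m(x)\cdot \nabla\phi+V(x)\phi=\lambda\phi \ \text{ in }\Omega,\qquad \frac{\partial\phi}{\partial n}+\beta(x)\phi=0\ \text{ on }\partial\Omega,$$ and let $\mu_1$ be the principal eigenvalue of $$-\Delta\phi=\mu\phi\ \text{ in }\Omega,\qquad \frac{\partial\phi}{\partial n}+\beta(x)\phi=0\ \text{ on }\partial\Omega.$$ Then the following hold. (i) If $\mu_1>0$, then $\lim_{D\to+\infty}\lambda(D)=+\infty$. (ii) If $\mu_1<0$, then $\lim_{D\to+\infty}\lambda(D)=-\infty$. (iii) If $\mu_1=0$, then $$\lim_{D\to+\infty}\lambda(D)=\int_\Omega\big(V\phi_0^2-2\alpha\,\phi_0\nabla m\cdot\nabla\phi_0\big),$$ where $\phi_0$ is the (positive) principal eigenfunction of the second problem corresponding to $\mu_1=0$, normalized by $\int_\Omega\phi_0^2=1$. In particular, the situation (i) holds if $\beta\ge0$ and $\beta\not\equiv0$; (ii) holds if either $\int_{\partial\Omega}\beta<0$, or $\int_{\partial\Omega}\beta=0$ and $\beta\not\equiv0$; and (iii) holds if $\beta\equiv0$.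
   Context: $\Omega\subset\mathbb{R}^N$ is a bounded smooth domain, $n(x)$ is the unit exterior normal to $\partial\Omega$, $\alpha>0$ is a fixed constant, $D>0$ is a parameter, $m\in C^2(\bar\Omega)$, $V\in C(\bar\Omega)$, and $\beta\in C(\partial\Omega)$ is a given function. The principal eigenvalue is the smallest eigenvalue; it is the one corresponding to a positive eigenfunction (the principal eigenfunction). *)

(* Defs.v *)
From mathcomp Require Import all_boot all_order all_algebra.
From mathcomp Require Import all_classical all_reals all_analysis.

Set Implicit Arguments.
Unset Strict Implicit.
Unset Printing Implicit Defensive.

Import Order.TTheory GRing.Theory Num.Theory.
Import numFieldNormedType.Exports.

Local Open Scope classical_set_scope.
Local Open Scope ring_scope.

(** R^N is ['rV[R]_N]; [borel_rV] is the same type carrying its Borel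
    sigma-algebra, so that functions and sets on ['rV[R]_N] can be used
    directly with [integral] and [measurable_fun]. *)
Definition borel_rV (R : realType) (N : nat) :=
  g_sigma_algebraType (@open 'rV[R]_N).

(** The N-fold product of the one-dimensional Lebesgue measure, by slicing along
    the first coordinate (this is the formula defining [product_measure1]).
    Only its values on Borel sets are meaningful. *)
Fixpoint lebesgue_rV (R : realType) (N : nat) : set 'rV[R]_N -> \bar R :=
  match N return set 'rV[R]_N -> \bar R with
  | 0 => fun A => (\1_A (0 : 'rV[R]_0))%:E
  | N'.+1 => fun A =>
      (\int[@lebesgue_measure R]_t
         lebesgue_rV [set y : 'rV[R]_N' | A (row_mx (t%:M : 'M[R]_1) y)])%E
  end.

Definition euclidean_dist (R : realType) (N : nat) (x y : 'rV[R]_N) : R :=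
  Num.sqrt (\sum_(i < N) (x 0 i - y 0 i) ^+ 2).

Definition diameter (R : realType) (N : nat) (A : set 'rV[R]_N) : \bar R :=
  ereal_sup [set (euclidean_dist p.1 p.2)%:E | p in A `*` A].

Definition unit_ball_volume (R : realType) (s : nat) : \bar R :=
  lebesgue_rV [set x : 'rV[R]_s | euclidean_dist x 0 <= 1].

(** The emptiness test matters for s = 0, where a nonempty set has gauge 1
    (so that the 0-dimensional Hausdorff measure is the counting measure). *)
Definition hausdorff_gauge (R : realType) (N s : nat) (A : set 'rV[R]_N) :
    \bar R :=
  if A == set0 then 0%E
  else (unit_ball_volume R s * (diameter A * (2^-1)%:E) ^+ s)%E.

Definition hausdorff_delta (R : realType) (N s : nat) (d : R)
    (A : set 'rV[R]_N) : \bar R :=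
  ereal_inf [set (\sum_(k <oo) hausdorff_gauge s (F k))%E |
    F in [set F : nat -> set 'rV[R]_N |
      (forall k, (diameter (F k) <= d%:E)%E) /\ A `<=` \bigcup_k F k]].

(** s-dimensional Hausdorff measure, normalized to agree with Lebesgue measure
    on R^s. *)
Definition hausdorff (R : realType) (N s : nat) (A : set 'rV[R]_N) : \bar R :=
  ereal_sup [set hausdorff_delta s d A | d in [set d : R | 0 < d]].

Definition boundary (T : topologicalType) (A : set T) : set T :=
  closure A `\` interior A.

Definition vol_int (R : realType) (N : nat) (A : set 'rV[R]_N)
    (f : 'rV[R]_N -> R) : R :=
  fine (integral (T := borel_rV R N) (@lebesgue_rV R N) A (EFin \o f)).

Definition surf_int (R : realType) (n : nat) (A : set 'rV[R]_n.+1)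
    (f : 'rV[R]_n.+1 -> R) : R :=
  fine (integral (T := borel_rV R n.+1) (@hausdorff R n.+1 n) A (EFin \o f)).

Definition partial (R : realType) (N : nat) (i : 'I_N) (f : 'rV[R]_N -> R) :
    'rV[R]_N -> R :=
  fun x => 'D_(delta_mx 0 i) f x.

(** f is C^k in the open set A and all its partial derivatives of order <= k
    extend continuously to the closure of A.  The values of f outside A are
    irrelevant.  For A = setT this is the class C^k(R^N). *)
Fixpoint Ck_closure (R : realType) (N : nat) (k : nat) (A : set 'rV[R]_N)
    (f : 'rV[R]_N -> R) : Prop :=
  (exists2 g : 'rV[R]_N -> R,
     {within closure A, continuous g} & forall x, A x -> f x = g x) /\
  match k with
  | 0 => True
  | k'.+1 => forall i : 'I_N,
      (forall x, A x -> derivable f x (delta_mx 0 i)) /\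
      Ck_closure k' A (partial i f)
  end.

Definition smooth (R : realType) (N : nat) (f : 'rV[R]_N -> R) : Prop :=
  forall k, Ck_closure k setT f.

(** Near each boundary point, A is one side of the graph of a smooth function
    of the coordinates other than x_i. *)
Definition smooth_boundary (R : realType) (n : nat) (A : set 'rV[R]_n.+1) :
    Prop :=
  forall x0, boundary A x0 ->
    exists (i : 'I_n.+1) (s : bool) (h : 'rV[R]_n -> R), smooth h /\
      \forall x \near x0, A x <-> 0 < (-1) ^+ s * (x 0 i - h (col' i x)).

Definition bounded_smooth_domain (R : realType) (n : nat)
    (A : set 'rV[R]_n.+1) : Prop :=
  [/\ open A, connected A, A !=set0, bounded_set A & smooth_boundary A].

Definition test_function (R : realType) (N : nat) (A : set 'rV[R]_N)
    (eta : 'rV[R]_N -> R) : Prop :=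
  smooth eta /\
  exists K, [/\ compact K, K `<=` A & forall x, ~ K x -> eta x = 0].

(** du is a square integrable weak gradient of u in A. *)
Definition weak_gradient (R : realType) (N : nat) (A : set 'rV[R]_N)
    (u : 'rV[R]_N -> R) (du : 'I_N -> 'rV[R]_N -> R) : Prop :=
  forall i,
    [/\ measurable_fun (T := borel_rV R N) A (du i),
        (integral (T := borel_rV R N) (@lebesgue_rV R N) A
           (fun x => (du i x ^+ 2)%:E) < +oo)%E
      & forall eta, test_function A eta ->
        vol_int A (fun x => u x * partial i eta x) =
        - vol_int A (fun x => du i x * eta x)].

(** u belongs to H^1(A), is continuous up to the boundary, and has weak
    gradient du.  The boundary trace of such a u is its restriction. *)
Definition H1_continuous (R : realType) (N : nat) (A : set 'rV[R]_N)
    (u : 'rV[R]_N -> R) (du : 'I_N -> 'rV[R]_N -> R) : Prop :=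
  {within closure A, continuous u} /\ weak_gradient A u du.

(** (lambda, phi) is an eigenpair, dphi being the weak gradient of phi, of
      - D Laplacian(phi) - b . grad(phi) + V phi = lambda phi   in Om,
      d(phi)/dn + beta phi = 0                                  on the boundary.
    With V and beta merely continuous, eigenfunctions need be neither C^2 in Om
    nor C^1 up to the boundary, so the problem is understood in the weak sense;
    the boundary term is what the Robin condition gives in Green's formula.
    Weak H^1 eigenfunctions are continuous on the closure of Om, whence the use
    of [H1_continuous]. *)
Definition robin_eigenpair (R : realType) (n : nat) (Om : set 'rV[R]_n.+1)
    (beta : 'rV[R]_n.+1 -> R) (D : R) (b : 'I_n.+1 -> 'rV[R]_n.+1 -> R)
    (V : 'rV[R]_n.+1 -> R) (lambda : R)
    (phi : 'rV[R]_n.+1 -> R) (dphi : 'I_n.+1 -> 'rV[R]_n.+1 -> R) : Prop :=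
  [/\ H1_continuous Om phi dphi,
      exists2 x, Om x & phi x != 0
    & forall psi dpsi, H1_continuous Om psi dpsi ->
      D * vol_int Om (fun x => \sum_(i < n.+1) dphi i x * dpsi i x)
      - vol_int Om (fun x => (\sum_(i < n.+1) b i x * dphi i x) * psi x)
      + vol_int Om (fun x => V x * phi x * psi x)
      + D * surf_int (boundary Om) (fun x => beta x * phi x * psi x)
      = lambda * vol_int Om (fun x => phi x * psi x)].

Definition positive_eigenpair (R : realType) (n : nat) (Om : set 'rV[R]_n.+1)
    (beta : 'rV[R]_n.+1 -> R) (D : R) (b : 'I_n.+1 -> 'rV[R]_n.+1 -> R)
    (V : 'rV[R]_n.+1 -> R) (lambda : R)
    (phi : 'rV[R]_n.+1 -> R) (dphi : 'I_n.+1 -> 'rV[R]_n.+1 -> R) : Prop :=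
  robin_eigenpair Om beta D b V lambda phi dphi /\
  forall x, closure Om x -> 0 < phi x.

(** The operator is self-adjoint in L^2(exp(2 alpha m / D) dx) when
    b = 2 alpha grad(m), so only real eigenvalues have to be compared. *)
Definition principal_eigenvalue (R : realType) (n : nat)
    (Om : set 'rV[R]_n.+1) (beta : 'rV[R]_n.+1 -> R) (D : R)
    (b : 'I_n.+1 -> 'rV[R]_n.+1 -> R) (V : 'rV[R]_n.+1 -> R)
    (lambda : R) : Prop :=
  (exists phi dphi, positive_eigenpair Om beta D b V lambda phi dphi) /\
  (forall lambda' phi dphi,
     robin_eigenpair Om beta D b V lambda' phi dphi -> lambda <= lambda').

(* Main.v *)
From HB Require Import structures.
Require Import Defs.
From mathcomp Require Import all_boot all_order all_algebra.
From mathcomp Require Import all_classical all_reals all_analysis.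
From mathcomp Require Import measurable_realfun.
From mathcomp Require Import ring lra.
Import Order.TTheory GRing.Theory Num.Theory.
Import numFieldNormedType.Exports.
Local Open Scope classical_set_scope.
Local Open Scope ring_scope.

(** For a function g write G, E, S for the integrals of g^2 and |grad g|^2 over the domain and of
    beta g^2 over its boundary. Conjugation by exp(alpha m / D) makes the operator self-adjoint,
    with quadratic form Q_D(g) = D (E + S) - 2 alpha int g grad m . grad g + (alpha^2 / D) int |grad
    m|^2 g^2 + int V g^2. The variational principle is obtained from positivity of the eigenfunction
    phi alone: testing its equation with g^2 / phi (Picone's identity, [picone]) gives lambda(D) G
    <= Q_D(g) for every g ([picone_le]), and g = exp(alpha m / D) phi gives equality ([picone_eq]).
    For the second problem the same identity reads E + S = mu1 G + H, where H is the integral of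
    |phi0 grad(g / phi0)|^2 ([neumann_energy]).

    Comparing Q_D with Q_1 at the minimizer of Q_D bounds lambda(D) below by an affine function of D
    of slope mu1 ([principal_lower]), which is (i). The trial function phi0, for which H = 0, gives
    an upper bound ([principal_upper]), which is (ii) and half of (iii). For the other half, mu1 =
    0, so Q_D(g) contains the term D H. The Poincare inequality ([poincare]) for g / phi0 gives a
    constant a such that k = g - a phi0 has squared norm at most a constant times H. The part of the
    form that does not involve D is then expanded at g = k + a phi0: at a phi0 it has the value of
    the limit, the cross terms are split by Young's inequality ([cross_terms]), and at k it is
    bounded below through lambda(1). The errors are eps G plus a constant times H, and D H absorbs
    the latter for large D ([principal_lower0]).

    The sign criteria come from the test functions 1 and 1 / phi0: int beta phi0 = mu1 int phi0, and
    int beta = mu1 |Omega| + int |grad log phi0|^2. They rest on strict positivity of surface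
    integrals ([surf_int_gt0]), for which Hausdorff measure is shown to be a Borel measure, finite
    on the boundary and positive near each of its points.

    Weak gradients are handled by finite differences. A mean value theorem for increments
    ([increment_mvt]) yields L2 bounds on increments, a chain rule ([weak_partial_chain]) that makes
    the admissible functions closed under products, inverses and exponentials, and the transport of
    L2 mass ([transfer]) that spreads the Poincare inequality from a cube to the whole domain. *)

Set Implicit Arguments.
Unset Strict Implicit.
Unset Printing Implicit Defensive.

(** * Borel sets of R^N and rational boxes *)

Section Borel.
Context {R : realType}.

Lemma mx_norm_ltP (N : nat) (x : 'rV[R]_N) (e : R) : 0 < e ->
  `|x| < e <-> forall i, `|x 0 i| < e.
Proof.
move=> e0; rewrite {1}/Num.Def.normr /= mx_normrE; split.
  move=> /bigmax_ltP[_ xe] i; exact: (xe (0, i)).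
by move=> xe; apply/bigmax_ltP; split=> // -[a b] _ /=; rewrite ord1.
Qed.

Lemma mx_norm_leP (N : nat) (x : 'rV[R]_N) (e : R) : 0 <= e ->
  `|x| <= e <-> forall i, `|x 0 i| <= e.
Proof.
move=> e0; rewrite {1}/Num.Def.normr /= mx_normrE; split.
  move=> /bigmax_leP[_ xe] i; exact: (xe (0, i)).
by move=> xe; apply/bigmax_leP; split=> // -[a b] _ /=; rewrite ord1.
Qed.

Lemma coord_norm_le (N : nat) (x : 'rV[R]_N) i : `|x 0 i| <= `|x|.
Proof. by have /mx_norm_leP := lexx `|x|; apply. Qed.

Lemma nbhs_rVP (N : nat) (A : set 'rV[R]_N) (x : 'rV[R]_N) :
  nbhs x A <-> exists2 e : R, 0 < e &
    forall y : 'rV[R]_N, (forall i, `|y 0 i - x 0 i| < e) -> A y.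
Proof.
split.
  move=> /nbhs_ballP[e e0 eA]; exists e => // y yx; apply: eA.
  rewrite -ball_normE /ball_ /=; apply/mx_norm_ltP => // i.
  by rewrite !mxE distrC.
move=> [e e0 eA]; apply/nbhs_ballP; exists e => // y.
rewrite -ball_normE /ball_ /= => /mx_norm_ltP-/(_ e0) h; apply: eA => i.
by rewrite distrC; have := h i; rewrite !mxE.
Qed.

Definition rat_box (N : nat) (q : 'rV[rat]_N * rat) : set 'rV[R]_N :=
  [set x | forall i, `|x 0 i - ratr (q.1 0 i)| < ratr q.2].

(** Reduces measurability of open sets to countably many conditions on single coordinates. *)
Lemma open_rat_boxes (N : nat) (A : set 'rV[R]_N) : open A ->
  A = \bigcup_(q in [set q | rat_box q `<=` A]) rat_box q.
Proof.
move=> oA; apply/seteqP; split=> [x Ax|x [q /= qA qx]]; last exact: qA.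
have /nbhs_rVP[e e0 eA] := open_nbhs_nbhs (conj oA Ax).
(* A rational radius below [e / 2]: a box of this radius whose rational centre is within it of [x]
   stays within [e] of [x]. *)
have [r /= /itvP re] := rat_in_itvoo (divr_gt0 e0 (ltr0Sn R 1)).
have r0 : 0 < ratr r :> R by rewrite re.
have h i : exists q : rat, `|x 0 i - ratr q| < ratr r.
  have xr : x 0 i < x 0 i + ratr r by rewrite ltrDl.
  have [q /= /[!in_itv] /andP[q1 q2]] := rat_in_itvoo xr.
  by exists q; rewrite ltr_norml; apply/andP; split; move: q1 q2 r0 => /= q1 q2 r0; lra.
have [f fP] := choice h.
exists (\row_i f i, r) => [y /= yf|i /=]; last by rewrite mxE.
apply: eA => i; have := yf i; rewrite !mxE => yfi.
have := fP i; rewrite distrC => fxi.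
rewrite -[_ - _](subrKA (ratr (f i))); apply: le_lt_trans (ler_normD _ _) _.
rewrite [ltRHS](splitr e); apply: ltrD.
  by rewrite (lt_trans yfi)// re.
by rewrite (lt_trans fxi)// re.
Qed.

Lemma open_measurable_rV (N : nat) (A : set 'rV[R]_N) :
  open A -> measurable (A : set (borel_rV R N)).
Proof. exact: sub_sigma_algebra. Qed.

Lemma closed_measurable_rV (N : nat) (A : set 'rV[R]_N) :
  closed A -> measurable (A : set (borel_rV R N)).
Proof.
move=> cA; rewrite -[A]setCK; apply: measurableC; apply: open_measurable_rV.
exact: closed_openC.
Qed.

End Borel.

(** * Lebesgue measure on R^N: measure structure and translation invariance *)

Section SigmaFinite.
Context d (T : measurableType d) (R : realType).
Variables (mu : {measure set T -> \bar R}) (mu_sf : sigma_finite setT mu).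

(** An alias indexed by the proof of sigma-finiteness, to which the structure required by product
    measures can be attached. *)
Definition sigma_finite_of of sigma_finite setT mu : set T -> \bar R := mu.

HB.instance Definition _ := Measure.on (sigma_finite_of mu_sf).
HB.instance Definition _ :=
  Measure_isSigmaFinite.Build _ _ _ (sigma_finite_of mu_sf) mu_sf.

End SigmaFinite.

Section Lebesgue.
Context {R : realType}.

Lemma measurable_coord (N : nat) (i : 'I_N) :
  measurable_fun setT (fun x : borel_rV R N => (x : 'rV[R]_N) 0 i).
Proof.
apply: (measurability _ (measurable_realfun.RGenOpens.measurableE R)) => //.
move=> _ [_ [a [b ->]] <-]; rewrite setTI; apply: open_measurable_rV.
by apply: open_comp => [x _|]; [exact: coord_continuous|exact: interval_open].
Qed.

(** Open sets are countable unions of rational boxes, and a box is a finite intersection of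
    conditions on coordinates. *)
Lemma measurable_fun_rV d (T : measurableType d) (D : set T) (N : nat)
    (f : T -> borel_rV R N) :
  measurable D -> (forall i, measurable_fun D (fun x => (f x : 'rV[R]_N) 0 i)) ->
  measurable_fun D f.
Proof.
move=> mD mf; have HH : @measurable _ (borel_rV R N) = <<s (@open (matrix R 1 N)) >> by []. apply: (measurability _ HH). 
move=> _ [A oA <-]; rewrite (open_rat_boxes oA) preimage_bigcup setI_bigcupr.
rewrite bigcup_mkcond; apply: countable_bigcupT_measurable => // q.
case: ifPn => // _.
rewrite (_ : _ `&` _ = D `&` \bigcap_(i : 'I_N) (D `&`
  (fun x => (f x : 'rV[R]_N) 0 i) @^-1` ball (ratr (q.1 0 i) : R) (ratr q.2))).
  apply: measurableI => //; apply: fin_bigcap_measurable; first exact: finite_finset.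
  by move=> i _; apply: mf => //; exact: measurable_ball.
apply/seteqP; split=> x /=.
  move=> [Dx xq]; split=> // i _; split => //=.
  by rewrite -ball_normE /ball_ /= distrC.
move=> [Dx xq]; split=> // i; have [_ /=] := xq i I.
by rewrite -ball_normE /ball_ /= distrC.
Qed.

(** The identification behind the slicing in [lebesgue_rV]: on Borel sets, Lebesgue measure in the
    next dimension is the push-forward of a product measure along this map. *)
Definition cons_rV (N : nat) (ty : measurableTypeR R * borel_rV R N) :
  borel_rV R N.+1 := row_mx (ty.1%:M : 'M[R]_1) (ty.2 : 'rV[R]_N).

Lemma cons_rV0 (N : nat) ty : (@cons_rV N ty : 'rV_N.+1) 0 0 = ty.1.
Proof.
transitivity (row_mx (ty.1%:M : 'M[R]_1) (ty.2 : 'rV[R]_N) 0 (lshift N 0)).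
  by congr (row_mx _ _ _ _); exact: val_inj.
by rewrite row_mxEl mxE mulr1n.
Qed.

Lemma cons_rVS (N : nat) ty (i : 'I_N) :
  (@cons_rV N ty : 'rV_N.+1) 0 (lift ord0 i) = (ty.2 : 'rV_N) 0 i.
Proof.
transitivity (row_mx (ty.1%:M : 'M[R]_1) (ty.2 : 'rV[R]_N) 0 (rshift 1 i)).
  by congr (row_mx _ _ _ _); exact: val_inj.
by rewrite row_mxEr.
Qed.

Lemma cons_rVD (N : nat) t y (v : 'rV[R]_N.+1) :
  (@cons_rV N (t, y) : 'rV_N.+1) + v =
  @cons_rV N (t + v 0 0, (y : 'rV_N) + \row_i v 0 (lift ord0 i)).
Proof.
apply/rowP => i; rewrite mxE; case: (unliftP ord0 i) => [j|] ->.
  by rewrite !cons_rVS /= !mxE.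
by rewrite !cons_rV0.
Qed.

Lemma measurable_cons_rV (N : nat) : measurable_fun setT (@cons_rV N).
Proof.
apply: measurable_fun_rV => // i; case: (unliftP ord0 i) => [j|] ->.
  under eq_fun do rewrite cons_rVS.
  exact: measurableT_comp (measurable_coord j) measurable_snd.
by under eq_fun do rewrite cons_rV0; exact: measurable_fst.
Qed.

Definition cube (N : nat) (c : 'rV[R]_N) (r : R) : set 'rV[R]_N :=
  [set x | forall i, `|x 0 i - c 0 i| <= r].

Lemma closed_cube (N : nat) (c : 'rV[R]_N) (r : R) : closed (cube c r).
Proof.
rewrite (_ : cube c r = \bigcap_(i : 'I_N)
   ((fun x : 'rV[R]_N => `|x 0 i - c 0 i|) @^-1` [set y | y <= r])); last first.
  by apply/seteqP; split => x /= h i; [move=> _; exact: h|exact: h i I].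
apply: closed_bigI => i _; apply: closed_comp; last exact: closed_le.
have cc : continuous (fun x : 'rV[R]_N => `|x 0 i - c 0 i|).
  move=> x; apply: (@continuous_comp _ _ _ (fun x : 'rV[R]_N => x 0 i)
    (fun y : R => `|y - c 0 i|)); first exact: coord_continuous.
  by apply: cvg_norm; apply: cvgB; [exact: cvg_id|exact: cvg_cst].
by move=> x _; exact: cc.
Qed.

Lemma measurable_cube (N : nat) (c : 'rV[R]_N) (r : R) :
  measurable (cube c r : set (borel_rV R N)).
Proof. by apply: closed_measurable_rV; exact: closed_cube. Qed.


Lemma bigcup_cube (N : nat) : \bigcup_k (cube (0 : 'rV[R]_N) k%:R) = setT.
Proof.
apply/seteqP; split=> // x _; exists (Num.truncn `|x|).+1 => // i /=.
rewrite mxE subr0; apply: le_trans (coord_norm_le _ _) _.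
exact/ltW/truncnS_gt.
Qed.

Lemma sigma_finite_cube (N : nat) (mu : {measure set (borel_rV R N) -> \bar R}) :
  (forall c r, 0 <= r -> mu (cube c r) = ((2 * r) ^+ N)%:E) ->
  sigma_finite setT mu.
Proof.
move=> muc; exists (fun k => cube 0 k%:R); first by rewrite bigcup_cube.
by move=> k; split; [exact: measurable_cube|rewrite muc// ltry].
Qed.

(** Induction on the dimension: one-dimensional Lebesgue measure times the measure already built,
    pushed forward by [cons_rV]. The values on cubes are carried along because they provide the
    sigma-finiteness for the next product. *)
Lemma lebesgue_rV_exists (N : nat) :
  exists mu : {sigma_finite_measure set (borel_rV R N) -> \bar R},
    (forall A, measurable A -> mu A = lebesgue_rV A) /\
    (forall c r, 0 <= r -> mu (cube c r) = ((2 * r) ^+ N)%:E).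
Proof.
suff [mu [muE muc]] : exists mu : {measure set (borel_rV R N) -> \bar R},
    (forall A, measurable A -> mu A = lebesgue_rV A) /\
    (forall c r, 0 <= r -> mu (cube c r) = ((2 * r) ^+ N)%:E).
  by exists (sigma_finite_of (sigma_finite_cube muc)).
elim: N => [|N [mu [muE muc]]].
  exists (dirac (0 : borel_rV R 0)); split; first by [].
  move=> c r r0; rewrite expr0 /= /dirac indicE mem_set// => i; by case: i.
pose nu : {sigma_finite_measure set (borel_rV R N) -> \bar R} :=
  sigma_finite_of (sigma_finite_cube muc).
pose P0 : {measure set (measurableTypeR R * borel_rV R N) -> \bar R} :=
  (@lebesgue_measure R \x nu)%E.
suff [PE Pc] : (forall A : set (borel_rV R N.+1), measurable A ->
      P0 (@cons_rV N @^-1` A) = lebesgue_rV A) /\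
    (forall c r, 0 <= r -> P0 (@cons_rV N @^-1` cube c r) = ((2 * r) ^+ N.+1)%:E).
  by exists (pushforward P0 (@cons_rV N)).
split.
  move=> A mA; apply: eq_integral => t _ /=.
  rewrite muE; first by congr lebesgue_rV; apply/seteqP; split=> y; rewrite /xsection /= ?inE.
  apply: measurable_xsection.
  rewrite -[X in measurable X]setTI; exact: measurable_cons_rV.
move=> c r r0; have -> : @cons_rV N @^-1` cube c r =
    `[c 0 0 - r, c 0 0 + r]%classic `*` cube (\row_i c 0 (lift ord0 i)) r.
  apply/seteqP; split=> -[t y]; rewrite /cube /= in_itv /=.
    move=> h; split=> [|i]; first by have := h 0; rewrite cons_rV0 ler_distl.
    by have := h (lift ord0 i); rewrite cons_rVS mxE.
  move=> [h0 h] i; case: (unliftP ord0 i) => [j|] ->.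
    by have := h j; rewrite cons_rVS mxE.
  by rewrite cons_rV0 ler_distl.
rewrite [LHS](@product_measure1E _ _ _ _ _ (@lebesgue_measure R) nu)//; last first.
  exact: measurable_cube.
rewrite [X in (X * _)%E]lebesgue_measure_itv /= lte_fin.
have [rr|] := ltP (c 0 0 - r) (c 0 0 + r).
  by rewrite [X in (_ * X)%E]muc// -EFinB -EFinM exprS; congr (_%:E); congr (_ * _); lra.
move=> rr; have -> : r = 0 by lra.
by rewrite mul0e mulr0 expr0n.
Unshelve. exact: measurable_cons_rV.
Qed.

Section Measure.
Variable N : nat.
Local Notation leb := (@lebesgue_rV R N : set (borel_rV R N) -> \bar R).

Let leb0 : leb set0 = 0%E.
Proof. by have [mu [muE _]] := lebesgue_rV_exists N; rewrite -muE// measure0. Qed.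

Let leb_ge0 A : (0 <= leb A)%E.
Proof.
elim: N A => [|n IH] A /=; first by rewrite lee_fin indicE.
by apply: integral_ge0 => t _; exact: IH.
Qed.

Let leb_sigma_additive : semi_sigma_additive leb.
Proof.
have [mu [muE _]] := lebesgue_rV_exists N => F mF tF mUF.
rewrite -muE//; under eq_fun do under eq_bigr do rewrite -muE//.
exact: measure_semi_sigma_additive.
Qed.

HB.instance Definition _ := isMeasure.Build _ _ _ leb
  leb0 leb_ge0 leb_sigma_additive.

Lemma lebesgue_cube (c : 'rV[R]_N) (r : R) : 0 <= r ->
  leb (cube c r) = ((2 * r) ^+ N)%:E.
Proof.
have [mu [muE muc]] := lebesgue_rV_exists N => r0.
by rewrite -muE ?muc//; exact: measurable_cube.
Qed.

HB.instance Definition _ := Measure_isSigmaFinite.Build _ _ _ leb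
  (sigma_finite_cube lebesgue_cube).

Lemma cube_nbhs (c : 'rV[R]_N) (r : R) : 0 < r -> nbhs c (cube c r).
Proof. by move=> r0; apply/nbhs_rVP; exists r => // y h i; exact: ltW. Qed.

Lemma nbhs_cube (c : 'rV[R]_N) (A : set 'rV[R]_N) : nbhs c A ->
  exists2 r : R, 0 < r & cube c r `<=` A.
Proof.
move=> /nbhs_rVP[e e0 eA]; exists (e / 2); first exact: divr_gt0.
move=> y yc; apply: eA => i; apply: le_lt_trans (yc i) _.
by rewrite ltr_pdivrMr// ltr_pMr// ltr1n.
Qed.

Lemma lebesgue_nbhs_gt0 (c : 'rV[R]_N) (A : set (borel_rV R N)) :
  measurable A -> nbhs c (A : set 'rV[R]_N) -> (0 < leb A)%E.
Proof.
move=> mA /nbhs_cube[r r0 rA].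
apply: (@lt_le_trans _ _ (leb (cube c r))); last first.
  by apply: le_measure; rewrite ?inE//; exact: measurable_cube.
by rewrite lebesgue_cube ?ltW// lte_fin exprn_gt0// mulr_gt0.
Qed.

Lemma bounded_cube (A : set 'rV[R]_N) : bounded_set A ->
  exists2 r : R, 0 < r & A `<=` cube 0 r.
Proof.
move=> [M [Mr MA]]; exists (`|M| + 1); first by rewrite ltr_wpDl.
move=> x Ax i; rewrite mxE subr0; apply: le_trans (coord_norm_le x i) _.
by apply: MA Ax; rewrite (le_lt_trans (ler_norm M))// ltrDl.
Qed.

Lemma lebesgue_bounded_lty (A : set (borel_rV R N)) :
  measurable A -> bounded_set (A : set 'rV[R]_N) -> (leb A < +oo)%E.
Proof.
move=> mA /bounded_cube[r r0 rA].
apply: (@le_lt_trans _ _ (leb (cube 0 r))).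
  by apply: le_measure; rewrite ?inE//; exact: measurable_cube.
by rewrite lebesgue_cube ?ltW// ltry.
Qed.

End Measure.

(** Lebesgue measure is determined by its values on half-open intervals, and those are invariant. *)
Lemma lebesgue_measure_shift (a : R) (A : set (measurableTypeR R)) :
  measurable A ->
  pushforward (@lebesgue_measure R) (fun t : measurableTypeR R => t + a : measurableTypeR R) A =
  lebesgue_measure A.
Proof.
move=> mA.
have ms : measurable_fun setT (fun t : measurableTypeR R => t + a : measurableTypeR R).
  by apply: measurable_funD.
apply/esym/lebesgue_measure_unique => //= _ [[u v]] _ <-.
rewrite /pushforward /=.
rewrite (_ : _ @^-1` _ = `](u - a), (v - a)]%classic); last first.
  by apply/seteqP; split => t /=; rewrite !in_itv /= ltrBlDr lerBrDr.
rewrite !lebesgue_measure_itv /= !lte_fin -!EFinB.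
by rewrite ltrD2r; case: ifP => // _; congr (_%:E); lra.
Unshelve. all: exact: ms.
Qed.

Lemma measurable_shift (N : nat) (v : 'rV[R]_N) :
  measurable_fun setT (fun x : borel_rV R N => (x : 'rV[R]_N) + v : borel_rV R N).
Proof.
apply: measurable_fun_rV => // i.
under eq_fun do rewrite mxE; apply: measurable_funD => //.
exact: measurable_coord.
Qed.

(** Induction on the dimension: each slice is shifted by the induction hypothesis, and the outer
    integral by invariance on the line. *)
Lemma lebesgue_shift (N : nat) (v : 'rV[R]_N) (A : set (borel_rV R N)) :
  measurable A ->
  lebesgue_rV [set x : 'rV[R]_N | A (x + v)] = lebesgue_rV (A : set 'rV[R]_N).
Proof.
elim: N v A => [|n IH] v A mA.
  by congr lebesgue_rV; apply/seteqP; split=> x /=; rewrite (thinmx0 v) addr0.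
pose B := @cons_rV n @^-1` A.
have mB : measurable B by rewrite -[B]setTI; exact: measurable_cons_rV.
pose f t := lebesgue_rV (xsection B t : set 'rV[R]_n).
have mf : measurable_fun setT f by exact: measurable_fun_xsection.
pose v' : 'rV[R]_n := \row_i v 0 (lift ord0 i).
have sh : measurable_fun setT
    (fun t : measurableTypeR R => t + v 0 0 : measurableTypeR R).
  by apply: measurable_funD.
transitivity (\int[@lebesgue_measure R]_t f (t + v 0 0)%R)%E.
  apply: eq_integral => t _; rewrite /f -(IH v').
    congr lebesgue_rV; apply/seteqP; split => y;
      by rewrite /xsection /B /= inE /= cons_rVD.
  exact: measurable_xsection.
transitivity (\int[pushforward (@lebesgue_measure R)
  (fun t : measurableTypeR R => (t + v 0 0)%R : measurableTypeR R)]_t f t)%E.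
  by rewrite ge0_integral_pushforward// => t _; exact: measure_ge0.
transitivity (\int[@lebesgue_measure R]_t f t)%E.
  by apply: eq_measure_integral => // C mC _; exact: lebesgue_measure_shift.
by apply: eq_integral => t _; congr lebesgue_rV; apply/seteqP; split => y;
  rewrite /xsection /= inE.
Qed.

End Lebesgue.

(** * Smooth steps and bumps on the line *)

Section SmoothStep.
Context {R : realType}.

(** The derivatives of [exp (-1/x)] are combinations of these functions. *)
Definition flat (k : nat) (x : R) : R :=
  if 0 < x then x^-1 ^+ k * expR (- x^-1) else 0.

Lemma flat_ge0 k x : 0 <= flat k x.
Proof.
by rewrite /flat; case: ltP => // x0; rewrite mulr_ge0 ?expR_ge0 ?exprn_ge0 ?invr_ge0 ?ltW.
Qed.

(** The bound y^(k+1) / (k+1)! <= exp y at y = 1/x; it forces continuity at 0. *)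
Lemma flat_le k x : 0 < x -> flat k x <= (k.+1)`!%:R * x.
Proof.
move=> x0; rewrite /flat x0.
have y0 : 0 <= x^-1 by rewrite invr_ge0 ltW.
have := expR_ge1Dxn k y0; rewrite expRN => h.
rewrite ler_pdivrMr ?expR_gt0//.
have f0 : 0 < (k.+1)`!%:R :> R by rewrite ltr0n fact_gt0.
apply: (@le_trans _ _ ((k.+1)`!%:R * x * (x^-1 ^+ k.+1 / (k.+1)`!%:R))).
  rewrite exprS le_eqVlt; apply/orP; left; apply/eqP; field.
  by rewrite !gt_eqF.
rewrite ler_wpM2l//; first by rewrite mulr_ge0// ltW.
by apply: le_trans h; rewrite lerDr.
Qed.

Lemma flat_continuous0 k : {for 0, continuous (flat k)}.
Proof.
have f0 : 0 < (k.+1)`!%:R :> R by rewrite ltr0n fact_gt0.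
apply/cvgrPdist_lt => e e0 /=.
have f00 : flat k 0 = 0 by rewrite /flat ltxx.
near=> x; rewrite f00 sub0r normrN ger0_norm ?flat_ge0//.
have [x0|x0] := ltP 0 x; last by rewrite /flat (ltNge 0) x0.
apply: le_lt_trans (flat_le k x0) _; rewrite mulrC -ltr_pdivlMr//.
near: x; apply: lt_nbhsl; exact: divr_gt0.
Unshelve. all: by end_near. Qed.

(** The family is closed under differentiation, so smoothness becomes an induction on the order. *)
Lemma is_derive_flat k (x : R) :
  is_derive x (1 : R) (flat k) (flat k.+2 x - k%:R * flat k.+1 x).
Proof.
have [x0|x0|->] := ltgtP x 0.
- have -> : flat k.+2 x - k%:R * flat k.+1 x = 0.
    by rewrite /flat ltNge (ltW x0) mulr0 subr0.
  apply: (@near_eq_is_derive _ _ _ (cst 0)).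
  by near=> y; rewrite /flat ltNge ltW//; near: y; exact: lt_nbhsl.
- have xp : 0 < x by [].
  have xn : x != 0 by rewrite gt_eqF.
  apply: (@near_eq_is_derive R R^o R^o (fun y : R => y^-1 ^+ k * expR (- y^-1))).
    by near=> y; rewrite /flat; have -> : 0 < y by near: y; exact: lt_nbhsr.
  have d1 : is_derive x 1 (fun y : R => y^-1) (- x ^- 2).
    apply: DeriveDef; first by apply: derivableV => //; exact: derivable_id.
    by rewrite deriveV//; rewrite derive_id [_ *: _]mulr1.
  have d2 : is_derive x 1 (fun y : R => y^-1 ^+ k) (k%:R * x^-1 ^+ k.-1 * (- x ^- 2)).
    have -> : (fun y : R => y^-1 ^+ k) = (fun y : R => y^-1) ^+ k.
      by apply/funext => y; rewrite fctE.
    by apply: is_derive_eq; rewrite [LHS]/GRing.scale /=; ring.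
  have d3 : is_derive x 1 (fun y : R => expR (- y^-1)) (expR (- x^-1) * x ^- 2).
    have d4 : is_derive x 1 (fun y : R => - y^-1) (x ^- 2).
      by apply: is_derive_eq; rewrite opprK.
    exact: (@is_derive1_comp _ expR (fun y : R => - y^-1)).
  apply: is_derive_eq; rewrite /flat xp /GRing.scale /= -exprVn.
  case: k d2 => [|k] _ /=; first by rewrite !expr0 !mul0r; ring.
  by rewrite !exprS; ring.
- have -> : flat k.+2 0 - k%:R * flat k.+1 0 = flat k.+1 0.
    by rewrite /flat ltxx mulr0 subr0.
  (* At 0 the difference quotient of [flat k] is [flat k.+1] itself, which is continuous there. *)
  apply/is_derive1_caratheodory; exists (flat k.+1); split=> //.
    move=> z; rewrite {2}/flat ltxx !subr0 /flat; case: ifP => z0; last by rewrite mul0r.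
    by rewrite exprS; field; rewrite gt_eqF.
  exact: flat_continuous0.
Unshelve. all: by end_near. Qed.

Lemma flat_continuous k : continuous (flat k).
Proof.
move=> x; apply/differentiable_continuous/derivable1_diffP.
exact: (@ex_derive _ _ _ _ _ _ _ (is_derive_flat k x)).
Qed.

Lemma flat0_mono x y : x <= y -> flat 0 x <= flat 0 y.
Proof.
move=> xy; rewrite /flat; case: ifP => x0; last first.
  by case: ifP => // _; rewrite mulr_ge0 ?expr0 ?expR_ge0.
have y0 : 0 < y by apply: lt_le_trans xy.
by rewrite y0 !expr0 !mul1r ler_expR lerN2 lef_pV2.
Qed.

(** The usual smooth transition from 0 (for x <= 0) to 1 (for x >= 1). *)
Definition step (x : R) : R := flat 0 x / (flat 0 x + flat 0 (1 - x)).

Lemma flat0_gt0 x : 0 < x -> 0 < flat 0 x.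
Proof. by move=> x0; rewrite /flat x0 expr0 mul1r expR_gt0. Qed.

Lemma step_den_gt0 x : 0 < flat 0 x + flat 0 (1 - x).
Proof.
have [x0|x0] := ltP 0 x; first by rewrite ltr_pwDl ?flat0_gt0 ?flat_ge0.
by rewrite ltr_wpDl ?flat_ge0 ?flat0_gt0// subr_gt0 (le_lt_trans x0).
Qed.

Lemma step_le0 x : x <= 0 -> step x = 0.
Proof. by move=> x0; rewrite /step /flat ltNge x0 mul0r. Qed.

Lemma step_ge1 x : 1 <= x -> step x = 1.
Proof.
move=> x1; rewrite /step [flat 0 (1 - x)]/flat subr_gt0 ltNge x1 /= addr0 divff//.
by rewrite gt_eqF// flat0_gt0// (lt_le_trans _ x1).
Qed.

Lemma step_mono x y : x <= y -> step x <= step y.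
Proof.
move=> xy; rewrite /step ler_pdivrMr ?step_den_gt0// mulrAC ler_pdivlMr ?step_den_gt0//.
rewrite !mulrDr mulrC lerD2l; apply: ler_pM; rewrite ?flat_ge0 ?flat0_mono//.
by rewrite lerB.
Qed.

(** The integer translates of this bump sum to one. *)
Definition bump (x : R) : R := step (x + 1) - step x.

Lemma bump_ge0 x : 0 <= bump x.
Proof. by rewrite subr_ge0 step_mono// lerDl. Qed.

Lemma bump_supp x : bump x != 0 -> `|x| < 1.
Proof.
apply: contra_neqT; rewrite -leNgt => x1; rewrite /bump.
have [x0|x0] := leP 0 x.
  by rewrite ger0_norm// in x1; rewrite !step_ge1 ?subrr//; lra.
by rewrite ltr0_norm// in x1; rewrite !step_le0 ?subrr//; lra.
Qed.

(** The sum telescopes to the difference of two steps, which have the values 1 and 0 on this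
    interval. *)
Lemma sum_bump (L : nat) (x : R) : - L%:R <= x <= L%:R ->
  \sum_(j < (L + L).+1) bump (x - (j%:R - L%:R)) = 1.
Proof.
move=> /andP[x1 x2].
pose f j := - step (x + L%:R - j%:R + 1).
transitivity (\sum_(0 <= j < (L + L).+1) (f j.+1 - f j)).
  rewrite big_mkord; apply: eq_bigr => j _; rewrite /f /bump opprK [RHS]addrC.
  by congr (step _ - step _); rewrite -?natr1; ring.
rewrite telescope_sumr// /f -natr1 natrD.
by rewrite step_le0 ?oppr0 ?sub0r ?opprK ?step_ge1//; lra.
Qed.

End SmoothStep.

(** * Continuity and smoothness of functions on R^N *)

Section ContinuousOps.
Context {R : realType} {T : topologicalType}.
Implicit Types (f g : T -> R) (x : T).

Lemma for_continuousD f g x : {for x, continuous f} -> {for x, continuous g} ->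
  {for x, continuous (fun y => f y + g y)}.
Proof. exact: cvgD. Qed.

Lemma for_continuousM f g x : {for x, continuous f} -> {for x, continuous g} ->
  {for x, continuous (fun y => f y * g y)}.
Proof. exact: cvgM. Qed.

Lemma for_continuousB f g x : {for x, continuous f} -> {for x, continuous g} ->
  {for x, continuous (fun y => f y - g y)}.
Proof. exact: cvgB. Qed.

Lemma for_continuousV f x : f x != 0 -> {for x, continuous f} ->
  {for x, continuous (fun y => (f y)^-1)}.
Proof. exact: cvgV. Qed.

Lemma for_continuous_comp f (phi : R -> R) x :
  {for x, continuous f} -> {for f x, continuous phi} ->
  {for x, continuous (fun y => phi (f y))}.
Proof. exact: continuous_comp. Qed.

Lemma continuous_add f g : continuous f -> continuous g ->
  continuous (fun y => f y + g y).
Proof. by move=> cf cg x; exact: (for_continuousD (cf x) (cg x)). Qed.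

Lemma continuous_mul f g : continuous f -> continuous g ->
  continuous (fun y => f y * g y).
Proof. by move=> cf cg x; exact: (for_continuousM (cf x) (cg x)). Qed.

Lemma continuous_inv f : (forall x, f x != 0) -> continuous f ->
  continuous (fun y => (f y)^-1).
Proof. by move=> f0 cf x; exact: (for_continuousV (f0 x) (cf x)). Qed.

Lemma continuous_sub f g : continuous f -> continuous g ->
  continuous (fun y => f y - g y).
Proof. by move=> cf cg x; apply: (cvgB (cf x) (cg x)). Qed.

Lemma continuous_sqr f : continuous f -> continuous (fun y => f y ^+ 2).
Proof. by move=> cf; exact: continuous_mul. Qed.

(** At a point off the closed set [C] the function vanishes on a whole neighbourhood. *)
Lemma continuous_extend0 (C : set T) f : closed C ->
  (forall x, C x -> {for x, continuous f}) -> (forall x, f x != 0 -> C x) ->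
  continuous f.
Proof.
move=> cC fC f0 x; have [Cx|nCx] := pselect (C x); first exact: fC.
have fx : f x = 0 by apply/eqP/contraT => /f0.
have nC : nbhs x (~` C) by apply: open_nbhs_nbhs; split=> //; exact: closed_openC.
rewrite /continuous_at fx; apply/cvgrPdist_lt => eps eps0.
apply: filterS nC => y /= nCy; rewrite sub0r normrN.
by have [->|/f0//] := eqVneq (f y) 0; rewrite normr0.
Qed.

End ContinuousOps.

Section SmoothRV.
Context {R : realType} {N : nat}.
Implicit Types (f g : 'rV[R]_N -> R) (x : 'rV[R]_N).

Lemma Ck_setT0 f : Ck_closure 0 setT f <-> continuous f.
Proof.
rewrite /= closureT; split=> [[[g cg fg] _]|cf].
  have -> : f = g by apply/funext => x; exact: fg.
  by apply/continuous_subspace_setT.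
by split=> //; exists f => //; exact: continuous_subspaceT.
Qed.

Lemma Ck_setTS k f : Ck_closure k.+1 setT f <->
  continuous f /\ forall i, (forall x, derivable f x (delta_mx 0 i)) /\
    Ck_closure k setT (partial i f).
Proof.
split=> [[f0 fS]|[f0 fS]]; split=> //.
- by apply/Ck_setT0; split.
- by move=> i; have [fi ?] := fS i; split=> // x; exact: fi.
- by have [] : Ck_closure 0 setT f by apply/Ck_setT0.
- by move=> i; have [fi ?] := fS i; split=> // x _; exact: fi.
Qed.

Lemma Ck_continuous k f : Ck_closure k setT f -> continuous f.
Proof. by case: k => [/Ck_setT0|k /Ck_setTS []]. Qed.

Lemma Ck_pred k f : Ck_closure k.+1 setT f -> Ck_closure k setT f.
Proof.
elim: k f => [|k IH] f; first by move=> /Ck_continuous/Ck_setT0.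
move=> /Ck_setTS[cf fS]; apply/Ck_setTS; split=> // i; have [fi ?] := fS i.
by split=> //; exact: IH.
Qed.

Lemma Ck_cst k (c : R) : Ck_closure k setT (fun _ : 'rV[R]_N => c).
Proof.
elim: k c => [|k IH] c.
  by apply/Ck_setT0 => x; exact: cst_continuous.
apply/Ck_setTS; split=> [x|i]; first exact: cst_continuous.
split=> [x|]; first exact: derivable_cst.
have -> : partial i (fun _ : 'rV[R]_N => c) = (fun=> 0) by apply/funext => x; exact: derive_cst.
exact: IH.
Qed.

Lemma Ck_add k f g : Ck_closure k setT f -> Ck_closure k setT g ->
  Ck_closure k setT (fun x => f x + g x).
Proof.
elim: k f g => [|k IH] f g.
  move=> /Ck_setT0 cf /Ck_setT0 cg; apply/Ck_setT0.
  exact: continuous_add.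
move=> /Ck_setTS[cf fS] /Ck_setTS[cg gS]; apply/Ck_setTS; split=> [|i].
  exact: continuous_add.
have [fi f'] := fS i; have [gi g'] := gS i; split=> [x|]; first exact: derivableD.
have -> : partial i (fun x => f x + g x) = (fun x => partial i f x + partial i g x).
  by apply/funext => x; exact: deriveD.
exact: IH.
Qed.

Lemma Ck_mul k f g : Ck_closure k setT f -> Ck_closure k setT g ->
  Ck_closure k setT (fun x => f x * g x).
Proof.
elim: k f g => [|k IH] f g.
  move=> /Ck_setT0 cf /Ck_setT0 cg; apply/Ck_setT0.
  exact: continuous_mul.
move=> /[dup] /Ck_pred f0 /Ck_setTS[cf fS] /[dup] /Ck_pred g0 /Ck_setTS[cg gS].
apply/Ck_setTS; split=> [|i].
  exact: continuous_mul.
have [fi f'] := fS i; have [gi g'] := gS i; split=> [x|]; first exact: derivableM.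
have -> : partial i (fun x => f x * g x) =
    (fun x => f x * partial i g x + g x * partial i f x).
  by apply/funext => x; exact: deriveM.
by apply: Ck_add; apply: IH.
Qed.

Lemma Ck_inv k f : (forall x, f x != 0) -> Ck_closure k setT f ->
  Ck_closure k setT (fun x => (f x)^-1).
Proof.
move=> fN0; elim: k => [|k IH].
  by move=> /Ck_setT0 cf; apply/Ck_setT0; exact: continuous_inv.
move=> /[dup] /Ck_pred f0 /Ck_setTS[cf fS]; apply/Ck_setTS; split=> [|i].
  exact: continuous_inv.
have [fi f'] := fS i; split=> [x|]; first exact: derivableV.
have -> : partial i (fun x => (f x)^-1) =
    (fun x => (-1 * (f x)^-1 * (f x)^-1) * partial i f x).
  apply/funext => x; rewrite /partial deriveV// [LHS]/GRing.scale /= expr2 invfM.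
  by ring.
by apply: Ck_mul => //; apply: Ck_mul; [apply: Ck_mul; [exact: Ck_cst|]|];
  exact: IH.
Qed.

(** Along a basis direction a function of one coordinate is either a function on the line or
    constant. *)
Lemma is_derive_coord (phi : R -> R) (d : R) (i j : 'I_N) x :
  is_derive (x 0 j) 1 phi d ->
  is_derive x (delta_mx 0 i) (fun y : 'rV[R]_N => phi (y 0 j)) ((i == j)%:R * d).
Proof.
move=> [phid <-].
have E (v : 'rV[R]_N) : (fun h : R => h^-1 *: (((fun y : 'rV[R]_N => phi (y 0 j)) \o shift x)
    (h *: v) - phi (x 0 j))) =
  (fun h : R => h^-1 *: ((phi \o shift (x 0 j)) (h *: v 0 j) - phi (x 0 j))).
  by apply/funext => h /=; rewrite !mxE.
have Ev : (delta_mx 0 i : 'rV[R]_N) 0 j = (i == j)%:R.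
  by rewrite mxE eqxx /= eq_sym.
split; rewrite ?/derivable ?/derive E Ev.
  by case: eqP => _ //; exact: derivable0.
by case: eqP => _; [rewrite mul1r|rewrite mul0r; exact: derive0].
Qed.

(** The induction on [k] needs all indices [q] at once, since one derivative raises [q] to [q.+1]
    and [q.+2]. *)
Lemma Ck_flat_coord k q (a b : R) (j : 'I_N) :
  Ck_closure k setT (fun x : 'rV[R]_N => flat q (a * x 0 j + b)).
Proof.
have d q' y : is_derive y (1 : R) (fun y => flat q' (a * y + b))
    ((flat q'.+2 (a * y + b) - q'%:R * flat q'.+1 (a * y + b)) * a).
  have d1 : is_derive y (1 : R) (fun y : R => a * y + b) a.
    by apply: is_derive_eq; rewrite addr0 [_ *: _]mulr1.
  exact: (@is_derive1_comp _ (flat q') (fun y : R => a * y + b) y _ _ (is_derive_flat q' _) d1).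
have c q' : continuous (fun x : 'rV[R]_N => flat q' (a * x 0 j + b)).
  move=> x; apply: (@for_continuous_comp _ _ (fun x : 'rV[R]_N => x 0 j)
    (fun y => flat q' (a * y + b))); first exact: coord_continuous.
  apply/differentiable_continuous/derivable1_diffP.
  exact: (@ex_derive _ _ _ _ _ _ _ (d q' _)).
elim: k q => [|k IH] q; first exact/Ck_setT0/c.
apply/Ck_setTS; split=> [|i]; first exact: c.
have dc x := is_derive_coord i (d q (x 0 j)).
split=> [x|]; first exact: (@ex_derive _ _ _ _ _ _ _ (dc x)).
have -> : partial i (fun x : 'rV[R]_N => flat q (a * x 0 j + b)) = (fun x =>
    (i == j)%:R * ((flat q.+2 (a * x 0 j + b) + - q%:R * flat q.+1 (a * x 0 j + b)) * a)).
  by apply/funext => x; rewrite /partial derive_val mulNr.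
apply: Ck_mul; first exact: Ck_cst.
apply: Ck_mul; last exact: Ck_cst.
by apply: Ck_add => //; apply: Ck_mul => //; exact: Ck_cst.
Qed.

Lemma smooth_add f g : smooth f -> smooth g -> smooth (fun x => f x + g x).
Proof. by move=> sf sg k; apply: Ck_add. Qed.

Lemma smooth_mul f g : smooth f -> smooth g -> smooth (fun x => f x * g x).
Proof. by move=> sf sg k; apply: Ck_mul. Qed.

Lemma smooth_sum (I : Type) (r : seq I) (F : I -> 'rV[R]_N -> R) :
  (forall i, smooth (F i)) -> smooth (fun x => \sum_(i <- r) F i x).
Proof.
move=> sF; elim: r => [|i r IH].
  under eq_fun do rewrite big_nil; move=> k; exact: Ck_cst.
by under eq_fun do rewrite big_cons; exact: smooth_add.
Qed.

Lemma smooth_prod (I : Type) (r : seq I) (F : I -> 'rV[R]_N -> R) :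
  (forall i, smooth (F i)) -> smooth (fun x => \prod_(i <- r) F i x).
Proof.
move=> sF; elim: r => [|i r IH].
  under eq_fun do rewrite big_nil; move=> k; exact: Ck_cst.
by under eq_fun do rewrite big_cons; exact: smooth_mul.
Qed.

Lemma smooth_bump (a b : R) (j : 'I_N) :
  smooth (fun x : 'rV[R]_N => bump (a * x 0 j + b)).
Proof.
have ss c : smooth (fun x : 'rV[R]_N => step (a * x 0 j + c)).
  have -> : (fun x : 'rV[R]_N => step (a * x 0 j + c)) = (fun x =>
      flat 0 (a * x 0 j + c) *
      (flat 0 (a * x 0 j + c) + flat 0 (- a * x 0 j + (1 - c)))^-1).
    by apply/funext => x; rewrite /step; congr (_ / (_ + flat 0 _)); ring.
  move=> k; apply: Ck_mul; first exact: Ck_flat_coord.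
  apply: Ck_inv; last by apply: Ck_add; exact: Ck_flat_coord.
  move=> x; have -> : - a * x 0 j + (1 - c) = 1 - (a * x 0 j + c) by ring.
  by rewrite gt_eqF// step_den_gt0.
have -> : (fun x : 'rV[R]_N => bump (a * x 0 j + b)) =
    (fun x => step (a * x 0 j + (b + 1)) + -1 * step (a * x 0 j + b)).
  by apply/funext => x; rewrite /bump addrA mulN1r.
by apply: smooth_add => //; apply: smooth_mul => // k; exact: Ck_cst.
Qed.

End SmoothRV.

(** * Uniform approximation by smooth partitions of unity on a grid *)

Section GridApprox.
Context {R : realType} {N : nat}.
Variables (f : 'rV[R]_N -> R) (M e : R).
Hypothesis e0 : 0 < e.
Hypothesis fM : forall x i, f x != 0 -> `|x 0 i| <= M.

(** The grid reaches beyond [M + e], so the weights sum to one at every point within [e] of the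
    support of [f]. *)
Let L := (Num.truncn ((M + e) / e)).+1.
Let node (j : {ffun 'I_N -> 'I_(L + L).+1}) : 'rV[R]_N :=
  \row_i (e * ((j i : nat)%:R - L%:R)).
Let w (j : {ffun 'I_N -> 'I_(L + L).+1}) (x : 'rV[R]_N) : R :=
  \prod_i bump (e^-1 * x 0 i + - ((j i : nat)%:R - L%:R)).

(** Grid values of [f] interpolated by products of bumps: a smoothing that plays the role of
    convolution with a mollifier. *)
Definition grid_approx (x : 'rV[R]_N) : R := \sum_j f (node j) * w j x.

Let w_ge0 j (x : 'rV[R]_N) : 0 <= w j x.
Proof. by apply: prodr_ge0 => i _; exact: bump_ge0. Qed.

Let w_near j x i : w j x != 0 -> `|node j 0 i - x 0 i| < e.
Proof.
move=> /prodf_neq0/(_ i isT)/bump_supp h; rewrite mxE.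
have -> : e * ((j i : nat)%:R - L%:R) - x 0 i =
    - e * (e^-1 * x 0 i + - ((j i : nat)%:R - L%:R)).
  by field; rewrite gt_eqF.
by rewrite normrM normrN (gtr0_norm e0) gtr_pMr.
Qed.

Let sum_w (x : 'rV[R]_N) : (forall i, `|x 0 i| <= M + e) -> \sum_j w j x = 1.
Proof.
move=> xM; rewrite /w -(bigA_distr_bigA (fun i (k : 'I_(L + L).+1) =>
  bump (e^-1 * x 0 i + - ((k : nat)%:R - L%:R)))) /=.
apply: big1 => i _; apply: sum_bump; rewrite -ler_norml normrM.
rewrite gtr0_norm ?invr_gt0// mulrC ler_pdivrMr//.
apply: le_trans (xM i) _; rewrite -ler_pdivrMr//.
exact/ltW/truncnS_gt.
Qed.

Lemma grid_approx_smooth : smooth grid_approx.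
Proof.
apply: smooth_sum => j; apply: smooth_mul; first by move=> k; exact: Ck_cst.
by apply: smooth_prod => i; exact: smooth_bump.
Qed.

(** The value is a convex combination of values of [f] at nodes within [e] of [x]. Far out, where
    the weights may fail to sum to one, those values are all 0, and so is the approximation. *)
Lemma grid_approx_bound (lo hi : R) (x : 'rV[R]_N) :
  (forall y : 'rV[R]_N, (forall i, `|y 0 i - x 0 i| < e) -> lo <= f y <= hi) ->
  lo <= grid_approx x <= hi.
Proof.
move=> lohi.
have [xM|xM] := pselect (forall i, `|x 0 i| <= M + e).
  have := sum_w xM => w1; rewrite -[lo]mulr1 -[hi]mulr1 -w1 !mulr_sumr.
  apply/andP; split; apply: ler_sum => j _.
    have [->|wj] := eqVneq (w j x) 0; first by rewrite !mulr0.
    have /andP[h _] := lohi _ (fun i => w_near i wj); by rewrite ler_wpM2r.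
  have [->|wj] := eqVneq (w j x) 0; first by rewrite !mulr0.
  have /andP[_ h] := lohi _ (fun i => w_near i wj); by rewrite ler_wpM2r.
have fx (y : 'rV[R]_N) : (forall i, `|y 0 i - x 0 i| < e) -> f y = 0.
  move=> yx; apply/eqP/contraT => /fM fyM; exfalso; apply: xM => i.
  have := fyM i; have := yx i => h1 h2.
  rewrite -[x 0 i](subrK (y 0 i)) addrC; apply: le_trans (ler_normD _ _) _.
  by rewrite lerD// distrC ltW.
have -> : grid_approx x = 0.
  apply: big1 => j _; have [->|wj] := eqVneq (w j x) 0; first by rewrite mulr0.
  by rewrite (fx _ (fun i => w_near i wj)) mul0r.
have xx i : `|x 0 i - x 0 i| < e by rewrite subrr normr0.
by have := lohi x xx; rewrite (fx x xx).
Qed.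

End GridApprox.

(** * Integrable, square integrable and bounded functions *)

Section Integrals.
Context {R : realType} {N : nat}.
Implicit Types (A B : set (borel_rV R N)) (f g : 'rV[R]_N -> R).

Local Notation leb := (@lebesgue_rV R N : set (borel_rV R N) -> \bar R).

Definition meas_on A f : Prop :=
  measurable_fun A (f : borel_rV R N -> measurableTypeR R).

Definition L1 A f : Prop := leb.-integrable A (EFin \o f).

Definition L2 A f : Prop := meas_on A f /\ L1 A (fun x => f x ^+ 2).

Definition Linf A f : Prop :=
  meas_on A f /\ exists M, forall x, A x -> `|f x| <= M.

Lemma meas_onD A f g : meas_on A f -> meas_on A g -> meas_on A (fun x => f x + g x).
Proof. exact: measurable_funD. Qed.

Lemma meas_onM A f g : meas_on A f -> meas_on A g -> meas_on A (fun x => f x * g x).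
Proof. exact: measurable_funM. Qed.

Lemma meas_on_cst A (c : R) : meas_on A (fun=> c).
Proof. exact: measurable_cst. Qed.

Lemma meas_on_ext A f g : (forall x, A x -> f x = g x) ->
  meas_on A f -> meas_on A g.
Proof.
by move=> fg; apply: eq_measurable_fun => x; rewrite inE => Ax; exact: fg.
Qed.

Lemma L1_meas A f : L1 A f -> meas_on A f.
Proof. by move=> /integrableP[mf _]; exact/measurable_EFinP. Qed.

Section On.
Variable A : set (borel_rV R N).
Hypothesis mA : measurable A.

Lemma L1_ext f g : (forall x, A x -> f x = g x) -> L1 A f -> L1 A g.
Proof.
move=> fg; apply: eq_integrable => // x; rewrite inE => Ax /=.
by rewrite fg.
Qed.

Lemma L1D f g : L1 A f -> L1 A g -> L1 A (fun x => f x + g x).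
Proof. by move=> If Ig; exact: (@eq_integrable _ _ _ leb _ mA _ _ _ (integrableD mA If Ig)). Qed.

Lemma L1Z (c : R) f : L1 A f -> L1 A (fun x => c * f x).
Proof. by move=> If; exact: (@eq_integrable _ _ _ leb _ mA _ _ _ (integrableZl mA c If)). Qed.

Lemma L1N f : L1 A f -> L1 A (fun x => - f x).
Proof. by move=> /(L1Z (-1)); apply: L1_ext => x _; rewrite mulN1r. Qed.

Lemma L1B f g : L1 A f -> L1 A g -> L1 A (fun x => f x - g x).
Proof. by move=> If /L1N; exact: L1D. Qed.

Lemma L1_0 : L1 A (fun=> 0).
Proof. exact: integrable0. Qed.

Lemma L1_sum (I : Type) (s : seq I) (F : I -> 'rV[R]_N -> R) :
  (forall i, L1 A (F i)) -> L1 A (fun x => \sum_(i <- s) F i x).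
Proof.
move=> IF; elim: s => [|i s IH].
  by apply: L1_ext L1_0 => x _; rewrite big_nil.
by apply: L1_ext (L1D (IF i) IH) => x _; rewrite big_cons.
Qed.

Lemma L1_le f g : meas_on A f -> (forall x, A x -> `|f x| <= g x) ->
  L1 A g -> L1 A f.
Proof.
move=> mf fg; apply: le_integrable => //; first exact/measurable_EFinP.
move=> x Ax; rewrite lee_fin /=; apply: le_trans (fg x Ax) _; exact: ler_norm.
Qed.

Lemma L1_norm f : L1 A f -> L1 A (fun x => `|f x|).
Proof. exact: integrable_norm. Qed.

Lemma vol_int_ext f g : (forall x, A x -> f x = g x) ->
  vol_int A f = vol_int A g.
Proof.
move=> fg; rewrite /vol_int; congr fine; apply: eq_integral => x; rewrite inE.
by move=> Ax /=; rewrite fg.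
Qed.

Lemma vol_intD f g : L1 A f -> L1 A g ->
  vol_int A (fun x => f x + g x) = vol_int A f + vol_int A g.
Proof. exact: (@RintegralD _ _ _ leb). Qed.

Lemma vol_intB f g : L1 A f -> L1 A g ->
  vol_int A (fun x => f x - g x) = vol_int A f - vol_int A g.
Proof. exact: (@RintegralB _ _ _ leb). Qed.

Lemma vol_intZ (c : R) f : L1 A f ->
  vol_int A (fun x => c * f x) = c * vol_int A f.
Proof. exact: (@RintegralZl _ _ _ leb). Qed.

Lemma vol_intN f : L1 A f -> vol_int A (fun x => - f x) = - vol_int A f.
Proof.
by move=> If; rewrite -mulN1r -vol_intZ//; apply: vol_int_ext => x _; rewrite mulN1r.
Qed.

Lemma vol_int0 : vol_int A (fun=> 0) = 0.
Proof. by rewrite /vol_int integral0. Qed.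

Lemma vol_int_sum (I : Type) (s : seq I) (F : I -> 'rV[R]_N -> R) :
  (forall i, L1 A (F i)) ->
  vol_int A (fun x => \sum_(i <- s) F i x) = \sum_(i <- s) vol_int A (F i).
Proof.
move=> IF; elim: s => [|i s IH].
  by rewrite big_nil -[RHS]vol_int0; apply: vol_int_ext => x _; rewrite big_nil.
rewrite big_cons -IH -vol_intD//; last exact: L1_sum.
by apply: vol_int_ext => x _; rewrite big_cons.
Qed.

Lemma vol_int_le f g : L1 A f -> L1 A g -> (forall x, A x -> f x <= g x) ->
  vol_int A f <= vol_int A g.
Proof. exact: (@le_Rintegral _ _ _ leb). Qed.

Lemma vol_int_ge0 f : (forall x, A x -> 0 <= f x) -> 0 <= vol_int A f.
Proof. exact: (@Rintegral_ge0 _ _ _ leb). Qed.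

Lemma vol_int_norm f : L1 A f -> `|vol_int A f| <= vol_int A (fun x => `|f x|).
Proof. exact: (@le_normr_Rintegral _ _ _ leb). Qed.

Lemma EFin_vol_int f : L1 A f ->
  (vol_int A f)%:E = (\int[leb]_(x in A) (f x)%:E)%E.
Proof. by move=> If; rewrite /vol_int fineK//; exact: integrable_fin_num. Qed.

Lemma L1P f : (forall x, A x -> 0 <= f x) -> meas_on A f ->
  L1 A f <-> (\int[leb]_(x in A) (f x)%:E < +oo)%E.
Proof.
move=> f0 mf; split=> [/integrableP[_]|foo].
  apply: le_lt_trans; rewrite le_eqVlt; apply/orP; left; apply/eqP.
  by apply: eq_integral => x; rewrite inE => /f0 fx /=; rewrite ger0_norm.
apply/integrableP; split; first exact/measurable_EFinP.
apply: le_lt_trans foo; rewrite le_eqVlt; apply/orP; left; apply/eqP.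
by apply: eq_integral => x; rewrite inE => /f0 fx /=; rewrite ger0_norm.
Qed.

Lemma L2_mul f g : L2 A f -> L2 A g -> L1 A (fun x => f x * g x).
Proof.
move=> [mf f2] [mg g2]; apply: L1_le (L1D f2 g2); first exact: meas_onM.
move=> x _; rewrite ler_norml; apply/andP; split; last first.
  by have := sqr_ge0 (f x - g x); have := sqr_ge0 (f x); have := sqr_ge0 (g x);
     rewrite !expr2; nra.
by have := sqr_ge0 (f x + g x); have := sqr_ge0 (f x); have := sqr_ge0 (g x);
     rewrite !expr2; nra.
Qed.

Lemma L2D f g : L2 A f -> L2 A g -> L2 A (fun x => f x + g x).
Proof.
move=> Lf Lg; split; first by apply: meas_onD; [have [] := Lf|have [] := Lg].
have := L1D (L1D Lf.2 Lg.2) (L1Z 2 (L2_mul Lf Lg)).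
by apply: L1_ext => x _; ring.
Qed.

Lemma L2_Linf f g : Linf A f -> L2 A g -> L2 A (fun x => f x * g x).
Proof.
move=> [mf [M fM]] [mg g2]; split; first exact: meas_onM.
apply: L1_le (L1Z (M ^+ 2) g2).
  by apply: meas_onM; apply: meas_onM.
move=> x Ax; rewrite ger0_norm ?sqr_ge0// exprMn ler_wpM2r ?sqr_ge0//.
by rewrite -ler_sqrt ?sqr_ge0 ?sqrtr_sqr//; apply: le_trans (fM x Ax) (ler_norm _).
Qed.

Lemma Linf_L1 f g : Linf A f -> L1 A g -> L1 A (fun x => f x * g x).
Proof.
move=> [mf [M fM]] Ig.
apply: L1_le (L1Z M (L1_norm Ig)); first by apply: meas_onM => //; exact: L1_meas.
by move=> x Ax; rewrite normrM ler_wpM2r// fM.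
Qed.

Lemma Linf_cst (c : R) : Linf A (fun=> c).
Proof. by split; [exact: meas_on_cst|exists `|c|]. Qed.

Lemma LinfD f g : Linf A f -> Linf A g -> Linf A (fun x => f x + g x).
Proof.
move=> [mf [M fM]] [mg [M' gM]]; split; first exact: meas_onD.
exists (M + M') => x Ax; apply: le_trans (ler_normD _ _) _.
by rewrite lerD ?fM ?gM.
Qed.

Lemma LinfM f g : Linf A f -> Linf A g -> Linf A (fun x => f x * g x).
Proof.
move=> [mf [M fM]] [mg [M' gM]]; split; first exact: meas_onM.
by exists (M * M') => x Ax; rewrite normrM ler_pM ?fM ?gM.
Qed.

Lemma Linf_ext f g : (forall x, A x -> f x = g x) -> Linf A f -> Linf A g.
Proof.
move=> fg [mf [M fM]]; split; first exact: meas_on_ext mf.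
by exists M => x Ax; rewrite -fg ?fM.
Qed.

Lemma L2_ext f g : (forall x, A x -> f x = g x) -> L2 A f -> L2 A g.
Proof.
move=> fg [mf f2]; split; first exact: meas_on_ext mf.
by apply: L1_ext f2 => x Ax; rewrite fg.
Qed.

Lemma LinfB f g : Linf A f -> Linf A g -> Linf A (fun x => f x - g x).
Proof.
move=> Lf Lg; apply: Linf_ext (LinfD Lf (LinfM (Linf_cst (-1)) Lg)) => x _.
by rewrite mulN1r.
Qed.

Lemma L2Z (c : R) f : L2 A f -> L2 A (fun x => c * f x).
Proof. by move=> Lf; apply: L2_Linf => //; exact: Linf_cst. Qed.

Lemma L2B f g : L2 A f -> L2 A g -> L2 A (fun x => f x - g x).
Proof.
by move=> Lf /(L2Z (-1)) Lg; apply: L2_ext (L2D Lf Lg) => x _; rewrite mulN1r.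
Qed.

Section Finite.
Hypothesis Afin : (leb A < +oo)%E.

Lemma L1_cst (c : R) : L1 A (fun=> c).
Proof.
apply/integrableP; split; first by apply/measurable_EFinP; exact: meas_on_cst.
by rewrite integral_cst//= lte_mul_pinfty.
Qed.

Lemma Linf_in_L1 f : Linf A f -> L1 A f.
Proof.
by move=> Lf; apply: L1_ext (Linf_L1 Lf (L1_cst 1)) => x _; rewrite mulr1.
Qed.

Lemma Linf_in_L2 f : Linf A f -> L2 A f.
Proof.
by move=> Lf; split; [have [] := Lf|apply: Linf_in_L1; exact: LinfM].
Qed.

Lemma L2_in_L1 f : L2 A f -> L1 A f.
Proof.
move=> Lf; apply: L1_ext (L2_mul Lf (Linf_in_L2 (Linf_cst 1))) => x _.
by rewrite mulr1.
Qed.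

Lemma vol_int_cst (c : R) : vol_int A (fun=> c) = c * vol_int A (fun=> 1).
Proof.
by rewrite -(vol_intZ _ (L1_cst 1)); apply: vol_int_ext => x _; rewrite mulr1.
Qed.

End Finite.
End On.

Lemma vol_int_sub A B f : A `<=` B -> (forall x, B x -> ~ A x -> f x = 0) ->
  vol_int B f = vol_int A f.
Proof.
move=> AB f0; rewrite /vol_int integral_mkcond [in RHS]integral_mkcond; congr fine.
apply: eq_integral => x _; rewrite /patch.
case: ifPn => xB; case: ifPn => xA //; last first.
  by exfalso; move/negP: xB; apply; apply/mem_set/AB/set_mem.
by rewrite /= f0 //; [exact: set_mem|move=> Ax; move/negP: xA; apply; exact: mem_set].
Qed.

Lemma L1_sub A B f : measurable A -> measurable B -> A `<=` B -> L1 B f -> L1 A f.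
Proof. by move=> mA mB AB; apply: integrableS. Qed.

Lemma L1_extend A B f : measurable A -> measurable B -> A `<=` B ->
  (forall x, B x -> ~ A x -> f x = 0) -> L1 A f -> L1 B f.
Proof.
move=> mA mB AB f0 /(integrable_mkcond _ mA) If; apply/(integrable_mkcond _ mB).
apply: eq_integrable If => // x _; rewrite /patch.
case: ifPn => xA; case: ifPn => xB //.
  by exfalso; move/negP: xB; apply; apply/mem_set/AB/set_mem.
by rewrite /= f0 //; [exact: set_mem|move=> Ax; move/negP: xA; apply; exact: mem_set].
Qed.

Lemma measurable_shift_set A (v : 'rV[R]_N) : measurable A ->
  measurable ([set x : 'rV[R]_N | A (x + v)] : set (borel_rV R N)).
Proof.
by move=> mA; rewrite -[X in measurable X]setTI; apply: (@measurable_shift R N v).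
Qed.

(** Change of variables as a push-forward, which agrees with Lebesgue measure by invariance. *)
Lemma ge0_integral_shift A (v : 'rV[R]_N) (g : borel_rV R N -> \bar R) :
  measurable A -> measurable_fun A g -> (forall x, A x -> (0 <= g x)%E) ->
  (\int[leb]_(x in [set x : 'rV[R]_N | A (x + v)%R]) g ((x : 'rV[R]_N) + v)%R)%E =
  (\int[leb]_(x in A) g x)%E.
Proof.
move=> mA mg g0.
transitivity (\int[pushforward leb (fun x : borel_rV R N =>
    ((x : 'rV[R]_N) + v)%R : borel_rV R N)]_(x in A) g x)%E.
  rewrite ge0_integral_pushforward//; first exact: measurable_shift.
  by move=> x; rewrite inE; exact: g0.
apply: eq_measure_integral; first exact: measurable_shift.
by move=> ms C mC _; exact: lebesgue_shift.
Qed.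

Lemma vol_int_shift A (v : 'rV[R]_N) f : measurable A -> L1 A f ->
  vol_int [set x : 'rV[R]_N | A (x + v)] (fun x => f (x + v)) = vol_int A f.
Proof.
move=> mA /integrableP[mf _]; rewrite /vol_int; congr fine.
rewrite integralE [RHS]integralE; congr (_ - _)%E.
  transitivity (\int[leb]_(x in [set x : 'rV[R]_N | A (x + v)%R])
      (EFin \o f)^\+ ((x : 'rV[R]_N) + v)%R)%E.
    by congr integral; apply/funext => x; rewrite !funeposE.
  apply: (@ge0_integral_shift A v (EFin \o f)^\+%E) => //.
  exact: measurable_funepos.
transitivity (\int[leb]_(x in [set x : 'rV[R]_N | A (x + v)%R])
    (EFin \o f)^\- ((x : 'rV[R]_N) + v)%R)%E.
  by congr integral; apply/funext => x; rewrite !funenegE.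
apply: (@ge0_integral_shift A v (EFin \o f)^\-%E) => //.
exact: measurable_funeneg.
Qed.

Lemma meas_on_shift A (v : 'rV[R]_N) f : measurable A -> meas_on A f ->
  meas_on [set x : 'rV[R]_N | A (x + v)] (fun x => f (x + v)).
Proof.
move=> mA mf; apply: (@measurable_comp _ _ _ _ _ _ A
  (f : borel_rV R N -> measurableTypeR R) _
  (fun x : borel_rV R N => (x : 'rV[R]_N) + v : borel_rV R N)) => //.
  by move=> _ [x Ax <-].
by apply: measurable_funTS; exact: measurable_shift.
Qed.

Lemma L1_shift A (v : 'rV[R]_N) f : measurable A -> L1 A f ->
  L1 [set x : 'rV[R]_N | A (x + v)] (fun x => f (x + v)).
Proof.
move=> mA If; have mf := L1_meas If; apply/integrableP; split.
  by apply/measurable_EFinP; exact: meas_on_shift.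
rewrite (@ge0_integral_shift A v (fun x => `|(f x)%:E|)%E)//.
  by move/integrableP: If => [].
by apply/measurable_EFinP/measurableT_comp.
Qed.

End Integrals.

(** * Erosions of open sets and uniform radii on compact sets *)

Section Erosion.
Context {R : realType} {N : nat}.
Implicit Types (A K : set 'rV[R]_N) (x y : 'rV[R]_N) (f w : 'rV[R]_N -> R).

(** The near-covering form of compactness turns local radii into a single one. *)
Lemma compact_uniform K (P : R -> 'rV[R]_N -> Prop) : compact K ->
  (forall x, K x -> exists2 e : R, 0 < e & forall y d,
     (forall i, `|y 0 i - x 0 i| < e) -> 0 < d < e -> P d y) ->
  exists2 d : R, 0 < d & forall x, K x -> P d x.
Proof.
move=> /compact_near_coveringP cK KP.
have h : \forall d \near (0 : R)^'+, K `<=` P d.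
  apply: cK => x Kx; have [e e0 eP] := KP x Kx.
  exists ([set y : 'rV[R]_N | forall i, `|y 0 i - x 0 i| < e], [set d | 0 < d < e]) => /=.
    split; first by apply/nbhs_rVP; exists e.
    near=> d; apply/andP; split; near: d; first exact: nbhs_right_gt.
    exact: nbhs_right_lt.
  by move=> [y d] /= [ye de]; exact: eP.
have [d [d0 dK]] : exists d : R, 0 < d /\ K `<=` P d.
  have : \forall d \near (0 : R)^'+, 0 < d /\ K `<=` P d.
    by apply: filterS2 (nbhs_right_gt 0) h => d.
  exact: filter_ex.
by exists d.
Unshelve. all: by end_near. Qed.

Lemma compact_cube (c : 'rV[R]_N) (r : R) : compact (cube c r).
Proof.
apply: bounded_closed_compact; last exact: closed_cube.
exists (`|c| + `|r|); split; first exact: num_real.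
move=> M cM x xc; apply/mx_norm_leP; first exact: le_trans (ltW cM).
move=> i; rewrite -[x 0 i](subrK (c 0 i)) addrC.
apply: le_trans (ler_normD _ _) _; apply: le_trans (ltW cM).
by apply: lerD; [exact: coord_norm_le|exact: le_trans (xc i) (ler_norm r)].
Qed.

Lemma compact_continuous_bounded K f : compact K -> {within K, continuous f} ->
  exists2 M, 0 <= M & forall x, K x -> `|f x| <= M.
Proof.
move=> cK cf; have /compact_bounded[M [_ Mf]] := continuous_compact cf cK.
exists (`|M| + 1); first by rewrite addr_ge0.
by move=> x Kx; apply: Mf; [rewrite (le_lt_trans (ler_norm M))// ltrDl|exists x].
Qed.

Lemma continuous_cube_bounded f (c : 'rV[R]_N) (r : R) : continuous f ->
  exists2 M, 0 <= M & forall x, cube c r x -> `|f x| <= M.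
Proof.
move=> cf; apply: compact_continuous_bounded; first exact: compact_cube.
exact: continuous_subspaceT.
Qed.

(** Heine's theorem on the cube of radius [M + 1]; a step shorter than 1 that starts outside this
    cube stays where [w] vanishes. *)
Lemma uniform_continuous_bounded_support w (M : R) : continuous w ->
  (forall x i, w x != 0 -> `|x 0 i| <= M) -> forall e, 0 < e ->
  exists2 d : R, 0 < d & forall x y : 'rV[R]_N,
    (forall i, `|y 0 i - x 0 i| < d) -> `|w y - w x| < e.
Proof.
move=> cw wM e e0.
have [|d d0 dP] := @compact_uniform (cube 0 (M + 1)) (fun d x =>
    forall y : 'rV[R]_N, (forall i, `|y 0 i - x 0 i| < d) -> `|w y - w x| < e)
    (@compact_cube _ _); last first.
  exists (Num.min d 1) => [|x y xy]; first by rewrite lt_min d0 ltr01.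
  have [xM|/existsNP[i /negP]] := pselect (cube 0 (M + 1) x).
    by apply: dP => // i; have := xy i; rewrite lt_min => /andP[].
  rewrite mxE subr0 -ltNge => Mx.
  have [wx|/(wM x i) ?] := eqVneq (w x) 0; last by exfalso; lra.
  have [wy|/(wM y i)] := eqVneq (w y) 0; first by rewrite wx wy subrr normr0.
  have := xy i; rewrite lt_min => /andP[_ h1] h2.
  have := ler_distD (y 0 i) (x 0 i) 0; rewrite !subr0 distrC => h3.
  by exfalso; lra.
move=> x _.
have : nbhs x [set y | `|w y - w x| < e / 2].
  have /cvgrPdist_lt/(_ (e / 2)) := cw x; rewrite divr_gt0// => /(_ isT).
  by apply: filterS => y /=; rewrite distrC.
move=> /nbhs_rVP[r r0 rw]; exists (Num.min 1 (r / 2)).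
  by rewrite lt_min ltr01 divr_gt0.
move=> y d yx /andP[d0 ]; rewrite lt_min => /andP[d1 dr].
move=> z zy.
have wy : `|w y - w x| < e / 2.
  apply: rw => i; have := yx i; rewrite lt_min => /andP[_ h]; apply: lt_trans h _.
  by move: r0; lra.
have wz : `|w z - w x| < e / 2.
  apply: rw => i; rewrite -[_ - _](subrKA (y 0 i)).
  apply: le_lt_trans (ler_normD _ _) _; rewrite [ltRHS]splitr; apply: ltrD.
    exact: lt_trans (zy i) dr.
  by have := yx i; rewrite lt_min => /andP[].
rewrite -[_ - _](subrKA (w x)); apply: le_lt_trans (ler_normD _ _) _.
by rewrite [ltRHS](splitr e) ltrD// distrC.
Qed.

(** Erosions exhaust an open set by closed sets; a support inside one leaves room [r] for
    translations. *)
Definition erode A (r : R) : set 'rV[R]_N :=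
  [set x | forall y : 'rV[R]_N, (forall i, `|y 0 i - x 0 i| < r) -> A y].

Lemma erode_sub A r : 0 < r -> erode A r `<=` A.
Proof. by move=> r0 x; apply => i; rewrite subrr normr0. Qed.

Lemma erode_near A r d x y : erode A r x -> (forall i, `|y 0 i - x 0 i| <= d) ->
  erode A (r - d) y.
Proof.
move=> rx yx z zy; apply: rx => i; rewrite -[_ - _](subrKA (y 0 i)).
apply: le_lt_trans (ler_normD _ _) _.
by rewrite -[r](subrK d) ltr_leD.
Qed.

Lemma erode_le A r s : r <= s -> erode A s `<=` erode A r.
Proof. by move=> rs x sx y yx; apply: sx => i; exact: lt_le_trans (yx i) rs. Qed.

Lemma closed_erode A r : 0 < r -> closed (erode A r).
Proof.
move=> r0; rewrite -[erode A r]setCK; apply: open_closedC; rewrite openE => x.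
move=> /existsNP[y /not_implyP[yx nAy]].
have /mx_norm_ltP-/(_ r0) : forall i, `|(y - x) 0 i| < r.
  by move=> i; rewrite !mxE; exact: yx.
move=> yxr; apply/nbhs_rVP; exists (r - `|y - x|); first by rewrite subr_gt0.
move=> z zx /= zr; apply: nAy; apply: zr => i.
rewrite -[_ - _](subrKA (x 0 i)); apply: le_lt_trans (ler_normD _ _) _.
have h1 := coord_norm_le (y - x) i; rewrite !mxE in h1.
by have := zx i; rewrite [`|x 0 i - _|]distrC => h2; lra.
Qed.

Lemma compact_erode A K : compact K -> open A -> K `<=` A ->
  exists2 r : R, 0 < r & K `<=` erode A r.
Proof.
move=> cK oA KA.
have [|r r0 rP] := @compact_uniform K (fun r => erode A r) cK; last by exists r.
move=> x Kx; have /nbhs_rVP[e e0 eA] := open_nbhs_nbhs (conj oA (KA _ Kx)).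
exists (e / 2); first exact: divr_gt0.
move=> y d yx /andP[_ de] z zy; apply: eA => i; rewrite -[_ - _](subrKA (y 0 i)).
apply: le_lt_trans (ler_normD _ _) _; rewrite [ltRHS]splitr ltrD//.
exact: lt_trans (zy i) de.
Qed.

Lemma test_function_erode A eta : open A -> test_function A eta ->
  exists2 r : R, 0 < r & forall x, eta x != 0 -> erode A r x.
Proof.
move=> oA [_ [K [cK KA eK]]]; have [r r0 rK] := compact_erode cK oA KA.
exists r => // x ex; apply: rK; apply: contrapT => /eK e0.
by rewrite e0 eqxx in ex.
Qed.

Lemma erode_test_function A eta r : bounded_set A -> smooth eta -> 0 < r ->
  (forall x, eta x != 0 -> erode A r x) -> test_function A eta.
Proof.
move=> bA se r0 er; split=> //; exists (erode A r); split.
- apply: bounded_closed_compact; last exact: closed_erode.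
  have [M [Mr MA]] := bA; exists M; split=> // k Mk x /(erode_sub r0).
  exact: MA.
- exact: erode_sub.
- by move=> x nx; apply/eqP; apply: contrapT => /negP /er.
Qed.

End Erosion.

(** * Finite differences of weakly differentiable functions *)

Section Increment.
Context {R : realType} {N : nat}.
Implicit Types (w f eta : 'rV[R]_N -> R) (x y : 'rV[R]_N).
Variable Om : set 'rV[R]_N.
Hypotheses (oOm : open Om) (bOm : bounded_set Om).

Local Notation leb := (@lebesgue_rV R N : set (borel_rV R N) -> \bar R).

Lemma domain_measurable : measurable (Om : set (borel_rV R N)).
Proof. exact: open_measurable_rV. Qed.

Lemma domain_finite : (leb Om < +oo)%E.
Proof. by apply: lebesgue_bounded_lty => //; exact: domain_measurable. Qed.

Lemma compact_closure_domain : compact (closure Om).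
Proof.
have [r r0 Or] := bounded_cube bOm.
apply: (@subclosed_compact _ _ (cube (0 : 'rV[R]_N) r)).
- exact: closed_closure.
- exact: compact_cube.
- have /closure_id -> : closed (cube (0 : 'rV[R]_N) r) by exact: closed_cube.
  exact: closureS.
Qed.

Lemma continuous_meas_on f : {in Om, continuous f} -> meas_on Om f.
Proof.
move=> cf; apply: (measurability _ (measurable_realfun.RGenOpens.measurableE R)).
move=> _ [_ [a [b ->]] <-]; apply: open_measurable_rV; rewrite openE => x [Ox fx].
apply: filterI; first exact: open_nbhs_nbhs.
by apply: (cf x (mem_set Ox)); apply: open_nbhs_nbhs; split=> //; exact: interval_open.
Qed.

Lemma within_closure_in f : {within closure Om, continuous f} ->
  {in Om, continuous f}.
Proof.
move=> cf; rewrite -continuous_open_subspace//.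
by apply: continuous_subspaceW cf; exact: subset_closure.
Qed.

Lemma within_closure_Linf f : {within closure Om, continuous f} -> Linf Om f.
Proof.
move=> cf; split; first by apply: continuous_meas_on; exact: within_closure_in.
have [M _ fM] := compact_continuous_bounded compact_closure_domain cf.
by exists M => x /subset_closure; exact: fM.
Qed.

Lemma continuous_Linf f : continuous f -> Linf Om f.
Proof. by move=> cf; apply: within_closure_Linf; exact: continuous_subspaceT. Qed.

Lemma compact_support_cube f r : 0 < r ->
  (forall x, f x != 0 -> erode Om r x) ->
  exists M : R, forall x i, f x != 0 -> `|x 0 i| <= M.
Proof.
move=> r0 fr; have [M _ OM] := bounded_cube bOm.
by exists M => x i /fr/(erode_sub r0)/OM/(_ i); rewrite mxE subr0.
Qed.

(** A translation is moved from [u] to [w]. The support condition lets both integrals be restricted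
    to sets that the translation exchanges. *)
Lemma vol_int_shift_support (u w : 'rV[R]_N -> R) (v : 'rV[R]_N) :
  (forall x, w x != 0 -> Om x /\ Om (x + v)) ->
  L1 Om (fun x => u x * w (x - v)) ->
  vol_int Om (fun x => u (x + v) * w x) = vol_int Om (fun x => u x * w (x - v)) /\
  L1 Om (fun x => u (x + v) * w x).
Proof.
move=> wO Iuw; pose B : set (borel_rV R N) := [set y : 'rV[R]_N | Om y /\ Om (y - v)].
pose A : set (borel_rV R N) := [set x : 'rV[R]_N | B (x + v)].
have mB : measurable B.
  apply: measurableI; first exact: domain_measurable.
  exact: (measurable_shift_set (- v) domain_measurable).
have mA : measurable A := measurable_shift_set v mB.
have AO : A `<=` Om by move=> x [_] /=; rewrite addrK.
have BO : B `<=` Om by move=> x [].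
have wA x : ~ A x -> w x = 0.
  move=> nA; apply/eqP/contraT => /wO[Ox Oxv]; exfalso; apply: nA.
  by split=> //=; rewrite addrK.
have IB : L1 B (fun x => u x * w (x - v)) := L1_sub mB domain_measurable BO Iuw.
have E : (fun x => u (x + v) * w (x + v - v)) = (fun x => u (x + v) * w x).
  by apply/funext => x; rewrite addrK.
split; last first.
  apply: (L1_extend mA domain_measurable AO).
    by move=> x _ /wA ->; rewrite mulr0.
  by rewrite -E; exact: (L1_shift v mB IB).
rewrite (vol_int_sub AO); last by move=> x _ /wA ->; rewrite mulr0.
rewrite -E (vol_int_shift v mB IB); apply: esym; apply: (vol_int_sub BO) => x Ox nB.
rewrite wA ?mulr0// => -[/= Ox1 Ox2]; apply: nB; split=> //.
by move: Ox2; rewrite subrK.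
Qed.

End Increment.
Section Directional.
Context {R : realType} {N : nat}.
Implicit Types (u p w f eta : 'rV[R]_N -> R) (x y : 'rV[R]_N).
Variable Om : set 'rV[R]_N.
Hypotheses (oOm : open Om) (bOm : bounded_set Om).
Variable i : 'I_N.

Local Notation leb := (@lebesgue_rV R N : set (borel_rV R N) -> \bar R).
Local Notation e := (delta_mx 0 i : 'rV[R]_N).
Let mOm := domain_measurable oOm.
Let fOm := domain_finite oOm bOm.

(** For a smooth weight [w] supported here, every translate [w (x - s *: e)] with [0 <= s <= t] is
    still a test function in [Om]. *)
Definition sweep (t r : R) : set 'rV[R]_N :=
  [set x | forall s, 0 <= s <= t -> erode Om r (x + s *: e)].

Definition weak_partial u p : Prop := forall eta, test_function Om eta ->
  vol_int Om (fun x => u x * partial i eta x) = - vol_int Om (fun x => p x * eta x).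

Lemma norm_shift_le (s : R) j : `|(s *: e) 0 j| <= `|s|.
Proof. by rewrite !mxE normrM ler_piMr// normr_nat; case: (_ && _). Qed.

Lemma continuous_shift w (v : 'rV[R]_N) : continuous w ->
  continuous (fun x => w (x - v)).
Proof.
move=> cw x; apply: (@continuous_comp _ _ _ (fun x : 'rV[R]_N => x - v) w).
  exact: (cvgB cvg_id (cvg_cst v)).
exact: cw.
Qed.

Lemma is_derive_line w x (s : R) : (forall y, derivable w y e) ->
  is_derive s (1 : R) (fun s => w (x - s *: e)) (- partial i w (x - s *: e)).
Proof.
move=> dw.
have d1 (a : R) : is_derive a (1 : R) (fun s => w (x + s *: e)) (partial i w (x + a *: e)).
  have E : (fun h : R => h^-1 *: (((fun s => w (x + s *: e)) \o shift a) (h *: (1 : R))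
      - w (x + a *: e))) =
    (fun h : R => h^-1 *: ((w \o shift (x + a *: e)) (h *: e) - w (x + a *: e))).
    apply/funext => h /=; congr (_ *: (w _ - _)).
    by rewrite [_ *: 1]mulr1 scalerDl addrCA.
  have := dw (x + a *: e); rewrite /derivable => dwa.
  by split; rewrite ?/derivable ?/derive E.
have := @is_derive1_comp _ (fun s => w (x + s *: e)) -%R s _ _ (d1 (- s)) (is_deriveNid s (1 : R)).
rewrite mulrN1 scaleNr.
have -> // : (fun s => w (x + s *: e)) \o -%R = (fun s => w (x - s *: e)).
by apply/funext => h /=; rewrite scaleNr.
Qed.

(** Differentiation under the integral sign, with a constant majorant. *)
Lemma is_derive_translate u w s : Linf Om u -> smooth w ->
  is_derive s (1 : R) (fun s => vol_int Om (fun x => u x * w (x - s *: e)))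
   (vol_int Om (fun x => u x * - partial i w (x - s *: e))).
Proof.
move=> Lu sw; have cw := Ck_continuous (sw 0%N).
have /Ck_setTS[_ /(_ i)[dw /Ck_continuous cdw]] := sw 1%N.
have [_ [M uM]] := Lu.
have [r r0 Or] := bounded_cube bOm.
(* [Om] lies in the cube of radius [r], and parameters within 1 of [s] translate it by at most
   [|s| + 1]. *)
have [M' M'0 wM] := continuous_cube_bounded (0 : 'rV[R]_N) (r + (`|s| + 1)) cdw.
pose f (a : R) (x : borel_rV R N) : R := u x * w ((x : 'rV[R]_N) - a *: e).
have sI : (`]s - 1, s + 1[%classic : set R) s by rewrite /= in_itv /= gtrBl ltrDl ltr01.
have df a x : is_derive a (1 : R) (f ^~ x) (u x * - partial i w ((x : 'rV_N) - a *: e)).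
  have dl := is_derive_line (x : 'rV[R]_N) a dw.
  exact: (@is_deriveZ R R^o R^o (fun a : R => w ((x : 'rV[R]_N) - a *: e)) (u x) a 1 _ dl).
have intf a : leb.-integrable Om (EFin \o f a).
  apply: (@L1_ext _ _ _ mOm (f a)) => //; apply: Linf_in_L1 => //.
  apply: LinfM => //; apply: continuous_Linf => //; exact: continuous_shift.
have G_ub : forall a x, (`]s - 1, s + 1[%classic : set R) a -> Om x ->
    `|partial1of2 f a x| <= `|M| * M'.
  move=> a x; rewrite /= in_itv /= => /andP[a1 a2] Ox.
  rewrite partial1of2E derive_val normrM normrN; apply: ler_pM => //.
    exact: le_trans (uM x Ox) (ler_norm M).
  apply: wM => j.
  have -> : ((x : 'rV[R]_N) - a *: e) 0 j - (0 : 'rV[R]_N) 0 j =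
      (x : 'rV[R]_N) 0 j - (a *: e) 0 j by rewrite !mxE subr0.
  apply: le_trans (ler_normB _ _) _.
  apply: lerD; first by have := Or x Ox j; rewrite mxE subr0.
  apply: le_trans (norm_shift_le a j) _.
  by rewrite ler_norml; apply/andP; split; have := ler_norm s; have := ler_norm (- s); rewrite normrN; lra.
have derf a x : (`]s - 1, s + 1[%classic : set R) a -> Om x -> derivable (f ^~ x) a 1.
  by move=> _ _; exact: (@ex_derive _ _ _ _ _ _ _ (df a x)).
have iG : leb.-integrable Om (EFin \o (fun=> `|M| * M')) := L1_cst mOm fOm _.
have G0 (x : borel_rV R N) : 0 <= `|M| * M' by rewrite mulr_ge0.
have D1 := @derivable_under_integral R _ _ leb f Om mOm s (s - 1) (s + 1) sI
  (fun a _ => intf a) derf (fun=> `|M| * M') G0 iG G_ub.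
have D2 := @differentiation_under_integral R _ _ leb f Om mOm s (s - 1) (s + 1) sI
  (fun a _ => intf a) derf (fun=> `|M| * M') G0 iG G_ub.
apply: DeriveDef; first exact: D1.
rewrite -derive1E [LHS]D2; apply: vol_int_ext => x Ox.
by rewrite partial1of2E derive_val.
Qed.

End Directional.
Section IncrementBound.
Context {R : realType} {N : nat}.
Implicit Types (u p w f eta : 'rV[R]_N -> R) (x y : 'rV[R]_N) (s t r d eps : R).
Variable Om : set 'rV[R]_N.
Hypotheses (oOm : open Om) (bOm : bounded_set Om).
Variable i : 'I_N.

Local Notation leb := (@lebesgue_rV R N : set (borel_rV R N) -> \bar R).
Local Notation e := (delta_mx 0 i : 'rV[R]_N).
Local Notation sweep := (sweep Om i).
Let mOm := domain_measurable oOm.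
Let fOm := domain_finite oOm bOm.

Lemma translate_quotient w (v x l : 'rV[R]_N) :
  (fun h : R => h^-1 *: (((fun x => w (x - v)) \o shift x) (h *: l) - w (x - v))) =
  (fun h : R => h^-1 *: ((w \o shift (x - v)) (h *: l) - w (x - v))).
Proof. by apply/funext => h /=; rewrite addrA. Qed.

Lemma partial_translate w (v x : 'rV[R]_N) (j : 'I_N) :
  partial j (fun x => w (x - v)) x = partial j w (x - v).
Proof. by rewrite /partial /derive translate_quotient. Qed.

Lemma smooth_translate w (v : 'rV[R]_N) : smooth w -> smooth (fun x => w (x - v)).
Proof.
move=> sw k; have := sw k; elim: k w {sw} => [|k IH] w.
  by move=> /Ck_setT0 cw; apply/Ck_setT0; exact: continuous_shift.
move=> /Ck_setTS[cw dw]; apply/Ck_setTS; split; first exact: continuous_shift.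
move=> j; have [dj Cj] := dw j.
split=> [x|]; first by rewrite /derivable translate_quotient; exact: dj.
rewrite (_ : partial j _ = (fun x => partial j w (x - v))); first exact: IH.
by apply/funext => x; exact: partial_translate.
Qed.

Lemma sweep_erode t r x s : sweep t r x -> 0 <= s <= t -> erode Om r (x + s *: e).
Proof. by apply. Qed.

Lemma sweep_sub t r x : 0 <= t -> 0 < r -> sweep t r x -> Om x /\ Om (x + t *: e).
Proof.
move=> t0 r0 sx; split.
  by have := sx 0; rewrite lexx t0 scale0r addr0 => /(_ isT)/(erode_sub r0).
by have := sx t; rewrite lexx t0 => /(_ isT)/(erode_sub r0).
Qed.

Lemma sweep_near t r d x y : sweep t r x -> (forall j, `|y 0 j - x 0 j| <= d) ->
  sweep t (r - d) y.
Proof.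
move=> sx yx s /sx sr; apply: (erode_near sr) => j.
rewrite !mxE; set c := s * _.
by have -> : y 0 j + c - (x 0 j + c) = y 0 j - x 0 j by ring.
Qed.

Lemma closed_sweep t r : 0 < r -> closed (sweep t r).
Proof.
move=> r0; rewrite (_ : sweep t r = \bigcap_(s in [set s | 0 <= s <= t])
  (fun x => x - (- s *: e)) @^-1` erode Om r).
  apply: closed_bigI => s _; apply: closed_comp; last exact: closed_erode.
  by move=> x _; exact: (cvgB cvg_id (cvg_cst _)).
by apply/seteqP; split=> x sx s; [move=> /sx|move=> /sx]; rewrite /= scaleNr opprK.
Qed.

(** The mean value theorem for s -> int u w(x - s e): the weak derivative tested against the
    translated weight turns its derivative into int p w(x - s e). *)
Lemma increment_mvt u p w t r : Linf Om u -> L1 Om p -> weak_partial Om i u p ->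
  smooth w -> 0 < t -> 0 < r -> (forall x, w x != 0 -> sweep t r x) ->
  exists2 s, 0 < s < t &
    vol_int Om (fun x => (u (x + t *: e) - u x) * w x) =
    t * vol_int Om (fun x => p x * w (x - s *: e)).
Proof.
move=> Lu Ip up sw t0 r0 wt.
have cw := Ck_continuous (sw 0%N).
have Luw s : L1 Om (fun x => u x * w (x - s *: e)).
  apply: Linf_in_L1 => //; apply: LinfM => //.
  by apply: continuous_Linf => //; exact: continuous_shift.
have [||c ct] := @MVT R (fun s => vol_int Om (fun x => u x * w (x - s *: e)))
  (fun s => vol_int Om (fun x => u x * - partial i w (x - s *: e))) 0 t t0.
- by move=> s _; exact: is_derive_translate.
- apply: derivable_within_continuous => s _.
  exact: (@ex_derive _ _ _ _ _ _ _ (is_derive_translate oOm bOm i s Lu sw)).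
move: ct; rewrite in_itv /= => ct; rewrite subr0 mulrC scale0r => E.
exists c => //.
have [E1 I1] := @vol_int_shift_support _ _ _ oOm u w (t *: e)
  (fun x wx => sweep_sub (ltW t0) r0 (wt x wx)) (Luw t).
rewrite (_ : (fun x => (u (x + t *: e) - u x) * w x) =
  (fun x => u (x + t *: e) * w x - u x * w x)); last first.
  by apply/funext => x; rewrite mulrBl.
have I0 : L1 Om (fun x => u x * w x).
  by have := Luw 0; apply: L1_ext => // x _; rewrite scale0r subr0.
rewrite vol_intB// E1.
have -> : vol_int Om (fun x => u x * w x) = vol_int Om (fun x => u x * w (x - 0)).
  by apply: vol_int_ext => x _; rewrite subr0.
rewrite E; congr (_ * _).
have tw : test_function Om (fun x => w (x - c *: e)).
  apply: (@erode_test_function _ _ _ _ r) => //; first exact: smooth_translate.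
  move=> x /wt/(_ c); rewrite subrK; apply.
  by case/andP: ct => c0 ct; rewrite (ltW c0) (ltW ct).
apply: oppr_inj; rewrite -(up _ tw).
have L2' : Linf Om (fun x => partial i w (x - c *: e)).
  apply: continuous_Linf => //; apply: continuous_shift.
  by have /Ck_setTS[_ /(_ i)[_ /Ck_continuous]] := sw 1%N.
rewrite -vol_intN//; last first.
  apply: Linf_in_L1 => //; apply: LinfM => //.
  by apply: Linf_ext (LinfM (Linf_cst _ (-1)) L2') => // x _; rewrite mulN1r.
by apply: vol_int_ext => x _; rewrite partial_translate mulrN opprK.
Qed.

(** Uniform density of the smooth functions extends the previous formula, up to
    an error, to continuous [w]. *)
Lemma increment_L1 u w t r : Linf Om u -> continuous w -> 0 < t -> 0 < r ->
  (forall x, w x != 0 -> sweep t r x) ->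
  L1 Om (fun x => (u (x + t *: e) - u x) * w x).
Proof.
move=> Lu cw t0 r0 wt.
have Luw s : L1 Om (fun x => u x * w (x - s *: e)).
  apply: Linf_in_L1 => //; apply: LinfM => //.
  by apply: continuous_Linf => //; exact: continuous_shift.
have [_ I1] := @vol_int_shift_support _ _ _ oOm u w (t *: e)
  (fun x wx => sweep_sub (ltW t0) r0 (wt x wx)) (Luw t).
have I0 : L1 Om (fun x => u x * w x).
  by have := Luw 0; apply: L1_ext => // x _; rewrite scale0r subr0.
by apply: L1_ext (L1B _ I1 I0) => // x _; rewrite mulrBl.
Qed.

(** Grid approximation with a mesh below the modulus of continuity of [w] and below [r / 2], so that
    the support grows by at most [r / 2]. *)
Lemma smooth_sweep_approx w t r d : continuous w -> 0 <= t -> 0 < r ->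
  (forall x, w x != 0 -> sweep t r x) -> 0 < d ->
  exists eta, [/\ smooth eta, forall x, eta x != 0 -> sweep t (r / 2) x &
    forall x, `|w x - eta x| <= d].
Proof.
move=> cw t0 r0 wt d0.
have [M wM] : exists M : R, forall x j, w x != 0 -> `|x 0 j| <= M.
  have [M _ OM] := bounded_cube bOm; exists M => x j /wt/(sweep_sub t0 r0)[Ox _].
  by have := OM x Ox j; rewrite mxE subr0.
have [d1 d10 dP] := uniform_continuous_bounded_support cw wM d0.
pose d2 := Num.min d1 (r / 2).
have d20 : 0 < d2 by rewrite lt_min d10 divr_gt0.
exists (grid_approx w M d2); split; first exact: grid_approx_smooth.
- move=> x ex.
  have [y [yx wy]] : exists y : 'rV[R]_N, (forall j, `|y 0 j - x 0 j| < d2) /\ w y != 0.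
    apply: contrapT => /forallNP h; move/negP: ex; apply.
    have := @grid_approx_bound _ _ w M d2 d20 wM 0 0 x; rewrite -eq_le eq_sym.
    apply=> y yx; suff -> : w y = 0 by rewrite lexx.
    by apply/eqP/contraT => wy; exfalso; apply: (h y).
  have -> : r / 2 = r - r / 2 by field.
  apply: sweep_near (wt _ wy) _ => j; rewrite distrC.
  by have := yx j; rewrite lt_min => /andP[_ /ltW].
- move=> x; have := @grid_approx_bound _ _ w M d2 d20 wM (w x - d) (w x + d) x.
  case/(_ _)/andP.
    move=> y yx; rewrite -ler_distl ltW//; apply: dP => j.
    by have := yx j; rewrite lt_min => /andP[].
  by move=> h1 h2; rewrite distrC ler_distl h1 h2.
Qed.

(** Uniform density of the smooth functions extends the previous formula, up to
    an error, to continuous [w]. *)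
Lemma increment_approx u p w t r : Linf Om u -> L1 Om p -> weak_partial Om i u p ->
  continuous w -> 0 < t -> 0 < r -> (forall x, w x != 0 -> sweep t r x) ->
  forall eps, 0 < eps -> exists2 s, 0 < s < t &
    `|vol_int Om (fun x => (u (x + t *: e) - u x) * w x) -
      t * vol_int Om (fun x => p x * w (x - s *: e))| <= eps.
Proof.
move=> Lu Ip up cw t0 r0 wt eps eps0.
have [mu [M0 uM0]] := Lu.
pose M := `|M0|; have uM x : Om x -> `|u x| <= M.
  by move=> Ox; apply: le_trans (uM0 x Ox) (ler_norm _).
pose A := vol_int Om (fun=> 1 : R); pose P := vol_int Om (fun x => `|p x|).
have A0 : 0 <= A by apply: vol_int_ge0.
have P0 : 0 <= P by apply: vol_int_ge0.
(* Replacing [w] by a smooth function within [d] of it costs at most [2 M A d] in the increment term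
   and [t P d] in the other. *)
pose K := (M + M) * A + t * P + 1.
have M00 : 0 <= M by exact: normr_ge0.
have K0 : 0 < K.
  apply: ltr_wpDl => //; apply: addr_ge0; apply: mulr_ge0 => //.
    exact: addr_ge0.
  exact: ltW.
pose d := eps / K; have d0 : 0 < d by rewrite divr_gt0.
have [eta [se et we]] := smooth_sweep_approx cw (ltW t0) r0 wt d0.
have r20 : 0 < r / 2 by rewrite divr_gt0.
have ce := Ck_continuous (se 0%N).
have [s st E] := increment_mvt Lu Ip up se t0 r20 et.
exists s => //.
have I1 := increment_L1 Lu cw t0 r0 wt.
have I2 := increment_L1 Lu ce t0 r20 et.
have Ipw f : continuous f -> L1 Om (fun x => p x * f (x - s *: e)).
  move=> cf; have Lf : Linf Om (fun x => f (x - s *: e)).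
    by apply: continuous_Linf => //; exact: continuous_shift.
  by apply: L1_ext (Linf_L1 mOm Lf Ip) => // x _; rewrite mulrC.
have B1 : `|vol_int Om (fun x => (u (x + t *: e) - u x) * w x) -
   vol_int Om (fun x => (u (x + t *: e) - u x) * eta x)| <= (M + M) * d * A.
  rewrite -vol_intB//; apply: le_trans (vol_int_norm mOm (L1B mOm I1 I2)) _.
  rewrite /A -vol_int_cst//; apply: vol_int_le => //.
  - by apply: L1_norm => //; exact: L1B.
  - exact: L1_cst.
  move=> x Ox; rewrite -mulrBr normrM.
  have [Oxt|nO] := pselect (Om (x + t *: e)).
    apply: ler_pM => //; apply: le_trans (ler_normB _ _) _.
    by rewrite lerD ?uM.
  have w0 : w x = 0 by apply/eqP/contraT => /wt/(sweep_sub (ltW t0) r0)[].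
  have e0 : eta x = 0 by apply/eqP/contraT => /et/(sweep_sub (ltW t0) r20)[].
  by rewrite w0 e0 subrr normr0 mulr0 mulr_ge0 ?addr_ge0// ltW.
have B2 : `|vol_int Om (fun x => p x * eta (x - s *: e)) -
   vol_int Om (fun x => p x * w (x - s *: e))| <= d * P.
  have [J1 J2] := (Ipw _ ce, Ipw _ cw).
  rewrite -vol_intB//; apply: le_trans (vol_int_norm mOm (L1B mOm J1 J2)) _.
  have Ip' := L1_norm Ip.
  rewrite /P -vol_intZ//; apply: vol_int_le => //.
  - by apply: L1_norm => //; exact: L1B.
  - exact: L1Z.
  by move=> x _; rewrite -mulrBr normrM mulrC ler_wpM2r// distrC.
rewrite -[X in `|X|](subrKA (t * vol_int Om (fun x => p x * eta (x - s *: e)))).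
apply: le_trans (ler_normD _ _) _.
rewrite -{1}E -mulrBr normrM (gtr0_norm t0).
apply: le_trans (lerD B1 (ler_wpM2l (ltW t0) B2)) _.
have -> : (M + M) * d * A + t * (d * P) = d * (K - 1) by rewrite /K; ring.
apply: (@le_trans _ _ (d * K)); first by rewrite ler_pM2l// gerBl ler01.
by rewrite /d divfK// gt_eqF.
Qed.

End IncrementBound.
Section Increments.
Context {R : realType} {N : nat}.
Implicit Types (u v p q w f chi : 'rV[R]_N -> R) (x y : 'rV[R]_N) (s t r d eps : R).
Variable Om : set 'rV[R]_N.
Hypotheses (oOm : open Om) (bOm : bounded_set Om).
Variable i : 'I_N.

Local Notation leb := (@lebesgue_rV R N : set (borel_rV R N) -> \bar R).
Local Notation e := (delta_mx 0 i : 'rV[R]_N).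
Local Notation sweep := (sweep Om i).
Let mOm := domain_measurable oOm.
Let fOm := domain_finite oOm bOm.

Lemma vol_int_subset (A B : set (borel_rV R N)) f : measurable A -> measurable B ->
  A `<=` B -> (forall x, B x -> 0 <= f x) -> L1 B f -> vol_int A f <= vol_int B f.
Proof.
move=> mA mB AB f0 If; have IA := L1_sub mA mB AB If.
rewrite -lee_fin !EFin_vol_int//; apply: ge0_subset_integral => //.
by apply/measurable_EFinP; exact: L1_meas If.
Qed.

(** Duality: the increment of [u], cut off by [chi], serves as its own weight [w], and Young's
    inequality absorbs the norm of [w] into the left side. *)
Lemma increment_test u p chi t r : {within closure Om, continuous u} ->
  L2 Om p -> weak_partial Om i u p ->
  continuous chi -> (forall x, 0 <= chi x <= 1) -> 0 < t -> 0 < r ->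
  (forall x, chi x != 0 -> sweep t r x) ->
  L1 Om (fun x => (u (x + t *: e) - u x) ^+ 2 * chi x) /\
  vol_int Om (fun x => (u (x + t *: e) - u x) ^+ 2 * chi x) <=
  t ^+ 2 * vol_int Om (fun x => p x ^+ 2).
Proof.
move=> cu Lp up cchi chi01 t0 r0 chir.
have Lu := within_closure_Linf oOm bOm cu.
have uOm := within_closure_in oOm cu.
pose w x := (u (x + t *: e) - u x) * chi x.
have wt x : w x != 0 -> sweep t r x.
  by rewrite mulf_eq0 negb_or => /andP[_]; exact: chir.
have cw : continuous w.
  apply: (@continuous_extend0 _ _ (sweep t r)) => //; first exact: closed_sweep.
  move=> x sx; have [Ox Oxt] := sweep_sub (ltW t0) r0 sx.
  apply: for_continuousM; last exact: cchi.
  apply: for_continuousB; last exact: uOm (mem_set Ox).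
  apply: (@continuous_comp _ _ _ (fun x : 'rV[R]_N => x + t *: e) u).
    exact: (cvgD cvg_id (cvg_cst _)).
  exact: uOm (mem_set Oxt).
pose X := vol_int Om (fun x => (u (x + t *: e) - u x) ^+ 2 * chi x).
have IX : L1 Om (fun x => (u (x + t *: e) - u x) * w x).
  exact: increment_L1 wt.
have XE : X = vol_int Om (fun x => (u (x + t *: e) - u x) * w x).
  by apply: vol_int_ext => x _; rewrite /w mulrA expr2.
have IX' : L1 Om (fun x => (u (x + t *: e) - u x) ^+ 2 * chi x).
  by apply: L1_ext IX => // x _; rewrite /w mulrA expr2.
split=> //; rewrite -/X.
have Lw : Linf Om w by apply: continuous_Linf.
have Lw2 : L1 Om (fun x => w x ^+ 2) by apply: Linf_in_L1 => //; exact: LinfM.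
have w2X : vol_int Om (fun x => w x ^+ 2) <= X.
  apply: vol_int_le => // x _; rewrite /w exprMn ler_wpM2l ?sqr_ge0//.
  by have /andP[c0 c1] := chi01 x; rewrite expr2 ler_piMr.
apply/ler_addgt0Pr => eps eps0.
have [s /andP[s0 st]] := increment_approx oOm bOm Lu (L2_in_L1 mOm fOm Lp) up cw
  t0 r0 wt (divr_gt0 eps0 (ltr0Sn R 1)).
rewrite -XE ler_distl => /andP[_ Xle].
have Lws : Linf Om (fun x => w (x - s *: e)).
  by apply: continuous_Linf => //; exact: continuous_shift.
have shw : vol_int Om (fun x => w (x - s *: e) ^+ 2) = vol_int Om (fun x => w x ^+ 2).
  have [||E _] := @vol_int_shift_support _ _ _ oOm (fun=> 1) (fun x => w x ^+ 2) (s *: e).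
  - move=> x; rewrite sqrf_eq0 => /wt wx.
    have ws s' : 0 <= s' <= t -> Om (x + s' *: e).
      by move=> /(sweep_erode wx)/(erode_sub r0).
    split; last by apply: ws; rewrite (ltW s0) (ltW st).
    by rewrite -[x]addr0 -(scale0r e); apply: ws; rewrite lexx (ltW t0).
  - apply: L1_ext (Linf_in_L1 mOm fOm (LinfM Lws Lws)) => // x _.
    by rewrite mul1r expr2.
  by move: E; under eq_fun do rewrite mul1r; under [in RHS]eq_fun do rewrite mul1r.
have Ip2 : L1 Om (fun x => t ^+ 2 / 2 * p x ^+ 2) by apply: L1Z => //; case: Lp.
have Lws2 : L1 Om (fun x => 2^-1 * w (x - s *: e) ^+ 2).
  by apply: L1Z => //; apply: Linf_in_L1 => //; exact: LinfM.
have Ipw : L1 Om (fun x => p x * w (x - s *: e)).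
  by apply: L2_mul => //; exact: Linf_in_L2.
(* Young's inequality; by [shw] the translated weight has the same norm as [w]. *)
have : t * vol_int Om (fun x => p x * w (x - s *: e)) <=
    t ^+ 2 / 2 * vol_int Om (fun x => p x ^+ 2) + 2^-1 * vol_int Om (fun x => w x ^+ 2).
  rewrite -shw -!vol_intZ//; last first.
  - by case: Lp.
  - by apply: Linf_in_L1 => //; exact: LinfM.
  rewrite -vol_intD//.
  apply: (vol_int_le mOm (L1Z mOm t Ipw) (L1D mOm Ip2 Lws2)).
  by move=> x _; have := sqr_ge0 (t * p x - w (x - s *: e)); lra.
by move=> h; lra.
Qed.

End Increments.
Section IncrementL2.
Context {R : realType} {N : nat}.
Implicit Types (u v p q w f chi : 'rV[R]_N -> R) (x y : 'rV[R]_N) (s t r d eps : R).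
Variable Om : set 'rV[R]_N.
Hypotheses (oOm : open Om) (bOm : bounded_set Om).
Variable i : 'I_N.

Local Notation leb := (@lebesgue_rV R N : set (borel_rV R N) -> \bar R).
Local Notation e := (delta_mx 0 i : 'rV[R]_N).
Local Notation sweep := (sweep Om i).
Let mOm := domain_measurable oOm.
Let fOm := domain_finite oOm bOm.

Lemma measurable_sweep t r : 0 < r -> measurable (sweep t r : set (borel_rV R N)).
Proof. by move=> r0; apply: closed_measurable_rV; exact: closed_sweep. Qed.

(** [increment_test] with a cutoff equal to 1 on the sweep, obtained by smoothing an indicator
    function. *)
Lemma increment_sweep u p t r : {within closure Om, continuous u} ->
  L2 Om p -> weak_partial Om i u p -> 0 < t -> 0 < r ->
  vol_int (sweep t r) (fun x => (u (x + t *: e) - u x) ^+ 2) <=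
  t ^+ 2 * vol_int Om (fun x => p x ^+ 2).
Proof.
move=> cu Lp up t0 r0.
have [M _ OM] := bounded_cube bOm.
(* The sweep is enlarged twice by [d], once to form [U] and once by the mesh, so the cutoff lives in
   [sweep t (r / 2)]. *)
pose d := r / 4; have d0 : 0 < d by rewrite divr_gt0.
have sO r' : 0 < r' -> sweep t r' `<=` Om.
  by move=> r'0 x sx; have [] := sweep_sub (ltW t0) r'0 sx.
pose U : set 'rV[R]_N := [set y | exists2 z, sweep t r z & forall j, `|y 0 j - z 0 j| < d].
pose ind y : R := (y \in U)%:R.
have Usw y : U y -> sweep t (r - d) y.
  by move=> [z sz zy]; apply: sweep_near sz _ => j; exact: ltW.
have indM y j : ind y != 0 -> `|y 0 j| <= M.
  rewrite /ind pnatr_eq0 eqb0 negbK inE => /Usw/(sO _ _)/OM/(_ j).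
  rewrite mxE subr0; apply; rewrite /d; lra.
pose chi := grid_approx ind M d.
have cchi : continuous chi := Ck_continuous (@grid_approx_smooth _ _ ind M d 0%N).
have chi01 x : 0 <= chi x <= 1.
  by apply: (@grid_approx_bound _ _ ind M d d0 indM) => y _; rewrite /ind; case: (y \in U); rewrite ?lexx ?ler01.
have chi1 x : sweep t r x -> chi x = 1.
  move=> sx; apply/eqP; rewrite eq_le andbC.
  apply: (@grid_approx_bound _ _ ind M d d0 indM) => y yx.
  by rewrite /ind mem_set ?lexx//; exists x.
have chis x : chi x != 0 -> sweep t (r / 2) x.
  move=> cx; have [y [yx Uy]] : exists y : 'rV[R]_N, (forall j, `|y 0 j - x 0 j| < d) /\ U y.
    apply: contrapT => /forallNP h; move/negP: cx; apply; rewrite eq_le andbC.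
    apply: (@grid_approx_bound _ _ ind M d d0 indM) => y yx.
    by rewrite /ind memNset ?lexx// => Uy; apply: (h y).
  have -> : r / 2 = r - d - d by rewrite /d; field.
  by apply: sweep_near (Usw _ Uy) _ => j; rewrite distrC ltW.
have [IX le] := increment_test oOm bOm cu Lp up cchi chi01 t0 (divr_gt0 r0 (ltr0Sn R 1)) chis.
apply: le_trans le.
rewrite (@vol_int_ext _ _ _ _ (fun x => (u (x + t *: e) - u x) ^+ 2 * chi x)); last first.
  by move=> x /chi1 ->; rewrite mulr1.
apply: vol_int_subset => //; first exact: measurable_sweep.
  exact: sO.
by move=> x _; have /andP[c0 _] := chi01 x; rewrite mulr_ge0 ?sqr_ge0.
Qed.

Definition path_domain t : set 'rV[R]_N :=
  [set x | forall s, 0 <= s <= t -> Om (x + s *: e)].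

(** A segment inside [Om] is compact, hence has positive distance to the complement. *)
Lemma path_domainE t : 0 <= t -> path_domain t = \bigcup_k sweep t (k.+1%:R^-1).
Proof.
move=> t0; apply/seteqP; split=> x; last first.
  by move=> [k _ sx] s /sx/(erode_sub _); apply; rewrite invr_gt0.
move=> px; pose S := (fun s : R => x + s *: e) @` `[0, t]%classic.
have cS : compact S.
  apply: continuous_compact; last exact: segment_compact.
  apply: continuous_subspaceT => s.
  exact: (cvgD (cvg_cst _) (cvgZr_tmp cvg_id)).
have [|r r0 rS] := compact_erode cS oOm.
  by move=> _ [s /= st <-]; apply: px; rewrite in_itv in st.
have [k] := ltr_add_invr r0; rewrite add0r => kr.
exists k => // s st.
have sr : erode Om r (x + s *: e) by apply: rS; exists s => //=; rewrite in_itv.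
exact: (erode_le (ltW kr) sr).
Qed.

Lemma measurable_path_domain t : 0 <= t -> measurable (path_domain t : set (borel_rV R N)).
Proof.
move=> t0; rewrite path_domainE//; apply: bigcupT_measurable => k.
by apply: measurable_sweep; rewrite invr_gt0.
Qed.

Lemma path_domain_sub t : 0 <= t -> path_domain t `<=` Om `&` [set x | Om (x + t *: e)].
Proof.
move=> t0 x px; split; last by apply: px; rewrite lexx andbT.
by have := px 0; rewrite lexx t0 scale0r addr0; apply.
Qed.

(** Monotone convergence along the exhausting sweeps; the bound there does not depend on the
    margin. *)
Lemma increment_path u p t : {within closure Om, continuous u} ->
  L2 Om p -> weak_partial Om i u p -> 0 < t ->
  L1 (path_domain t) (fun x => (u (x + t *: e) - u x) ^+ 2) /\
  vol_int (path_domain t) (fun x => (u (x + t *: e) - u x) ^+ 2) <=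
  t ^+ 2 * vol_int Om (fun x => p x ^+ 2).
Proof.
move=> cu Lp up t0.
have Lu := within_closure_Linf oOm bOm cu.
have mP := measurable_path_domain (ltW t0).
have PO := path_domain_sub (ltW t0).
have fP : (leb (path_domain t) < +oo)%E.
  by apply: le_lt_trans fOm; apply: le_measure; rewrite ?inE// => x /PO[].
have Ld : Linf (path_domain t) (fun x => u (x + t *: e) - u x).
  have [mu [M uM]] := Lu; split.
    have mu1 : meas_on (path_domain t) u.
      by apply: measurable_funS mu => // x /PO[].
    have mu2 : meas_on (path_domain t) (fun x => u (x + t *: e)).
      have := @meas_on_shift _ _ _ (t *: e) _ mOm mu; apply: measurable_funS => //.
        exact: (measurable_shift_set (t *: e) mOm).
      by move=> x /PO[].
    by have := meas_onD mu2 (meas_onM (@meas_on_cst _ _ (path_domain t) (-1)) mu1);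
       apply: meas_on_ext => x _; rewrite mulN1r.
  exists (M + M) => x /PO[Ox Oxt].
  by apply: le_trans (ler_normB _ _) _; rewrite lerD ?uM.
have Ld2 := LinfM Ld Ld.
have I2 : L1 (path_domain t) (fun x => (u (x + t *: e) - u x) ^+ 2).
  exact: Linf_in_L1.
split=> //.
have sP k : sweep t (k.+1%:R^-1) `<=` path_domain t.
  by move=> x sx; rewrite (path_domainE (ltW t0)); exists k.
rewrite -lee_fin EFin_vol_int//.
rewrite [X in (\int[leb]_(x in X) _)%E](path_domainE (ltW t0)).
have cvgP := @ge0_nondecreasing_set_cvg_integral _ _ _
  (fun k => sweep t (k.+1%:R^-1) : set (borel_rV R N))
  (fun x => ((u ((x : 'rV[R]_N) + t *: e) - u x) ^+ 2)%:E) leb.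
have sk k : 0 < k.+1%:R^-1 :> R by rewrite invr_gt0.
have cvgI : (\int[leb]_(x in (sweep t (k.+1%:R^-1)%R : set (borel_rV R N)))
    ((u ((x : 'rV[R]_N) + t *: e)%R - u x) ^+ 2)%:E)%E @[k --> \oo] -->
  (\int[leb]_(x in \bigcup_k (sweep t (k.+1%:R^-1)%R : set (borel_rV R N)))
    ((u ((x : 'rV[R]_N) + t *: e)%R - u x) ^+ 2)%:E)%E.
  apply: cvgP.
  - move=> a b ab; apply/subsetPset => x sx s /sx; apply: erode_le.
    by rewrite lef_pV2 ?posrE// ler_nat.
  - by move=> k; exact: measurable_sweep.
  - by move=> k; apply: measurable_funS (measurable_int _ I2).
  - by move=> k x _; rewrite lee_fin sqr_ge0.
apply: (cvge_le _ cvgI).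
apply: nearW => k.
rewrite -EFin_vol_int ?lee_fin; first exact: increment_sweep.
  exact: (@measurable_sweep t _ (sk k)).
exact: (L1_sub (@measurable_sweep t _ (sk k)) mP (@sP k) I2).
Qed.

End IncrementL2.

(** * The chain rule for weak partial derivatives *)

Section ChainRule.
Context {R : realType} {N : nat}.
Implicit Types (u v p q w f chi : 'rV[R]_N -> R) (x y : 'rV[R]_N) (s t r d eps : R).
Variable Om : set 'rV[R]_N.
Hypotheses (oOm : open Om) (bOm : bounded_set Om).
Variable i : 'I_N.

Local Notation leb := (@lebesgue_rV R N : set (borel_rV R N) -> \bar R).
Local Notation e := (delta_mx 0 i : 'rV[R]_N).
Local Notation sweep := (sweep Om i).
Let mOm := domain_measurable oOm.
Let fOm := domain_finite oOm bOm.

Lemma is_derive_increment (f : R -> R) (a l : R) : is_derive a (1 : R) f l ->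
  forall eps, 0 < eps -> exists2 d, 0 < d & forall h, 0 < h < d ->
    `|f (a + h) - f a - h * l| <= eps * h.
Proof.
move=> /is_derive1_caratheodory[g [fg cg gl]] eps eps0.
have /cvgrPdist_le/(_ eps eps0)/nbhs_ballP[d /= d0 dP] := cg.
exists d => // h /andP[h0 hd].
have := fg (a + h); rewrite addrAC subrr add0r => ->.
have -> : g (a + h) * h - h * l = - (g a - g (a + h)) * h by rewrite gl; ring.
rewrite normrM normrN (gtr0_norm h0) ler_pM2r//; apply: dP.
by rewrite /ball /= opprD addrA subrr sub0r normrN gtr0_norm.
Qed.

(** [q] is controlled only in [Om]; the support of [w] keeps away from the complement. *)
Lemma continuous_mul_support q w r : 0 < r -> {in Om, continuous q} ->
  continuous w -> (forall x, w x != 0 -> erode Om r x) ->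
  continuous (fun x => q x * w x).
Proof.
move=> r0 cq cw wr; apply: (@continuous_extend0 _ _ (erode Om r)).
- exact: closed_erode.
- move=> x /(erode_sub r0) Ox; apply: for_continuousM; last exact: cw.
  exact: cq (mem_set Ox).
- by move=> x; rewrite mulf_eq0 negb_or => /andP[_]; exact: wr.
Qed.

Lemma erode_sweep r t x : t <= r -> erode Om (r + r) x -> sweep t r x.
Proof.
move=> tr xr s /andP[s0 st]; have -> : r = r + r - r by ring.
apply: (erode_near xr) => j.
have -> : (x + s *: e) 0 j - x 0 j = (s *: e) 0 j by rewrite mxE addrAC subrr add0r.
by apply: le_trans (norm_shift_le i s j) _; rewrite ger0_norm// (le_trans st).
Qed.

(** Increments of [v] against [eta] and increments of [u] against [q eta] differ by a quadratic
    remainder, which is O(t^2) by the L2 bound on increments. Dividing by [t] and letting [t] tend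
    to 0 identifies the weak derivative. *)
Lemma weak_partial_chain u v p q (C : R) :
  {within closure Om, continuous u} -> {within closure Om, continuous v} ->
  {within closure Om, continuous q} -> L2 Om p -> weak_partial Om i u p ->
  (forall x y, Om x -> Om y ->
    `|v x - v y - q y * (u x - u y)| <= C * (u x - u y) ^+ 2) ->
  weak_partial Om i v (fun x => q x * p x).
Proof.
move=> cu cv cq Lp up vuq eta teta.
have [r0 r00 er0] := test_function_erode oOm teta.
pose r := r0 / 2; have r0' : 0 < r by rewrite divr_gt0.
have er x : eta x != 0 -> erode Om (r + r) x by rewrite -splitr; exact: er0.
have [se _] := teta; have ce := Ck_continuous (se 0%N).
have Lu := within_closure_Linf oOm bOm cu.
have Lv := within_closure_Linf oOm bOm cv.
have Lq := within_closure_Linf oOm bOm cq.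
pose w x := q x * eta x.
have cw : continuous w.
  by apply: (@continuous_mul_support q eta r0) => //; exact: within_closure_in.
have wr x : w x != 0 -> erode Om (r + r) x.
  by rewrite mulf_eq0 negb_or => /andP[_]; exact: er.
have [M wM] : exists M : R, forall x j, w x != 0 -> `|x 0 j| <= M.
  exact: (compact_support_cube bOm (addr_gt0 r0' r0') wr).
have [Me eM] : exists M : R, forall x j, eta x != 0 -> `|x 0 j| <= M.
  exact: (compact_support_cube bOm (addr_gt0 r0' r0') er).
have [K0 K00 eK] := continuous_cube_bounded (0 : 'rV[R]_N) Me ce.
pose K := K0 + 1; have Kp : 0 < K by rewrite ltr_wpDl.
have etaK x : `|eta x| <= K.
  have [->|ex] := eqVneq (eta x) 0; first by rewrite normr0 ltW.
  apply: (@le_trans _ _ K0); last by rewrite lerDl.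
  by apply: eK => j; rewrite mxE subr0; exact: eM.
have [E cE] : exists C', 0 <= C' /\ C <= C' by exists `|C|; split=> //; exact: ler_norm.
case: cE => E0 CE.
pose chi x := `|eta x| / K.
have cchi : continuous chi.
  apply: continuous_mul; last exact: cst_continuous.
  by move=> x; apply: (@for_continuous_comp _ _ eta Num.Def.normr); [exact: ce|exact: norm_continuous].
have chi01 x : 0 <= chi x <= 1.
  by rewrite /chi divr_ge0 ?(ltW Kp)//= ler_pdivrMr// mul1r.
have chir x : chi x != 0 -> erode Om (r + r) x.
  by rewrite mulf_eq0 normr_eq0 negb_or => /andP[? _]; exact: er.
set A := vol_int Om (fun x => v x * partial i eta x).
set B := vol_int Om (fun x => q x * p x * eta x).
pose P1 := vol_int Om (fun x => `|p x|).
pose P2 := vol_int Om (fun x => p x ^+ 2).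
have P10 : 0 <= P1 by apply: vol_int_ge0.
have P20 : 0 <= P2 by apply: vol_int_ge0 => x _; exact: sqr_ge0.
pose G := E * K * P2 + 1.
have G0 : 0 < G by rewrite ltr_wpDl// mulr_ge0// mulr_ge0// ltW.
have BE : B = vol_int Om (fun x => p x * w x).
  by apply: vol_int_ext => x _; rewrite /w; ring.
have Ip1 := L2_in_L1 mOm fOm Lp.
have Ipw s : L1 Om (fun x => p x * w (x - s *: e)).
  apply: L2_mul => //; apply: Linf_in_L2 => //; apply: continuous_Linf => //.
  exact: continuous_shift.
(* One [eps] comes from the difference quotient of [v], one from the terms of order t^2, and
   [eps * P1] from translating [w]. *)
suff AB eps : 0 < eps -> `|A + B| <= eps * (2 + P1).
  have P2' : 0 < 2 + P1 by rewrite ltr_pwDl.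
  have /eqP : `|A + B| = 0.
    apply/eqP; rewrite eq_le normr_ge0 andbT; apply/ler_addgt0Pr => eps eps0.
    rewrite add0r; apply: le_trans (AB (eps / (2 + P1)) _) _; first exact: divr_gt0.
    by rewrite divfK// gt_eqF.
  by rewrite normr_eq0 addr_eq0 => /eqP.
move=> eps0.
have [d1 d10 dP] := uniform_continuous_bounded_support cw wM eps0.
have D := is_derive_translate oOm bOm i 0 Lv se.
have [d2 d20 d2P] := is_derive_increment D eps0.
(* [d1] makes translates of [w] close to [w], [d2] makes the difference quotient accurate, [r] keeps
   the supports in [Om], and [eps / G] makes the terms of order t^2 at most [eps * t]. *)
pose t := Num.min (Num.min (d1 / 2) (d2 / 2)) (Num.min r (eps / G)).
have t0 : 0 < t by rewrite !lt_min !divr_gt0.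
have [tr tG] : t <= r /\ t * G <= eps.
  by split; [rewrite !ge_min lexx !orbT|rewrite -ler_pdivlMr// !ge_min lexx !orbT].
have td1 : t < d1.
  apply: (@le_lt_trans _ _ (d1 / 2)); first by rewrite !ge_min lexx.
  by rewrite ltr_pdivrMr// ltr_pMr// ltr1n.
have td2 : t < d2.
  apply: (@le_lt_trans _ _ (d2 / 2)); first by rewrite !ge_min lexx orbT.
  by rewrite ltr_pdivrMr// ltr_pMr// ltr1n.
have ets x : eta x != 0 -> sweep t r x by move=> /er; exact: erode_sweep.
have wts x : w x != 0 -> sweep t r x by move=> /wr; exact: erode_sweep.
have cts x : chi x != 0 -> sweep t r x by move=> /chir; exact: erode_sweep.
have Ive := increment_L1 oOm bOm Lv ce t0 r0' ets.
have Iuw := increment_L1 oOm bOm Lu cw t0 r0' wts.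
have [Ichi chile] := increment_test oOm bOm cu Lp up cchi chi01 t0 r0' cts.
have S1 : `|vol_int Om (fun x => (v (x + t *: e) - v x) * eta x) + t * A| <= eps * t.
  have := d2P t; rewrite t0 td2 => /(_ isT); rewrite add0r.
  have Lve s : L1 Om (fun x => v x * eta (x - s *: e)).
    apply: Linf_in_L1 => //; apply: LinfM => //.
    by apply: continuous_Linf => //; exact: continuous_shift.
  have [E1 I1] := @vol_int_shift_support _ _ _ oOm v eta (t *: e)
    (fun x wx => sweep_sub (ltW t0) r0' (ets x wx)) (Lve t).
  rewrite -E1 -vol_intB//.
  have -> : vol_int Om (fun x => v x * - partial i eta (x - 0 *: e)) = - A.
    rewrite -vol_intN//; first by apply: vol_int_ext => x _; rewrite scale0r subr0 mulrN.
    apply: Linf_in_L1 => //; apply: LinfM => //; apply: continuous_Linf => //.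
    by have /Ck_setTS[_ /(_ i)[_ /Ck_continuous]] := se 1%N.
  rewrite mulrN opprK => h; apply: le_trans h; rewrite le_eqVlt; apply/orP; left.
  by apply/eqP; congr (`|_ + _|); apply: vol_int_ext => x _; rewrite scale0r subr0; ring.
(* The quadratic remainder, integrated against [|eta| = K chi], falls under [increment_test]. *)
have S2 : `|vol_int Om (fun x => (v (x + t *: e) - v x) * eta x) -
    vol_int Om (fun x => (u (x + t *: e) - u x) * w x)| <= E * K * (t ^+ 2 * P2).
  rewrite -vol_intB//; apply: le_trans (vol_int_norm mOm (L1B mOm Ive Iuw)) _.
  apply: le_trans (_ : _ <= E * K * vol_int Om (fun x => (u (x + t *: e) - u x) ^+ 2 * chi x)) _;
    last by rewrite ler_wpM2l// mulr_ge0// ltW.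
  rewrite -vol_intZ//; apply: vol_int_le => //.
  - by apply: L1_norm; exact: L1B.
  - exact: L1Z.
  move=> x Ox; have [e0|ex] := eqVneq (eta x) 0.
    by rewrite /w /chi e0 normr0 !(mulr0, mul0r) subrr normr0.
  have [_ Oxt] := sweep_sub (ltW t0) r0' (ets x ex).
  have -> : (v (x + t *: e) - v x) * eta x - (u (x + t *: e) - u x) * w x =
    (v (x + t *: e) - v x - q x * (u (x + t *: e) - u x)) * eta x by rewrite /w; ring.
  have -> : E * K * ((u (x + t *: e) - u x) ^+ 2 * chi x) =
    E * (u (x + t *: e) - u x) ^+ 2 * `|eta x| by rewrite /chi; field; rewrite gt_eqF.
  rewrite normrM ler_wpM2r//; apply: le_trans (vuq _ _ Oxt Ox) _.
  by rewrite ler_wpM2r// sqr_ge0.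
(* Accuracy [t ^+ 2] is the reason for the summand 1 in [G]. *)
have [s /andP[s0 st] S3] := increment_approx oOm bOm Lu Ip1 up cw t0 r0' wts (exprn_gt0 2 t0).
have S4 : `|vol_int Om (fun x => p x * w (x - s *: e)) - B| <= eps * P1.
  have Ipw0 : L1 Om (fun x => p x * w x).
    by apply: L1_ext (Ipw 0) => // x _; rewrite scale0r subr0.
  rewrite BE -vol_intB//; apply: le_trans (vol_int_norm mOm (L1B mOm (Ipw s) Ipw0)) _.
  rewrite -vol_intZ//; last exact: L1_norm.
  apply: vol_int_le => //; first by apply: L1_norm; exact: L1B.
    by apply: L1Z => //; exact: L1_norm.
  move=> x _; rewrite -mulrBr normrM mulrC ler_wpM2r//; apply/ltW/dP => j.
  have -> : (x - s *: e) 0 j - x 0 j = - (s *: e) 0 j by rewrite !mxE; ring.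
  rewrite normrN; apply: le_lt_trans (norm_shift_le i s j) _.
  by rewrite (gtr0_norm s0) (lt_trans st).
set X1 := vol_int _ _ in S1 S2; set X2 := vol_int _ _ in S2 S3.
set X3 := vol_int _ _ in S3 S4.
have S34 : `|t * (X3 - B)| <= t * (eps * P1).
  by rewrite normrM (gtr0_norm t0) ler_pM2l.
have : `|t * (A + B)| <= t * (eps * (2 + P1)).
  have -> : t * (A + B) = (X1 + t * A) - (X1 - X2) - (X2 - t * X3) - t * (X3 - B) by ring.
  apply: le_trans (ler_normB _ _) _.
  have h3 := ler_normB (X1 + t * A - (X1 - X2)) (X2 - t * X3).
  have h2 := ler_normB (X1 + t * A) (X1 - X2).
  apply: le_trans (lerD (le_trans h3 (lerD h2 (lexx _))) (lexx _)) _.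
  apply: (@le_trans _ _ (eps * t + E * K * (t ^+ 2 * P2) + t ^+ 2 + t * (eps * P1))).
    apply: lerD => //; apply: lerD => //; exact: lerD.
  have -> : eps * t + E * K * (t ^+ 2 * P2) + t ^+ 2 + t * (eps * P1) =
    t * (eps + t * G + eps * P1) by rewrite /G; ring.
  rewrite ler_pM2l//; lra.
by rewrite normrM (gtr0_norm t0) ler_pM2l.
Qed.

End ChainRule.

(** * Sums, products, inverses and exponentials of continuous H1 functions *)

Section H1Ring.
Context {R : realType} {N : nat}.
Implicit Types (u v p q w f : 'rV[R]_N -> R) (x y : 'rV[R]_N) (s t r d eps : R).
Variable Om : set 'rV[R]_N.
Hypotheses (oOm : open Om) (bOm : bounded_set Om).
Implicit Types (du dv : 'I_N -> 'rV[R]_N -> R).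

Local Notation leb := (@lebesgue_rV R N : set (borel_rV R N) -> \bar R).
Local Notation H1 := (H1_continuous Om).
Let mOm := domain_measurable oOm.
Let fOm := domain_finite oOm bOm.

Lemma weak_gradientP u du : weak_gradient Om u du <->
  forall i, L2 Om (du i) /\ weak_partial Om i u (du i).
Proof.
split=> H i; have := H i; last first.
  move=> [[mdu I2] wp]; split=> //.
  apply/(@L1P _ _ Om (fun x => du i x ^+ 2)) => //.
    by move=> x _; exact: sqr_ge0.
  exact: meas_onM.
move=> [mdu I2 wp]; split=> //; split=> //.
apply/(@L1P _ _ Om (fun x => du i x ^+ 2)) => //.
  by move=> x _; exact: sqr_ge0.
exact: meas_onM.
Qed.

Lemma H1_Linf u du : H1 u du -> Linf Om u.
Proof. by move=> [cu _]; exact: within_closure_Linf. Qed.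

Lemma H1_L2 u du i : H1 u du -> L2 Om (du i).
Proof. by move=> [_ /weak_gradientP/(_ i)[]]. Qed.

Lemma test_Linf eta i : test_function Om eta ->
  Linf Om eta /\ Linf Om (partial i eta).
Proof.
move=> [se _]; split; apply: continuous_Linf => //.
  exact: Ck_continuous (se 0%N).
by have /Ck_setTS[_ /(_ i)[_ /Ck_continuous]] := se 1%N.
Qed.

Lemma weak_partial_ext i u v p q : (forall x, Om x -> u x = v x) ->
  (forall x, Om x -> p x = q x) -> weak_partial Om i u p -> weak_partial Om i v q.
Proof.
move=> uv pq up eta /up; congr (_ = - _).
  by apply: vol_int_ext => x Ox; rewrite uv.
by apply: vol_int_ext => x Ox; rewrite pq.
Qed.

Lemma H1_ext u v du dv : {in closure Om, u =1 v} ->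
  (forall i x, Om x -> du i x = dv i x) -> H1 u du -> H1 v dv.
Proof.
move=> uv duv [cu /weak_gradientP wu]; split.
  exact: subspace_eq_continuous cu.
apply/weak_gradientP => i; have [L2u up] := wu i; split.
  by apply: L2_ext L2u => //; exact: duv.
apply: weak_partial_ext up => x Ox; last exact: duv.
by apply: uv; rewrite inE; exact: subset_closure.
Qed.

Lemma H1_chain u du v q (C : R) : {within closure Om, continuous v} ->
  {within closure Om, continuous q} ->
  (forall x y, Om x -> Om y ->
    `|v x - v y - q y * (u x - u y)| <= C * (u x - u y) ^+ 2) ->
  H1 u du -> H1 v (fun i x => q x * du i x).
Proof.
move=> cv cq vuq [cu /weak_gradientP wu]; split=> //; apply/weak_gradientP => i.
have [L2u up] := wu i; split.
  by apply: L2_Linf => //; exact: within_closure_Linf.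
exact: (weak_partial_chain oOm bOm cu cv cq L2u up vuq).
Qed.

Lemma H1_add u v du dv : H1 u du -> H1 v dv ->
  H1 (fun x => u x + v x) (fun i x => du i x + dv i x).
Proof.
move=> Hu Hv; have Lu := H1_Linf Hu; have Lv := H1_Linf Hv.
have [[cu /weak_gradientP wu] [cv /weak_gradientP wv]] := (Hu, Hv).
split; first exact: continuous_add.
apply/weak_gradientP => i; have [L2u up] := wu i; have [L2v vp] := wv i.
split=> [|eta teta]; first exact: L2D.
have [Le Lde] := test_Linf i teta.
have E (f g h : 'rV[R]_N -> R) : L1 Om (fun x => f x * h x) -> L1 Om (fun x => g x * h x) ->
    vol_int Om (fun x => (f x + g x) * h x) =
    vol_int Om (fun x => f x * h x) + vol_int Om (fun x => g x * h x).
  by move=> I1 I2; rewrite -vol_intD//; apply: vol_int_ext => x _; rewrite mulrDl.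
rewrite !E ?up// ?vp// ?opprD//.
- by apply: L2_mul => //; exact: Linf_in_L2.
- by apply: L2_mul => //; exact: Linf_in_L2.
- by apply: Linf_in_L1 => //; exact: LinfM.
- by apply: Linf_in_L1 => //; exact: LinfM.
Qed.

Lemma H1_scale (c : R) u du : H1 u du -> H1 (fun x => c * u x) (fun i x => c * du i x).
Proof.
move=> Hu; have [cu _] := Hu.
apply: (H1_chain (C := 0)) Hu.
- by apply: continuous_mul => //; exact: cst_continuous.
- exact: cst_continuous.
- move=> x y _ _; rewrite mul0r (_ : _ - _ = 0) ?normr0//; ring.
Qed.

Lemma H1_sqr u du : H1 u du -> H1 (fun x => u x ^+ 2) (fun i x => 2 * u x * du i x).
Proof.
move=> Hu; have [cu _] := Hu; apply: (H1_chain (C := 1)) Hu.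
- exact: continuous_sqr.
- by apply: continuous_mul => //; exact: cst_continuous.
- move=> x y _ _; rewrite mul1r (_ : _ - _ = (u x - u y) ^+ 2); last ring.
  by rewrite ger0_norm// sqr_ge0.
Qed.

(** Polarization reduces products to the chain rule for squares. *)
Lemma H1_mul u v du dv : H1 u du -> H1 v dv ->
  H1 (fun x => u x * v x) (fun i x => u x * dv i x + v x * du i x).
Proof.
move=> Hu Hv.
have := H1_scale (2^-1) (H1_add (H1_sqr (H1_add Hu Hv))
  (H1_scale (-1) (H1_add (H1_sqr Hu) (H1_sqr Hv)))).
by apply: H1_ext => [x _|i x _]; field.
Qed.

(** The remainder 1/a - 1/b + (a - b)/b^2 equals (a - b)^2 / (a b^2), and 1/u is bounded on the
    compact closure. *)
Lemma H1_inv u du : (forall x, closure Om x -> 0 < u x) -> H1 u du ->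
  H1 (fun x => (u x)^-1) (fun i x => - (u x) ^- 2 * du i x).
Proof.
move=> u0 Hu; have [cu _] := Hu.
have ucV : {within closure Om, continuous (fun x => (u x)^-1)}.
  rewrite continuous_subspace_in => x /[!inE] Ox; apply: for_continuousV; last exact: cu.
  by rewrite gt_eqF// u0.
have [M M0 uM] := compact_continuous_bounded (compact_closure_domain bOm) ucV.
apply: (H1_chain (C := M ^+ 3)) Hu => //.
  have := continuous_mul (@cst_continuous (subspace (closure Om)) R (-1)) (continuous_sqr ucV).
  apply: subspace_eq_continuous => x _; rewrite /= mulN1r exprVn//.
move=> x y Ox Oy.
have [ux uy] := (u0 _ (subset_closure Ox), u0 _ (subset_closure Oy)).
have [Mx My] := (uM _ (subset_closure Ox), uM _ (subset_closure Oy)).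
rewrite (_ : _ - _ = (u x)^-1 * (u y)^-1 ^+ 2 * (u x - u y) ^+ 2); last first.
  by field; rewrite !gt_eqF.
rewrite normrM (ger0_norm (sqr_ge0 _)) ler_wpM2r ?sqr_ge0//.
rewrite normrM normrX exprS; apply: ler_pM => //.
by rewrite expr1 ler_pM.
Qed.

(** Second-order Taylor bound, by applying the mean value theorem twice. *)
Lemma expR_increment (K a b : R) : a <= K -> b <= K ->
  `|expR a - expR b - expR b * (a - b)| <= expR K * (a - b) ^+ 2.
Proof.
have lip (a' b' : R) : a' <= K -> b' <= K -> b' <= a' ->
    exists2 c, b' <= c <= a' & expR a' - expR b' = expR c * (a' - b').
  move=> aK bK ba.
  have [|c] := @MVT_segment R expR expR b' a' ba (fun (z : R) _ => is_derive_expR z).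
    by apply: continuous_subspaceT => z; exact: continuous_expR.
  by rewrite in_itv /= => cab ->; exists c.
have lip2 (a' b' : R) : a' <= K -> b' <= K ->
    exists2 c, Num.min a' b' <= c <= Num.max a' b' &
      expR a' - expR b' = expR c * (a' - b').
  move=> aK bK; have [ba|/ltW ab] := leP b' a'; first exact: lip.
  have [c cab E] := lip b' a' bK aK ab; exists c => //.
  by rewrite -[LHS]opprB E; ring.
move=> aK bK; have [c /andP[c1 c2] ->] := lip2 a b aK bK.
have cK : c <= K by apply: le_trans c2 _; rewrite ge_max aK.
rewrite -mulrBl; have [c' /andP[_ c'2] ->] := lip2 c b cK bK.
have c'K : c' <= K by apply: le_trans c'2 _; rewrite ge_max cK.
rewrite -mulrA normrM ger0_norm ?expR_ge0//; apply: ler_pM; rewrite ?expR_ge0 ?ler_expR//.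
rewrite normrM -[leRHS]ger0_norm ?sqr_ge0// normrX expr2 ler_wpM2r//.
move: c1 c2; rewrite ler_norml; have [ba|/ltW ab] := leP b a.
  by move=> c1 c2; rewrite ger0_norm ?subr_ge0//; apply/andP; split; lra.
by move=> c1 c2; rewrite ler0_norm ?subr_le0//; apply/andP; split; lra.
Qed.

Lemma H1_exp u du : H1 u du ->
  H1 (fun x => expR (u x)) (fun i x => expR (u x) * du i x).
Proof.
move=> Hu; have [cu _] := Hu; have [_ [M uM]] := H1_Linf Hu.
have cexp : {within closure Om, continuous (fun x => expR (u x))}.
  move=> x; exact: (@for_continuous_comp R (subspace (closure Om)) u expR x (cu x)
    (@continuous_expR R (u x))).
apply: (H1_chain (C := expR M)) Hu => // x y Ox Oy.
by apply: expR_increment; apply: le_trans (ler_norm _) _; exact: uM.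
Qed.

Lemma Ck_closure_sub k (A B : set 'rV[R]_N) f : A `<=` B ->
  Ck_closure k B f -> Ck_closure k A f.
Proof.
move=> AB; elim: k f => [|k IH] f [[g cg fg] fS]; split.
- by exists g; [apply: continuous_subspaceW cg; exact: closureS|move=> x /AB; exact: fg].
- by [].
- by exists g; [apply: continuous_subspaceW cg; exact: closureS|move=> x /AB; exact: fg].
- by move=> i; have [dfi Ci] := fS i; split=> [x /AB|]; [exact: dfi|exact: IH].
Qed.

Lemma Ck_closure_Linf k f : Ck_closure k Om f -> Linf Om f.
Proof.
case: k => [|k] [[g cg fg] _]; apply: Linf_ext (within_closure_Linf oOm bOm cg) => //;
  by move=> x Ox; rewrite fg.
Qed.

(** The limiting argument of [weak_partial_chain], with the remainder supplied by Taylor's formula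
    along segments in [Om] and the bound on the second derivative. *)
Lemma weak_partial_C2 m i : Ck_closure 2 Om m -> weak_partial Om i m (partial i m).
Proof.
move=> m2; have [_ /(_ i)[dm _]] := m2.
have m1 : Ck_closure 1 Om (partial i m) by have [_ /(_ i)[_]] := m2.
have [_ /(_ i)[ddm _]] := m1.
have m0 : Ck_closure 0 Om (partial i (partial i m)) by have [_ /(_ i)[_]] := m1.
have Lm := Ck_closure_Linf m2; have Lp := Ck_closure_Linf m1.
have [_ [M pM]] := Ck_closure_Linf m0.
have taylor x t : 0 < t -> (forall s, 0 <= s <= t -> Om (x + s *: delta_mx 0 i)) ->
    `|m (x + t *: delta_mx 0 i) - m x - t * partial i m x| <= `|M| * t ^+ 2.
  move=> t0 xt.
  (* The mean value theorem along the segment, used for [m] and then for its partial derivative. *)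
  have line (g : 'rV[R]_N -> R) : (forall y, Om y -> derivable g y (delta_mx 0 i)) ->
      forall t', 0 < t' <= t -> exists2 c, 0 <= c <= t' &
      g (x + t' *: delta_mx 0 i) - g x = t' * partial i g (x + c *: delta_mx 0 i).
    move=> dg t' /andP[t'0 t't].
    have D s : 0 <= s <= t' -> is_derive s (1 : R) (fun s => g (x + s *: delta_mx 0 i))
        (partial i g (x + s *: delta_mx 0 i)).
      move=> /andP[s0 st].
      have E : (fun h : R => h^-1 *: (((fun s => g (x + s *: delta_mx 0 i)) \o shift s)
          (h *: (1 : R)) - g (x + s *: delta_mx 0 i))) =
        (fun h : R => h^-1 *: ((g \o shift (x + s *: delta_mx 0 i)) (h *: delta_mx 0 i)
          - g (x + s *: delta_mx 0 i))).
        apply/funext => h /=; congr (_ *: (g _ - _)).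
        by rewrite [_ *: 1]mulr1 scalerDl addrCA.
      have := dg (x + s *: delta_mx 0 i); rewrite /derivable => dgs.
      split; rewrite ?/derivable ?/derive E//.
      by apply: dgs; apply: xt; rewrite s0 (le_trans st).
    have [||c] := @MVT R (fun s => g (x + s *: delta_mx 0 i))
        (fun s => partial i g (x + s *: delta_mx 0 i)) 0 t' t'0.
    - by move=> s; rewrite in_itv /= => /andP[/ltW s0 /ltW st]; apply: D; rewrite s0.
    - apply: derivable_within_continuous => s; rewrite in_itv /= => st.
      exact: (@ex_derive _ _ _ _ _ _ _ (D s st)).
    rewrite in_itv /= => /andP[/ltW c0 /ltW ct]; rewrite scale0r addr0 subr0 => ->.
    by exists c; [rewrite c0|rewrite mulrC].
  have [|c /andP[c0 ct] ->] := line m dm t; first by rewrite t0 lexx.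
  rewrite -mulrBr normrM (gtr0_norm t0) expr2 mulrCA ler_pM2l//.
  have [c00|cn0] := eqVneq c 0.
    by rewrite c00 scale0r addr0 subrr normr0 mulr_ge0// ltW.
  have cp : 0 < c by rewrite lt_neqAle eq_sym cn0.
  have [|c' /andP[c'0 c't] ->] := line (partial i m) ddm c; first by rewrite cp.
  rewrite normrM (gtr0_norm cp) mulrC; apply: ler_pM => //.
  apply: le_trans (ler_norm M); apply: pM; apply: xt.
  by rewrite c'0 (le_trans c't).
move=> eta teta.
have [r0 r00 er0] := test_function_erode oOm teta.
pose r := r0 / 2; have r0' : 0 < r by rewrite divr_gt0.
have er x : eta x != 0 -> erode Om (r + r) x by rewrite -splitr; exact: er0.
have [se _] := teta; have ce := Ck_continuous (se 0%N).
have [Le Lde] := test_Linf i teta.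
have [_ [K eK]] := Le.
set A := vol_int Om (fun x => m x * partial i eta x).
set B := vol_int Om (fun x => partial i m x * eta x).
pose V := vol_int Om (fun=> 1 : R).
have V0 : 0 <= V by apply: vol_int_ge0.
pose G := `|M| * `|K| * V + 1.
have G0 : 0 < G by rewrite ltr_wpDl// !mulr_ge0.
suff AB eps : 0 < eps -> `|A + B| <= eps * 2.
  have /eqP : `|A + B| = 0.
    apply/eqP; rewrite eq_le normr_ge0 andbT; apply/ler_addgt0Pr => eps eps0.
    by have := AB (eps / 2) (divr_gt0 eps0 (ltr0Sn R 1)); rewrite add0r divfK ?gt_eqF.
  by rewrite normr_eq0 addr_eq0 => /eqP.
move=> eps0.
have D := is_derive_translate oOm bOm i 0 Lm se.
have [d2 d20 d2P] := is_derive_increment D eps0.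
pose t := Num.min (d2 / 2) (Num.min r (eps / G)).
have t0 : 0 < t by rewrite !lt_min !divr_gt0.
have [tr tG] : t <= r /\ t * G <= eps.
  by split; [rewrite !ge_min lexx !orbT|rewrite -ler_pdivlMr// !ge_min lexx !orbT].
have td2 : t < d2.
  apply: (@le_lt_trans _ _ (d2 / 2)); first by rewrite !ge_min lexx.
  by rewrite ltr_pdivrMr// ltr_pMr// ltr1n.
have ets x : eta x != 0 -> sweep Om i t r x by move=> /er; exact: erode_sweep.
have Ive := increment_L1 oOm bOm Lm ce t0 r0' ets.
have Lpe : L1 Om (fun x => t * (partial i m x * eta x)).
  by apply: L1Z => //; apply: Linf_in_L1 => //; exact: LinfM.
have S1 : `|vol_int Om (fun x => (m (x + t *: delta_mx 0 i) - m x) * eta x) + t * A| <= eps * t.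
  have := d2P t; rewrite t0 td2 => /(_ isT); rewrite add0r.
  have Lve s : L1 Om (fun x => m x * eta (x - s *: delta_mx 0 i)).
    apply: Linf_in_L1 => //; apply: LinfM => //.
    by apply: continuous_Linf => //; exact: continuous_shift.
  have [E1 I1] := @vol_int_shift_support _ _ _ oOm m eta (t *: delta_mx 0 i)
    (fun x wx => sweep_sub (ltW t0) r0' (ets x wx)) (Lve t).
  rewrite -E1 -vol_intB//.
  have -> : vol_int Om (fun x => m x * - partial i eta (x - 0 *: delta_mx 0 i)) = - A.
    rewrite -vol_intN//; first by apply: vol_int_ext => x _; rewrite scale0r subr0 mulrN.
    by apply: Linf_in_L1 => //; exact: LinfM.
  rewrite mulrN opprK => h; apply: le_trans h; rewrite le_eqVlt; apply/orP; left.
  by apply/eqP; congr (`|_ + _|); apply: vol_int_ext => x _; rewrite scale0r subr0; ring.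
have S2 : `|vol_int Om (fun x => (m (x + t *: delta_mx 0 i) - m x) * eta x) - t * B| <=
    `|M| * t ^+ 2 * `|K| * V.
  rewrite -vol_intZ//; last by apply: Linf_in_L1 => //; exact: LinfM.
  rewrite -vol_intB//; apply: le_trans (vol_int_norm mOm (L1B mOm Ive Lpe)) _.
  rewrite -vol_int_cst//; apply: vol_int_le => //.
  - by apply: L1_norm; exact: L1B.
  - exact: L1_cst.
  move=> x Ox; have [e0|ex] := eqVneq (eta x) 0.
    by rewrite e0 !mulr0 subrr normr0 !mulr_ge0// ?sqr_ge0 ?(ltW t0).
  rewrite mulrA -mulrBl normrM; apply: ler_pM => //.
    apply: taylor => // s st; apply: (erode_sub r0').
    exact: (sweep_erode (ets x ex)).
  exact: le_trans (eK x Ox) (ler_norm K).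
have : `|t * (A + B)| <= t * (eps * 2).
  set X := vol_int _ _ in S1 S2.
  have -> : t * (A + B) = (X + t * A) - (X - t * B) by ring.
  apply: le_trans (ler_normB _ _) _; apply: le_trans (lerD S1 S2) _.
  have -> : eps * t + `|M| * t ^+ 2 * `|K| * V = t * (eps + t * (G - 1)) by rewrite /G; ring.
  rewrite ler_pM2l//; move: tG; rewrite mulrBr mulr1; lra.
by rewrite normrM (gtr0_norm t0) ler_pM2l.
Qed.

(** Separates the continuous extension [u] from [m], whose values on the boundary are arbitrary. *)
Lemma H1_C2 u m : {within closure Om, continuous u} ->
  (forall x, Om x -> u x = m x) -> Ck_closure 2 Om m -> H1 u (fun i => partial i m).
Proof.
move=> cu um m2; split=> //; apply/weak_gradientP => i; split.
  have m1 : Ck_closure 1 Om (partial i m) by have [_ /(_ i)[_]] := m2.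
  by apply: Linf_in_L2 => //; exact: Ck_closure_Linf m1.
apply: weak_partial_ext (weak_partial_C2 i m2) => // x Ox.
by rewrite um.
Qed.

Lemma H1_smooth f : smooth f -> H1 f (fun i => partial i f).
Proof.
move=> sf; apply: H1_C2 => //.
  by apply: continuous_subspaceT; exact: Ck_continuous (sf 0%N).
exact: Ck_closure_sub (sf 2%N).
Qed.

Lemma H1_cst (c : R) : H1 (fun=> c) (fun _ _ => 0).
Proof.
have sc : smooth (fun _ : 'rV[R]_N => c) by move=> k; exact: Ck_cst.
by apply: H1_ext (H1_smooth sc) => // i x _; exact: derive_cst.
Qed.

End H1Ring.

(** * Transport of L2 mass along segments, and the Poincare inequality on a cube *)

Section SignedIncrement.
Context {R : realType} {N : nat}.
Implicit Types (u v p q w f : 'rV[R]_N -> R) (x y : 'rV[R]_N) (s t r d eps : R).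
Variable Om : set 'rV[R]_N.
Hypotheses (oOm : open Om) (bOm : bounded_set Om).
Implicit Types (du dv : 'I_N -> 'rV[R]_N -> R).

Local Notation leb := (@lebesgue_rV R N : set (borel_rV R N) -> \bar R).
Local Notation H1 := (H1_continuous Om).
Let mOm := domain_measurable oOm.
Let fOm := domain_finite oOm bOm.

Lemma meas_on_sub (A B : set (borel_rV R N)) f : measurable B -> A `<=` B ->
  meas_on B f -> meas_on A f.
Proof. by move=> mB AB; exact: measurable_funS. Qed.

Lemma Linf_sub (A B : set (borel_rV R N)) f : measurable B -> A `<=` B ->
  Linf B f -> Linf A f.
Proof.
move=> mB AB [mf [M fM]]; split; first exact: meas_on_sub mf.
by exists M => x /AB; exact: fM.
Qed.

Lemma Linf_translate (W : set (borel_rV R N)) (v : 'rV[R]_N) f :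
  (forall x : 'rV[R]_N, W x -> Om (x + v)) -> Linf Om f ->
  Linf W (fun x => f (x + v)).
Proof.
move=> WO [mf [M fM]]; split; last by exists M => x /WO; exact: fM.
apply: (@meas_on_sub W [set x : 'rV[R]_N | Om (x + v)]) => //.
  exact: measurable_shift_set.
exact: meas_on_shift.
Qed.

Lemma sub_domain_finite (W : set (borel_rV R N)) : measurable W -> W `<=` Om ->
  (leb W < +oo)%E.
Proof. by move=> mW WO; apply: le_lt_trans fOm; apply: le_measure; rewrite ?inE. Qed.

(** For negative [t] the segment is traversed backwards from the translate of [W]. *)
Lemma increment_signed u du i t (W : set (borel_rV R N)) : H1 u du -> measurable W ->
  (forall x : 'rV[R]_N, W x -> forall s, 0 <= s <= 1 -> Om (x + (s * t) *: delta_mx 0 i)) ->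
  Linf W (fun x => u (x + t *: delta_mx 0 i) - u x) /\
  vol_int W (fun x => (u (x + t *: delta_mx 0 i) - u x) ^+ 2) <=
    t ^+ 2 * vol_int Om (fun x => du i x ^+ 2).
Proof.
move=> Hu mW WO; have [cu /weak_gradientP wu] := Hu; have [L2u up] := wu i.
have Lu := H1_Linf oOm bOm Hu.
have W0 : W `<=` Om.
  by move=> x /WO/(_ 0); rewrite lexx ler01 mul0r scale0r addr0; apply.
have W1 (x : 'rV[R]_N) : W x -> Om (x + t *: delta_mx 0 i).
  by move=> /WO/(_ 1); rewrite lexx ler01 mul1r; apply.
have LW : Linf W (fun x => u (x + t *: delta_mx 0 i) - u x).
  by apply: LinfB => //; [exact: Linf_translate|exact: Linf_sub Lu].
split=> //.
have I2 : L1 W (fun x => (u (x + t *: delta_mx 0 i) - u x) ^+ 2).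
  apply: Linf_in_L1 => //; last exact: LinfM.
  exact: sub_domain_finite.
have [t0|t0|t0] := ltgtP 0 t.
- have [J le] := increment_path oOm bOm cu L2u up t0.
  apply: le_trans le; apply: vol_int_subset => //.
  + by apply: measurable_path_domain => //; exact: ltW.
  + move=> x Wx s /andP[s0 st].
    have -> : s = s / t * t by rewrite divfK// gt_eqF.
    by apply: WO => //; rewrite divr_ge0 ?(ltW t0)//= ler_pdivrMr// mul1r.
  + by move=> x _; exact: sqr_ge0.
- have Nt0 : 0 < - t by rewrite oppr_gt0.
  have [J le] := increment_path oOm bOm cu L2u up Nt0.
  rewrite sqrrN in le; apply: le_trans le.
  pose B : set (borel_rV R N) := [set y : 'rV[R]_N | W (y + (- t) *: delta_mx 0 i)].
  have mB : measurable B := measurable_shift_set _ mW.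
  have BP : B `<=` path_domain Om i (- t).
    move=> y By s /andP[s0 st].
    have -> : y + s *: delta_mx 0 i = y + - t *: delta_mx 0 i +
        ((1 - s / - t) * t) *: delta_mx 0 i.
      rewrite -addrA -scalerDl; congr (_ + _ *: _); field; rewrite lt_eqF//.
    apply: WO => //; rewrite subr_ge0 ler_pdivrMr// mul1r st /=.
    by rewrite gerBl divr_ge0// ltW.
  have -> : vol_int W (fun x => (u (x + t *: delta_mx 0 i) - u x) ^+ 2) =
      vol_int B (fun x => (u (x + - t *: delta_mx 0 i) - u x) ^+ 2).
    rewrite -(@vol_int_shift _ _ W (- t *: delta_mx 0 i))//.
    apply: vol_int_ext => x _; rewrite -addrA -scalerDl addNr scale0r addr0.
    by rewrite -sqrrN opprB.
  apply: vol_int_subset => //.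
  + by apply: measurable_path_domain => //; exact: ltW.
  + by move=> x _; exact: sqr_ge0.
- rewrite -t0 expr0n /= mul0r (@vol_int_ext _ _ _ _ (fun=> 0)) ?vol_int0// => x _.
  by rewrite scale0r addr0 subrr expr0n.
Qed.

(** From u(x + t e)^2 <= 2 u(x)^2 + 2 (u(x + t e) - u(x))^2: mass moves along a coordinate direction
    at the cost of Dirichlet energy. *)
Lemma transfer u du i t (W : set (borel_rV R N)) : H1 u du -> measurable W ->
  (forall x : 'rV[R]_N, W x -> forall s, 0 <= s <= 1 -> Om (x + (s * t) *: delta_mx 0 i)) ->
  vol_int [set y : 'rV[R]_N | W (y - t *: delta_mx 0 i)] (fun x => u x ^+ 2) <=
  2 * vol_int W (fun x => u x ^+ 2) + 2 * t ^+ 2 * vol_int Om (fun x => du i x ^+ 2).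
Proof.
move=> Hu mW WO; have [LW le] := increment_signed Hu mW WO.
have Lu := H1_Linf oOm bOm Hu.
have W0 : W `<=` Om.
  by move=> x /WO/(_ 0); rewrite lexx ler01 mul0r scale0r addr0; apply.
have W1 (x : 'rV[R]_N) : W x -> Om (x + t *: delta_mx 0 i).
  by move=> /WO/(_ 1); rewrite lexx ler01 mul1r; apply.
have fW := sub_domain_finite mW W0.
have LuW : Linf W u := Linf_sub mOm W0 Lu.
have Lut : Linf W (fun x => u (x + t *: delta_mx 0 i)) by exact: Linf_translate.
have Iut : L1 W (fun x => u (x + t *: delta_mx 0 i) ^+ 2).
  by apply: Linf_in_L1 => //; exact: LinfM.
have IuW : L1 W (fun x => u x ^+ 2) by apply: Linf_in_L1 => //; exact: LinfM.
have IdW : L1 W (fun x => (u (x + t *: delta_mx 0 i) - u x) ^+ 2).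
  by apply: Linf_in_L1 => //; exact: LinfM.
have -> : vol_int [set y : 'rV[R]_N | W (y - t *: delta_mx 0 i)] (fun x => u x ^+ 2) =
    vol_int W (fun x => u (x + t *: delta_mx 0 i) ^+ 2).
  rewrite -(@vol_int_shift _ _ W (- (t *: delta_mx 0 i)))//.
  by apply: vol_int_ext => x _; rewrite subrK.
apply: (@le_trans _ _ (2 * vol_int W (fun x => u x ^+ 2) +
   2 * vol_int W (fun x => (u (x + t *: delta_mx 0 i) - u x) ^+ 2))).
  rewrite -!vol_intZ// -vol_intD//; [|exact: L1Z..].
  apply: vol_int_le => //; first by apply: L1D => //; exact: L1Z.
  move=> x _; set a := u (x + _); set b := u x.
  by have := sqr_ge0 (a - 2 * b); rewrite !expr2; nra.
by rewrite -[2 * t ^+ 2 * _]mulrA lerD2l ler_pM2l.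
Qed.

End SignedIncrement.
Section BoxMean.
Context {R : realType} {N : nat}.
Implicit Types (u : 'rV[R]_N -> R) (x y v : 'rV[R]_N) (s t r d eps : R).
Variable Om : set 'rV[R]_N.
Hypotheses (oOm : open Om) (bOm : bounded_set Om).
Implicit Types (du dv : 'I_N -> 'rV[R]_N -> R).
Variables (c : 'rV[R]_N) (rho : R).
Hypotheses (rho0 : 0 < rho) (QO : cube c rho `<=` Om).

Local Notation leb := (@lebesgue_rV R N : set (borel_rV R N) -> \bar R).
Local Notation H1 := (H1_continuous Om).
Local Notation Q := (cube c rho : set (borel_rV R N)).
Let mOm := domain_measurable oOm.
Let mQ : measurable Q := measurable_cube c rho.
Let fQ : (leb Q < +oo)%E := sub_domain_finite oOm bOm mQ QO.

Definition dirichlet du : R := \sum_i vol_int Om (fun x => du i x ^+ 2).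

Lemma dirichlet_ge0 du : 0 <= dirichlet du.
Proof. by apply: sumr_ge0 => i _; apply: vol_int_ge0 => x _; exact: sqr_ge0. Qed.

Definition overlap v : set (borel_rV R N) := [set x : 'rV[R]_N | Q x /\ Q (x + v)].

Let overlapQ v : overlap v `<=` Q. Proof. by move=> x []. Qed.

Lemma measurable_overlap v : measurable (overlap v).
Proof. by apply: measurableI => //; exact: measurable_shift_set. Qed.

(** Truncations of [v], by which a translation is carried out one coordinate at a time. *)
Let front (k : nat) v : 'rV[R]_N := \row_j (if (j < k)%N then v 0 j else 0).

(** Induction on the number of coordinates moved. Intermediate points stay in the cube because its
    coordinates vary independently; each step doubles the constant by (a + b)^2 <= 2 a^2 + 2 b^2. *)
Lemma box_increment : exists2 K : R, 0 <= K & forall u du v, H1 u du ->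
  Linf (overlap v) (fun x => u (x + v) - u x) /\
  vol_int (overlap v) (fun x => (u (x + v) - u x) ^+ 2) <=
  K * (2 * rho) ^+ 2 * dirichlet du.
Proof.
suff claim m : (m <= N)%N -> exists2 K : R, 0 <= K & forall u du v, H1 u du ->
  vol_int (overlap v) (fun x => (u (x + front m v) - u x) ^+ 2) <=
  K * (2 * rho) ^+ 2 * dirichlet du.
  have [K K0 KP] := claim N (leqnn N); exists K => // u du v Hu; split.
    have Lu := H1_Linf oOm bOm Hu.
    apply: LinfB => //; last by apply: Linf_sub Lu => // x [/QO].
    by apply: (Linf_translate oOm) Lu => x [_ /QO].
  have fv : front N v = v by apply/rowP => j; rewrite mxE ltn_ord.
  by have := KP u du v Hu; rewrite fv.
elim: m => [|k IH] kN.
  exists 0 => // u du v _; rewrite !mul0r (@vol_int_ext _ _ _ _ (fun=> 0)) ?vol_int0// => x _.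
  rewrite (_ : front 0 v = 0) ?addr0 ?subrr ?expr0n//.
  by apply/rowP => j; rewrite !mxE.
have [K K0 KP] := IH (ltnW kN).
exists (2 * K + 2) => [|u du v Hu]; first by rewrite addr_ge0// mulr_ge0.
have Lu := H1_Linf oOm bOm Hu.
pose i := Ordinal kN.
pose W : set (borel_rV R N) := [set z : 'rV[R]_N | overlap v (z - front k v)].
have mW : measurable W := measurable_shift_set _ (measurable_overlap v).
have fE : front k.+1 v = front k v + v 0 i *: delta_mx 0 i.
  apply/rowP => j; rewrite !mxE /= ltnS leq_eqVlt.
  have [->|ji] := eqVneq j i; first by rewrite eqxx ltnn /= add0r mulr1.
  have -> : (j == k :> nat) = false by apply/negbTE; apply: contra ji => /eqP jk; exact/eqP/val_inj.
  by rewrite /= mulr0 addr0.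
have convex (a b s : R) j : `|a - c 0 j| <= rho -> `|a + b - c 0 j| <= rho ->
    0 <= s <= 1 -> `|a + s * b - c 0 j| <= rho.
  move=> h1 h2 /andP[s0 s1].
  have -> : a + s * b - c 0 j = (1 - s) * (a - c 0 j) + s * (a + b - c 0 j) by ring.
  apply: le_trans (ler_normD _ _) _; rewrite !normrM (ger0_norm s0).
  rewrite (@ger0_norm _ (1 - s)) ?subr_ge0//.
  have -> : rho = (1 - s) * rho + s * rho by ring.
  by apply: lerD; apply: ler_wpM2l => //; rewrite subr_ge0.
have WQ x j s : overlap v x -> 0 <= s <= 1 ->
    `|(x + front k v + (s * v 0 i) *: delta_mx 0 i) 0 j - c 0 j| <= rho.
  move=> [xQ xvQ] s01; have h1 := xQ j; have h2 := xvQ j; rewrite mxE in h2.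
  rewrite !mxE /=; have [ji|ji] := eqVneq j i.
    rewrite ji in h1 h2 *; by rewrite ltnn addr0 mulr1; exact: (convex _ _ _ _ h1 h2 s01).
  by rewrite /= mulr0 addr0; case: ifP => _; rewrite ?addr0.
have WO (z : 'rV[R]_N) : W z -> forall s, 0 <= s <= 1 -> Om (z + (s * v 0 i) *: delta_mx 0 i).
  move=> Wz s s01; apply: QO => j; have := WQ _ j s Wz s01.
  by rewrite subrK.
have mv := measurable_overlap v.
have [LW le] := increment_signed oOm bOm Hu mW WO.
have fo : (leb (overlap v) < +oo)%E.
  by apply: (sub_domain_finite oOm bOm) => // x [/QO].
have Of (m : nat) : (forall x : 'rV[R]_N, overlap v x -> Om (x + front m v)) ->
    Linf (overlap v) (fun x => u (x + front m v)).
  by move=> h; apply: (Linf_translate oOm) Lu.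
have Lk : Linf (overlap v) (fun x => u (x + front k v)).
  apply: Of => x ox; apply: QO => j; have := WQ x j 0 ox.
  by rewrite lexx ler01 mul0r scale0r addr0; apply.
have Lk1 : Linf (overlap v) (fun x => u (x + front k.+1 v)).
  apply: Of => x ox; apply: QO => j; have := WQ x j 1 ox.
  by rewrite lexx ler01 mul1r fE addrA; apply.
have L0 : Linf (overlap v) u by apply: Linf_sub Lu => // x [/QO].
have I1 : L1 (overlap v) (fun x => (u (x + front k v) - u x) ^+ 2).
  by apply: Linf_in_L1 => //; apply: LinfM => //; exact: LinfB.
have I2 : L1 (overlap v) (fun x => (u (x + front k.+1 v) - u (x + front k v)) ^+ 2).
  by apply: Linf_in_L1 => //; apply: LinfM => //; exact: LinfB.
have I3 : L1 (overlap v) (fun x => (u (x + front k.+1 v) - u x) ^+ 2).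
  by apply: Linf_in_L1 => //; apply: LinfM => //; exact: LinfB.
have B2 : vol_int (overlap v) (fun x => (u (x + front k.+1 v) - u (x + front k v)) ^+ 2) <=
    (2 * rho) ^+ 2 * dirichlet du.
  (* A point of the overlap shows that the coordinates of [v] are at most [2 * rho] in absolute
     value. *)
  have [[x [xQ xvQ]]|ov0] := pselect (overlap v !=set0); last first.
    rewrite (@vol_int_ext _ _ _ _ (fun=> 0)); last by move=> x ox; exfalso; apply: ov0; exists x.
    by rewrite vol_int0 mulr_ge0 ?sqr_ge0 ?dirichlet_ge0.
  apply: (@le_trans _ _ (v 0 i ^+ 2 * vol_int Om (fun x => du i x ^+ 2))).
    apply: le_trans le.
    have I2' : L1 W (fun z => (u (z + v 0 i *: delta_mx 0 i) - u z) ^+ 2).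
      apply: Linf_in_L1 => //; last exact: LinfM.
      apply: (sub_domain_finite oOm bOm) => // z Wz; apply: QO => j; have := WQ _ j 0 Wz.
      by rewrite subrK lexx ler01 mul0r scale0r addr0; apply.
    rewrite -(vol_int_shift (front k v) mW I2') le_eqVlt; apply/orP; left; apply/eqP.
    rewrite (_ : [set x : 'rV[R]_N | W (x + front k v)] = overlap v).
      by apply: vol_int_ext => z _; rewrite fE addrA.
    by apply/seteqP; split=> z /=; rewrite /W /= addrK.
  apply: ler_pM; rewrite ?sqr_ge0//; first by apply: vol_int_ge0 => z _; exact: sqr_ge0.
    have h1 := xQ i; have h2 := xvQ i; rewrite mxE in h2.
    rewrite -[leLHS]ger0_norm ?sqr_ge0// normrX; apply: lerXn2r; rewrite ?nnegrE//.
      by rewrite mulr_ge0// ltW.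
    have -> : v 0 i = (x 0 i + v 0 i - c 0 i) - (x 0 i - c 0 i) by ring.
    by apply: le_trans (ler_normB _ _) _; lra.
  rewrite /dirichlet (bigD1 i)//= lerDl; apply: sumr_ge0 => j _.
  by apply: vol_int_ge0 => z _; exact: sqr_ge0.
apply: (@le_trans _ _ (2 * vol_int (overlap v) (fun x => (u (x + front k v) - u x) ^+ 2) +
   2 * vol_int (overlap v) (fun x => (u (x + front k.+1 v) - u (x + front k v)) ^+ 2))).
  rewrite -!vol_intZ// -vol_intD//; [|exact: L1Z..].
  apply: vol_int_le => //; first by apply: L1D => //; exact: L1Z.
  move=> x _; set a := u (x + front k.+1 v); set b := u (x + front k v); set d := u x.
  by have := sqr_ge0 (a - b - (b - d)); rewrite !expr2; nra.
by have := KP u du v Hu; move: B2; set D := dirichlet du; lra.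
Qed.

End BoxMean.
Section BoxPoincare.
Context {R : realType} {N : nat}.
Implicit Types (u : 'rV[R]_N -> R) (x y v : 'rV[R]_N) (s t r d eps : R).
Variable Om : set 'rV[R]_N.
Hypotheses (oOm : open Om) (bOm : bounded_set Om).
Implicit Types (du dv : 'I_N -> 'rV[R]_N -> R).
Variables (c : 'rV[R]_N) (rho : R).
Hypotheses (rho0 : 0 < rho) (QO : cube c rho `<=` Om).

Local Notation leb := (@lebesgue_rV R N : set (borel_rV R N) -> \bar R).
Local Notation H1 := (H1_continuous Om).
Local Notation Q := (cube c rho : set (borel_rV R N)).
Let mOm := domain_measurable oOm.
Let mQ : measurable Q := measurable_cube c rho.
Let fQ : (leb Q < +oo)%E := sub_domain_finite oOm bOm mQ QO.

Lemma measurable_addrV : measurable_fun setT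
  (fun xv : borel_rV R N * borel_rV R N => (xv.1 : 'rV[R]_N) + xv.2 : borel_rV R N).
Proof.
apply: measurable_fun_rV => // i; under eq_fun do rewrite mxE.
apply: measurable_funD.
  exact: measurableT_comp (measurable_coord i) measurable_fst.
exact: measurableT_comp (measurable_coord i) measurable_snd.
Qed.

(** The squared increment as a function of base point and displacement, extended by 0 to the whole
    product for Tonelli's theorem. *)
Let phi u (xv : borel_rV R N * borel_rV R N) : R :=
  \1_Q xv.1 * \1_Q ((xv.1 : 'rV[R]_N) + xv.2) *
  ((u \_ Q) ((xv.1 : 'rV[R]_N) + xv.2) - (u \_ Q) xv.1) ^+ 2.

Let phi_ge0 u xv : 0 <= phi u xv.
Proof. by rewrite mulr_ge0 ?sqr_ge0// mulr_ge0. Qed.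

Let measurable_phi u : meas_on Om u -> measurable_fun setT (phi u).
Proof.
move=> mu.
have muQ : measurable_fun setT ((u : borel_rV R N -> measurableTypeR R) \_ Q).
  by apply/(measurable_restrictT _ mQ); exact: (meas_on_sub mOm QO mu).
have m1 : measurable_fun setT (\1_Q : borel_rV R N -> R) by exact: measurable_indic.
apply: measurable_funM; first apply: measurable_funM.
- exact: measurableT_comp m1 measurable_fst.
- exact: measurableT_comp m1 measurable_addrV.
- apply: measurable_funX; apply: measurable_funB.
    exact: measurableT_comp muQ measurable_addrV.
  exact: measurableT_comp muQ measurable_fst.
Qed.

(** Expanding both squares shows the identity, which trades the deviation from the mean for
    increments. *)
Lemma vol_int_variance u : Linf Q u -> 0 < vol_int Q (fun=> 1 : R) ->
  vol_int Q (fun x => (u x - vol_int Q u / vol_int Q (fun=> 1)) ^+ 2) =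
  (2 * vol_int Q (fun=> 1))^-1 * vol_int Q (fun x => vol_int Q (fun y => (u y - u x) ^+ 2)).
Proof.
move=> Lu q0; set q := vol_int Q (fun=> 1 : R); set S := vol_int Q u.
have I1 := Linf_in_L1 mQ fQ Lu.
have I2 : L1 Q (fun x => u x ^+ 2) by apply: Linf_in_L1 => //; exact: LinfM.
set T := vol_int Q (fun x => u x ^+ 2).
have E (a : R) : vol_int Q (fun x => (u x - a) ^+ 2) = T - 2 * a * S + a ^+ 2 * q.
  rewrite (@vol_int_ext _ _ _ _ (fun x => u x ^+ 2 + (-2 * a) * u x + a ^+ 2)); last first.
    by move=> x _; ring.
  rewrite vol_intD//; [|apply: L1D => //; exact: L1Z|exact: L1_cst].
  rewrite vol_intD//; last exact: L1Z.
  by rewrite vol_intZ// vol_int_cst// -/q -/S -/T; ring.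
rewrite E (@vol_int_ext _ _ _ (fun x => vol_int Q (fun y => (u y - u x) ^+ 2))
  (fun x => T + (-2 * S) * u x + q * u x ^+ 2)); last by move=> x _; rewrite E; ring.
rewrite vol_intD//; [|by apply: L1D => //; [exact: L1_cst|exact: L1Z]|exact: L1Z].
rewrite vol_intD//; [|exact: L1_cst|exact: L1Z].
rewrite !vol_intZ// vol_int_cst// -/q -/S -/T.
by field; rewrite gt_eqF.
Qed.

(** In the variance formula put y = x + v, exchange the integrals, and apply [box_increment] for
    each displacement [v]. *)
Lemma box_poincare : exists2 C : R, 0 <= C & forall u du, H1 u du ->
  exists a : R, vol_int Q (fun x => (u x - a) ^+ 2) <= C * dirichlet Om du.
Proof.
have [K K0 KP] := box_increment oOm bOm rho0 QO.
pose q := vol_int Q (fun=> 1 : R).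
have q0 : 0 < q.
  rewrite -lte_fin EFin_vol_int//; last exact: (L1_cst mQ fQ).
  by rewrite integral_cst// mul1e; exact: (lebesgue_nbhs_gt0 mQ (cube_nbhs c rho0)).
pose B : set (borel_rV R N) := cube (0 : 'rV[R]_N) (2 * rho).
pose V := vol_int B (fun=> 1 : R).
have mB : measurable B by exact: measurable_cube.
have fB : (leb B < +oo)%E by rewrite lebesgue_cube ?ltry// mulr_ge0// ltW.
have V0 : 0 <= V by apply: vol_int_ge0.
exists ((2 * q)^-1 * (K * (2 * rho) ^+ 2 * V)).
  by rewrite !mulr_ge0 ?invr_ge0 ?mulr_ge0 ?sqr_ge0// ltW.
move=> u du Hu; exists (vol_int Q u / q).
have Lu := H1_Linf oOm bOm Hu; have LuQ := Linf_sub mOm QO Lu.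
set D := dirichlet Om du; have D0 : 0 <= D := dirichlet_ge0 Om du.
rewrite vol_int_variance// -/q -[leRHS]mulrA ler_pM2l ?invr_gt0 ?mulr_gt0//.
have uQ x : Q x -> (u \_ Q) x = u x by move=> Qx; rewrite patchE mem_set.
have mphi : measurable_fun setT (EFin \o phi u).
  by apply/measurable_EFinP; apply: measurable_phi; case: Lu.
have tonelli : (\int[leb]_x \int[leb]_v (phi u (x, v))%:E =
    \int[leb]_v \int[leb]_x (phi u (x, v))%:E)%E.
  apply: (@fubini_tonelli _ _ _ _ _ leb leb (EFin \o phi u)) => //.
  by move=> xv; rewrite lee_fin.
have inner x : (\int[leb]_v (phi u (x, v))%:E =
    ((fun x => (vol_int Q (fun y => (u y - u x) ^+ 2))%:E) \_ Q) x)%E.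
  rewrite patchE; case: ifPn => [/set_mem Qx|nQx]; last first.
    by apply: integral0_eq => v _; rewrite /phi /= indicE (negbTE nQx) !mul0r.
  have Id : L1 Q (fun y => (u y - u x) ^+ 2).
    have LL := LinfB LuQ (Linf_cst Q (u x)).
    exact: (Linf_in_L1 mQ fQ (LinfM LL LL)).
  rewrite EFin_vol_int//.
  rewrite -(@ge0_integral_shift _ _ Q x (fun y => ((u y - u x) ^+ 2)%:E))//; last 2 first.
  - by apply/measurable_EFinP; exact: L1_meas Id.
  - by move=> y _; rewrite lee_fin sqr_ge0.
  rewrite [RHS]integral_mkcond; apply: eq_integral => v _.
  rewrite patchE /phi /= indicE mem_set// mul1r indicE.
  rewrite [x + v]addrC.
  have [vQ|vQ] := pselect (Q ((v : 'rV[R]_N) + x)).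
    by rewrite !mem_set// mul1r uQ// uQ.
  by rewrite !memNset// mul0r.
(* Displacements outside [B], the cube of radius [2 * rho], have empty overlap, so the bound is
   integrable in [v]. *)
have outer v : (\int[leb]_x (phi u (x, v))%:E <=
    ((cst (K * (2 * rho) ^+ 2 * D)%:E) \_ B) v)%E.
  have -> : (\int[leb]_x (phi u (x, v))%:E =
     (vol_int (overlap c rho v) (fun x => (u (x + v) - u x) ^+ 2))%:E)%E.
    have [Lo _] := KP u du v Hu.
    have mo : measurable (overlap c rho v).
      exact: measurable_overlap.
    have fo : (leb (overlap c rho v) < +oo)%E.
      by apply: (sub_domain_finite oOm bOm) => // x [/QO].
    rewrite (EFin_vol_int mo (Linf_in_L1 mo fo (LinfM Lo Lo))).
    rewrite [RHS]integral_mkcond; apply: eq_integral => x _.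
    rewrite patchE /phi /= !indicE.
    have [xQ|xQ] := pselect (Q x); last first.
      have no : ~ overlap c rho v x by case.
      by rewrite (memNset xQ) (memNset no) !mul0r.
    have [vQ|vQ] := pselect (Q ((x : 'rV[R]_N) + v)); last first.
      have no : ~ overlap c rho v x by case.
      by rewrite (memNset vQ) (memNset no) mulr0 mul0r.
    have ov : overlap c rho v x by [].
    by rewrite (mem_set xQ) (mem_set vQ) (mem_set ov) !mul1r (uQ _ xQ) (uQ _ vQ).
  have [_ le] := KP u du v Hu.
  rewrite patchE; case: ifPn => [_|nBv]; first by rewrite lee_fin.
  rewrite (@vol_int_ext _ _ _ _ (fun=> 0)) ?vol_int0// => x [xQ xvQ]; exfalso.
  move/negP: nBv; apply; apply/mem_set => j; rewrite mxE subr0.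
  have h1 := xQ j; have h2 := xvQ j; rewrite mxE in h2.
  have -> : v 0 j = (x 0 j + v 0 j - c 0 j) - (x 0 j - c 0 j) by ring.
  by apply: le_trans (ler_normB _ _) _; lra.
have Ivar : L1 Q (fun x => vol_int Q (fun y => (u y - u x) ^+ 2)).
  set T := vol_int Q (fun x => u x ^+ 2).
  have I1 := Linf_in_L1 mQ fQ LuQ.
  have I2 : L1 Q (fun x => u x ^+ 2) := Linf_in_L1 mQ fQ (LinfM LuQ LuQ).
  apply: (@L1_ext _ _ _ mQ (fun a => T + (-2 * vol_int Q u) * u a + q * u a ^+ 2)).
    move=> a _; rewrite (@vol_int_ext _ _ _ (fun x => (u x - u a) ^+ 2)
      (fun x => u x ^+ 2 + (-2 * u a) * u x + u a ^+ 2)); last by move=> x _; ring.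
    have Ia := L1Z mQ (-2 * u a) I1.
    rewrite (vol_intD mQ (L1D mQ I2 Ia) (L1_cst mQ fQ _)) (vol_intD mQ I2 Ia).
    by rewrite (vol_intZ mQ _ I1) (vol_int_cst mQ fQ) -/q -/T; ring.
  exact: (L1D mQ (L1D mQ (L1_cst mQ fQ _) (L1Z mQ _ I1)) (L1Z mQ _ I2)).
rewrite -lee_fin (EFin_vol_int mQ Ivar).
apply: (@le_trans _ _ (\int[leb]_v (((cst (K * (2 * rho) ^+ 2 * D)%:E) \_ B) v))%E).
  rewrite [leLHS]integral_mkcond.
  rewrite [leLHS](_ : _ = \int[leb]_x \int[leb]_v (phi u (x, v))%:E)%E; last first.
    by apply: eq_integral => x _; rewrite inner.
  rewrite tonelli; apply: (ge0_le_integral leb measurableT).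
  - by move=> v _; apply: integral_ge0 => x _; rewrite lee_fin phi_ge0.
  - have := @measurable_fun_fubini_tonelli_G _ _ _ _ _ leb (EFin \o phi u) mphi.
    by apply=> xv; rewrite lee_fin.
  - by apply/(measurable_restrictT _ mB); exact: measurable_cst.
  - by move=> v _; exact: outer.
rewrite -integral_mkcond (integral_cst leb mB) -/D.
have -> : K * (2 * rho) ^+ 2 * V * D = K * (2 * rho) ^+ 2 * D * V by ring.
rewrite [leRHS]EFinM /V (EFin_vol_int mB (L1_cst mB fB _)).
by rewrite (integral_cst leb mB) mul1e.
Qed.

End BoxPoincare.

(** * The Poincare inequality on a bounded smooth domain *)

Lemma compact_induction (T : topologicalType) (K : set T) (P : set T -> Prop) :
  compact K -> P set0 -> (forall A B, A `<=` B -> P B -> P A) ->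
  (forall A B, P A -> P B -> P (A `|` B)) ->
  (forall x, K x -> exists2 U, nbhs x U & P U) -> P K.
Proof.
move=> cK P0 Psub PU Ploc; apply: contrapT => nPK.
(* If [P] failed on [K], the sets whose complement in [K] satisfies [P] would form a proper filter
   containing [K]; the local hypothesis at a cluster point contradicts this. *)
pose F (A : set T) := P (K `\` A).
have FF : ProperFilter F.
  constructor; first by rewrite /F setD0.
  constructor; first by rewrite /F setDT.
    by move=> A B FA FB; rewrite /F setDIr; exact: PU.
  by move=> A B AB; apply: Psub => x [Kx nBx]; split=> // /AB.
have FK : F K by rewrite /F setDv.
have [x [Kx clx]] := cK F FF FK.
have [U xU PU'] := Ploc x Kx.
have FnU : F (~` U) by apply: Psub PU' => y [_ /contrapT].
by have [y [nUy Uy]] := clx _ _ FnU xU.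
Qed.

Section BoundaryGraph.
Context {R : realType} {n : nat}.
Implicit Types (x y : 'rV[R]_n.+1) (Om : set 'rV[R]_n.+1) (h : 'rV[R]_n -> R).

Lemma continuous_col' (i : 'I_n.+1) : continuous (fun x => col' i x : 'rV[R]_n).
Proof.
move=> x A /nbhs_rVP[e e0 eA]; apply/nbhs_rVP; exists e => // y yx.
by apply: eA => j; rewrite !mxE.
Qed.

Lemma continuous_graph (i : 'I_n.+1) h : continuous h ->
  continuous (fun x => x 0 i - h (col' i x)).
Proof.
move=> ch; apply: continuous_sub; first exact: coord_continuous.
by move=> x; apply: continuous_comp; [exact: continuous_col'|exact: ch].
Qed.

Definition graph_chart Om (x0 : 'rV[R]_n.+1) (i : 'I_n.+1) (s : bool) h (r : R) :=
  [/\ smooth h, 0 < r & forall y, (forall j, `|y 0 j - x0 0 j| < r) ->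
    (Om y <-> 0 < (-1) ^+ s * (y 0 i - h (col' i y))) /\
    (boundary Om y <-> y 0 i = h (col' i y))].

(** A point off the graph has a neighbourhood on one side of it; a point on the graph is a limit of
    points moved slightly inward. *)
Lemma boundary_graph Om x0 : open Om -> smooth_boundary Om -> boundary Om x0 ->
  exists i s h r, graph_chart Om x0 i s h r.
Proof.
move=> oOm sOm /sOm [i [s [h [sh /nbhs_rVP[r r0 hr]]]]].
exists i, s, h, r; split=> // y yr; split; first exact: hr.
have cg := @continuous_graph i h (Ck_continuous (sh 0%N)).
set g := fun x : 'rV[R]_n.+1 => x 0 i - h (col' i x).
have near_y (d : R) : 0 < d -> (forall j, `|y 0 j - x0 0 j| < r - d) ->
  forall z : 'rV[R]_n.+1, (forall j, `|z 0 j - y 0 j| <= d) -> Om z <-> 0 < (-1) ^+ s * g z.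
  move=> d0 yd z zy; apply: hr => j.
  have -> : z 0 j - x0 0 j = (z 0 j - y 0 j) + (y 0 j - x0 0 j) by ring.
  by apply: le_lt_trans (ler_normD _ _) _; have := yd j; have := zy j; lra.
have [d d0 yd] : exists2 d : R, 0 < d & forall j, `|y 0 j - x0 0 j| < r - d.
  pose M := \big[Num.max/0]_(j < n.+1) `|y 0 j - x0 0 j|.
  have Mr : M < r by apply/bigmax_ltP; split.
  exists ((r - M) / 2); first by rewrite divr_gt0// subr_gt0.
  move=> j; apply: (@le_lt_trans _ _ M); last by lra.
  exact: (le_bigmax _ (fun j => `|y 0 j - x0 0 j|)).
have yP := near_y d d0 yd.
have iOm : interior Om = Om by apply/interior_id.
rewrite /boundary iOm; split=> [[cly nOy]|gy].
  apply/eqP; rewrite -subr_eq0; apply/eqP; apply: contrapT => /eqP g0.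
  have gneg : (-1) ^+ s * g y < 0.
    rewrite lt_neqAle mulf_neq0 ?signr_eq0//= leNgt; apply/negP => gp; apply: nOy.
    by apply/yP => // j; rewrite subrr normr0 ltW.
  have cs : continuous (fun z => (-1) ^+ s * g z).
    by apply: continuous_mul => //; exact: cst_continuous.
  have : nbhs y [set z | (-1) ^+ s * g z < 0].
    by apply: (cs y [set a : R | a < 0]); exact: lt_nbhsl.
  move=> /nbhs_rVP[e e0 eN].
  have [|z [Oz /= zy]] := cly [set z | forall j, `|z 0 j - y 0 j| < Num.min d e].
    by apply/nbhs_rVP; exists (Num.min d e); rewrite ?lt_min ?d0.
  have zd : forall j, `|z 0 j - y 0 j| <= d.
    by move=> j; have := zy j; rewrite lt_min => /andP[/ltW].
  have ze : forall j, `|z 0 j - y 0 j| < e.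
    by move=> j; have := zy j; rewrite lt_min => /andP[_ ].
  by have := eN z ze; have /(yP z zd) := Oz; rewrite /=; lra.
have gy0 : g y = 0 by rewrite /g gy subrr.
split; last first.
  have yy j : `|y 0 j - y 0 j| <= d by rewrite subrr normr0 ltW.
  by move=> /(yP y yy); rewrite gy0 mulr0 ltxx.
move=> B /nbhs_rVP[e e0 eB].
pose t := Num.min d (e / 2).
have t0 : 0 < t by rewrite lt_min d0 divr_gt0.
have td : t <= d by rewrite ge_min lexx.
have te : t <= e / 2 by rewrite ge_min lexx orbT.
(* Moving inward by [t] makes the defining function equal to [t], hence positive. *)
exists (y + ((-1) ^+ s * t) *: delta_mx 0 i); split.
  apply/yP => [j|].
    rewrite !mxE addrAC subrr add0r normrM normrM normr_sign mul1r (gtr0_norm t0).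
    by rewrite eqxx /=; case: eqP => _; rewrite ?normr1 ?normr0; lra.
  rewrite /g mxE (_ : col' i _ = col' i y); last first.
    by apply/rowP => j; rewrite !mxE eq_sym (negbTE (neq_lift _ _))/= mulr0 addr0.
  rewrite !mxE !eqxx mulr1 addrAC -/(g y).
  by rewrite gy0 add0r mulrA -expr2 sqrr_sign mul1r.
apply: eB => j; rewrite !mxE addrAC subrr add0r normrM normrM normr_sign mul1r (gtr0_norm t0).
by rewrite eqxx /=; case: eqP => _; rewrite ?normr1 ?normr0; lra.
Qed.

(** A move by [t] in the inward direction changes the signed height above the graph by exactly
    [t]. *)
Lemma graph_shift Om x0 i s h r y t : graph_chart Om x0 i s h r ->
  (forall j, `|y 0 j - x0 0 j| < r / 2) -> `|t| <= r / 2 ->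
  Om (y + ((-1) ^+ s * t) *: delta_mx 0 i) <->
  0 < (-1) ^+ s * (y 0 i - h (col' i y)) + t.
Proof.
move=> [_ r0 ch] yx tr.
have yr j : `|(y + ((-1) ^+ s * t) *: delta_mx 0 i) 0 j - x0 0 j| < r.
  rewrite !mxE; set a := _ * _%:R; have ha : `|a| <= r / 2.
    rewrite normrM normrM normr_sign mul1r.
    by rewrite eqxx /=; case: eqP => _; rewrite ?normr1 ?normr0; lra.
  by rewrite addrAC; apply: le_lt_trans (ler_normD _ _) _; have := yx j; lra.
have [-> _] := ch _ yr.
rewrite (_ : col' i (y + _) = col' i y); last first.
  by apply/rowP => j; rewrite !mxE eq_sym (negbTE (neq_lift _ _))/= mulr0 addr0.
rewrite !mxE !eqxx mulr1.
rewrite (_ : _ * _ = (-1) ^+ s * (y 0 i - h (col' i y)) + (-1) ^+ s ^+ 2 * t); last by ring.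
by rewrite sqrr_sign mul1r.
Qed.

End BoundaryGraph.
Section Poincare.
Context {R : realType} {n : nat}.
Implicit Types (u : 'rV[R]_n.+1 -> R) (x y v : 'rV[R]_n.+1) (s t r d eps : R).
Variable Om : set 'rV[R]_n.+1.
Hypothesis hOm : bounded_smooth_domain Om.
Implicit Types (du dv : 'I_n.+1 -> 'rV[R]_n.+1 -> R).

Local Notation N := n.+1.
Local Notation leb := (@lebesgue_rV R N : set (borel_rV R N) -> \bar R).
Local Notation H1 := (H1_continuous Om).
Let oOm : open Om. Proof. by case: hOm. Qed.
Let bOm : bounded_set Om. Proof. by case: hOm. Qed.
Let mOm := domain_measurable oOm.

Lemma vol_int_setU (A B : set (borel_rV R N)) u : measurable A -> measurable B ->
  (forall x, (A `|` B) x -> 0 <= u x) -> L1 (A `|` B) u ->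
  vol_int (A `|` B) u <= vol_int A u + vol_int B u.
Proof.
move=> mA mB u0 Iu.
have mAB : measurable (A `|` B) := measurableU _ _ mA mB.
have mBA : measurable (B `\` A) := measurableD mB mA.
have AE : A `|` B = A `|` (B `\` A).
  apply/seteqP; split=> x => [[Ax|Bx]|[Ax|[Bx _]]]; [by left| |by left|by right].
  by have [Ax|nAx] := pselect (A x); [left|right].
have BAB : B `\` A `<=` B by move=> x [].
have IA := L1_sub mA mAB (@subsetUl _ A B) Iu.
have IB := L1_sub mB mAB (@subsetUr _ A B) Iu.
have IBA := L1_sub mBA mB BAB IB.
apply: (@le_trans _ _ (vol_int A u + vol_int (B `\` A) u)).
  rewrite -lee_fin EFinD (EFin_vol_int mAB Iu) (EFin_vol_int mA IA) (EFin_vol_int mBA IBA).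
  rewrite AE (ge0_integral_setU leb mA mBA) //.
  - by rewrite -AE; apply/measurable_EFinP; exact: L1_meas Iu.
  - by move=> x; rewrite -AE lee_fin; exact: u0.
  - by apply/disj_set2P; rewrite setDE setICA setICr setI0.
by rewrite lerD2l; apply: (vol_int_subset mBA mB BAB _ IB) => x Bx; apply: u0; right.
Qed.

Section Control.
Variables (x1 : 'rV[R]_N) (r1 : R).

Let energy u du := vol_int (cube x1 r1) (fun x => u x ^+ 2) + dirichlet Om du.

Let energy_ge0 u du : 0 <= energy u du.
Proof.
by rewrite addr_ge0 ?dirichlet_ge0//; apply: vol_int_ge0 => x _; exact: sqr_ge0.
Qed.

(** Square integrals over the set are bounded by the mass on the base cube plus the Dirichlet
    energy. The larger measurable set [W] lets the property pass to arbitrary subsets. *)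
Definition controlled (A : set 'rV[R]_N) : Prop :=
  exists W : set (borel_rV R N), [/\ measurable W, A `<=` W &
    exists2 C : R, 0 <= C & forall u du, H1 u du ->
      vol_int (W `&` Om) (fun x => u x ^+ 2) <= C * energy u du].

Let sqr_L1 u du (A : set (borel_rV R N)) : H1 u du -> measurable A -> A `<=` Om ->
  L1 A (fun x => u x ^+ 2).
Proof.
move=> Hu mA AO; have Lu := Linf_sub mOm AO (H1_Linf oOm bOm Hu).
exact: Linf_in_L1 mA (sub_domain_finite oOm bOm mA AO) _ (LinfM Lu Lu).
Qed.

Lemma controlledS (A B : set 'rV[R]_N) : A `<=` B -> controlled B -> controlled A.
Proof. by move=> AB [W [mW BW h]]; exists W; split=> // x /AB/BW. Qed.

Lemma controlledU (A B : set 'rV[R]_N) : controlled A -> controlled B ->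
  controlled (A `|` B).
Proof.
move=> [V [mV AV [C C0 VP]]] [W [mW BW [D D0 WP]]].
exists (V `|` W); split; first exact: measurableU.
  by move=> x [/AV|/BW]; [left|right].
exists (C + D) => [|u du Hu]; first exact: addr_ge0.
have mVO : measurable (V `&` Om : set (borel_rV R N)) := measurableI _ _ mV mOm.
have mWO : measurable (W `&` Om : set (borel_rV R N)) := measurableI _ _ mW mOm.
have I : L1 ((V `&` Om) `|` (W `&` Om)) (fun x => u x ^+ 2).
  by apply: (sqr_L1 Hu) => [|x [[]|[]]//]; exact: measurableU.
rewrite setIUl; apply: le_trans (vol_int_setU mVO mWO _ I) _ => [x _|].
  exact: sqr_ge0.
by rewrite mulrDl lerD ?VP ?WP.
Qed.

Lemma controlled0 : controlled set0.
Proof.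
exists set0; split; [exact: measurable0|by []|].
by exists 0 => // u du _; rewrite set0I mul0r /vol_int integral_set0.
Qed.

(** The translate of the part of [A] in [Om] lies in [B], and [transfer] brings its mass back. *)
Lemma controlled_move (A B : set 'rV[R]_N) i t :
  measurable (A : set (borel_rV R N)) -> controlled B ->
  (forall x, A x -> Om x -> B (x + t *: delta_mx 0 i) /\
    forall s, 0 <= s <= 1 -> Om (x + (s * t) *: delta_mx 0 i)) ->
  controlled A.
Proof.
move=> mA [W [mW BW [C C0 WP]]] AB; exists A; split=> //.
exists (2 * C + 2 * t ^+ 2) => [|u du Hu]; first by apply: addr_ge0; apply: mulr_ge0 => //; exact: sqr_ge0.
have mAO : measurable (A `&` Om : set (borel_rV R N)) := measurableI _ _ mA mOm.
have mWO : measurable (W `&` Om : set (borel_rV R N)) := measurableI _ _ mW mOm.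
pose Z : set (borel_rV R N) := [set x : 'rV[R]_N | (A `&` Om) (x - t *: delta_mx 0 i)].
have mZ : measurable Z := measurable_shift_set _ mAO.
have ZP (x : 'rV[R]_N) : Z x -> forall s, 0 <= s <= 1 -> Om (x + (s * - t) *: delta_mx 0 i).
  move=> [Ax Ox] s /andP[s0 s1]; have [_ /(_ (1 - s))] := AB _ Ax Ox.
  rewrite -addrA -scaleNr -scalerDl.
  have -> : - t + (1 - s) * t = s * - t by ring.
  by apply; rewrite subr_ge0 s1 gerBl.
have le := transfer oOm bOm Hu mZ ZP.
have ZW : Z `<=` W `&` Om.
  move=> x [Ax Ox]; have [Bx /(_ 1)] := AB _ Ax Ox.
  rewrite lexx ler01 mul1r subrK => /(_ isT) Ox'; split=> //.
  by apply: BW; rewrite subrK in Bx.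
have -> : A `&` Om = [set y : 'rV[R]_N | Z (y - - t *: delta_mx 0 i)].
  by apply/seteqP; split=> y; rewrite /Z /= scaleNr opprK addrK.
apply: le_trans le _; rewrite [leRHS]mulrDl; apply: lerD.
  rewrite -mulrA ler_pM2l//; apply: le_trans (WP u du Hu).
  apply: vol_int_subset => //; first by move=> x _; exact: sqr_ge0.
  by apply: (sqr_L1 Hu) => // x [].
rewrite sqrrN; apply: ler_wpM2l; first by apply: mulr_ge0 => //; exact: sqr_ge0.
apply: (@le_trans _ _ (dirichlet Om du)); last first.
  by rewrite lerDr; apply: vol_int_ge0 => x _; exact: sqr_ge0.
rewrite /dirichlet (bigD1 i)//= lerDl; apply: sumr_ge0 => j _.
by apply: vol_int_ge0 => z _; exact: sqr_ge0.
Qed.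

(* The centre is moved one coordinate at a time. *)
Lemma controlled_cube x y r d : cube x r `<=` Om ->
  (forall j, `|y 0 j - x 0 j| + d <= r) -> controlled (cube y d) ->
  controlled (cube x d).
Proof.
move=> xO xy cy.
pose z k : 'rV[R]_N := \row_j (if (j < k)%N then y 0 j else x 0 j).
suff claim k : (k <= N)%N -> controlled (cube (z (N - k)%N) d).
  by have := claim N (leqnn _); rewrite subnn (_ : z 0%N = x)//; apply/rowP => j; rewrite mxE.
elim: k => [_|k IH kN].
  by rewrite subn0 (_ : z N = y)//; apply/rowP => j; rewrite mxE ltn_ord.
have [d0|d0] := leP 0 d; last first.
  apply: controlledS controlled0 => v /(_ ord0) h; exfalso.
  by have := le_lt_trans h d0; rewrite ltNge normr_ge0.
have iN : (N - k.+1 < N)%N by rewrite ltn_subrL.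
pose i := Ordinal iN.
have Nk : (N - k = (N - k.+1).+1)%N by rewrite subnSK.
apply: (@controlled_move _ (cube (z (N - k)%N) d) i (y 0 i - x 0 i)).
- exact: measurable_cube.
- exact: IH (ltnW kN).
- move=> v vz _.
  have vE j c : (v + c *: delta_mx 0 i) 0 j = v 0 j + c * (j == i)%:R by rewrite !mxE.
  split=> [j|s /andP[s0 s1]].
    have ltE : (j < N - k)%N = (j == (N - k.+1)%N :> nat) || (j < N - k.+1)%N.
      by rewrite Nk ltnS leq_eqVlt.
    have := vz j; rewrite vE !mxE ltE; move: ltE => _.
    have [->|ji] := eqVneq j i; last first.
      have -> : (j == (N - k.+1)%N :> nat) = false.
        by apply/negbTE; apply: contra ji => /eqP jk; exact/eqP/val_inj.
      by rewrite mulr0 addr0.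
    rewrite ltnn eqxx /= mulr1.
    by have -> : v 0 i + (y 0 i - x 0 i) - y 0 i = v 0 i - x 0 i by ring.
  apply: xO => j; rewrite vE; have := vz j; have h := xy j; rewrite mxE.
  have [ji|ji] := eqVneq j i.
    rewrite ji ltnn mulr1 => h'.
    have -> : v 0 i + s * (y 0 i - x 0 i) - x 0 i = s * (y 0 i - x 0 i) + (v 0 i - x 0 i) by ring.
    apply: le_trans (ler_normD _ _) _; rewrite normrM (ger0_norm s0).
    have : s * `|y 0 i - x 0 i| <= `|y 0 i - x 0 i| by apply: ler_piMl.
    by rewrite ji in h; lra.
  rewrite mulr0 addr0; case: ifP => _ h'; last by have := normr_ge0 (y 0 j - x 0 j); lra.
  have -> : v 0 j - x 0 j = (v 0 j - y 0 j) + (y 0 j - x 0 j) by ring.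
  by apply: le_trans (ler_normD _ _) _; lra.
Qed.

Lemma cubeS x y r d : (forall j, `|y 0 j - x 0 j| + d <= r) -> cube y d `<=` cube x r.
Proof.
move=> xy v vy j; have -> : v 0 j - x 0 j = (v 0 j - y 0 j) + (y 0 j - x 0 j) by ring.
by apply: le_trans (ler_normD _ _) _; have := xy j; have := vy j; lra.
Qed.

Hypotheses (r10 : 0 < r1) (x1O : cube x1 r1 `<=` Om).

(** Connectedness: the set of such points contains [x1], is open, and is closed in [Om], since a
    small cube can be moved to a nearby good centre. *)
Lemma controlled_interior x : Om x -> exists2 r, 0 < r & controlled (cube x r).
Proof.
pose S := [set x | Om x /\ exists2 r, 0 < r & controlled (cube x r)].
suff SE : S = Om by rewrite -SE => -[].
have [_ cOm _ _ _] := hOm; apply: cOm.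
- exists x1; split; first by apply: x1O => j; rewrite subrr normr0 ltW.
  exists r1 => //; exists (cube x1 r1); split=> //; first exact: measurable_cube.
  exists 1 => // u du _; rewrite mul1r (_ : cube x1 r1 `&` Om = cube x1 r1).
    by rewrite lerDl dirichlet_ge0.
  by apply/seteqP; split=> z => [[]//|Qz]; split=> //; exact: x1O.
- exists S; last by apply/seteqP; split=> z => [Sz|[_ []]//]; split=> //; case: Sz.
  rewrite openE => z [Oz [r r0 cr]].
  have /nbhs_rVP[e e0 eO] : nbhs z Om by exact: open_nbhs_nbhs.
  apply/nbhs_rVP; exists (Num.min e (r / 2)); first by rewrite lt_min e0 divr_gt0.
  move=> y yz; split; first by apply: eO => j; have := yz j; rewrite lt_min => /andP[].
  exists (r / 2); first by rewrite divr_gt0.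
  apply: controlledS cr; apply: cubeS => j.
  by have := yz j; rewrite lt_min => /andP[_]; lra.
- exists (closure S); first exact: closed_closure.
  apply/seteqP; split=> z => [Sz|[Oz clz]]; first by split; [case: Sz|exact: subset_closure].
  split=> //; have /nbhs_cube[r r0 rO] : nbhs z Om by exact: open_nbhs_nbhs.
  have [|y [[Oy [d d0 cd]] yz]] := clz (cube z (r / 4)).
    by apply: cube_nbhs; rewrite divr_gt0.
  have m0 : 0 < Num.min d (r / 4) by rewrite lt_min d0 divr_gt0.
  have md : Num.min d (r / 4) <= d by rewrite ge_min lexx.
  have mr : Num.min d (r / 4) <= r / 4 by rewrite ge_min lexx orbT.
  exists (Num.min d (r / 4)) => //.
  apply: (@controlled_cube _ y r) => // [j|]; first by have := yz j; lra.
  by apply: controlledS cd; apply: cubeS => j; rewrite subrr normr0 add0r.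
Qed.

(** Near a boundary point a small cube is pushed inward across the graph by [r / 4], onto a
    controlled cube; compactness of the closure does the rest. *)
Lemma controlled_closure : controlled (closure Om).
Proof.
have [_ _ _ _ sOm] := hOm.
apply: (compact_induction (compact_closure_domain bOm)).
- exact: controlled0.
- exact: controlledS.
- exact: controlledU.
move=> x clx; have [Ox|nOx] := pselect (Om x).
  by have [r r0 cr] := controlled_interior Ox; exists (cube x r) => //; exact: cube_nbhs.
have bx : boundary Om x by split=> // /interior_subset.
have [i [s [h [r ch]]]] := boundary_graph oOm sOm bx; have [_ r0 _] := ch.
have e0 : 0 < (-1) ^+ s * (x 0 i - h (col' i x)) + r / 4.
  have xr j : `|x 0 j - x 0 j| < r by rewrite subrr normr0.
  by have [_ _ /(_ x xr)[_ /iffLR/(_ bx)]] := ch => ->; rewrite subrr mulr0 add0r divr_gt0.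
have xr j : `|x 0 j - x 0 j| < r / 2 by rewrite subrr normr0 divr_gt0.
have r4 : `|r / 4| <= r / 2 by rewrite gtr0_norm ?divr_gt0//; lra.
have /(graph_shift ch xr r4) Oz := e0.
have [d d0 cd] := controlled_interior Oz.
pose e := Num.min d (r / 4).
have e0' : 0 < e by rewrite lt_min d0 divr_gt0.
have ed : e <= d by rewrite ge_min lexx.
have er : e <= r / 4 by rewrite ge_min lexx orbT.
exists (cube x e); first exact: cube_nbhs.
apply: (controlled_move (i := i) (t := (-1) ^+ s * (r / 4)) (measurable_cube x e) cd) => v vx Ov.
split=> [j|t /andP[t0 t1]].
  by have := vx j; rewrite !mxE; set a := v 0 j; set b := x 0 j; set w := _ * _%:R;
    rewrite (_ : a + w - (b + w) = a - b); [lra|ring].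
have vr j : `|v 0 j - x 0 j| < r / 2 by have := vx j; lra.
have t4 : `|t * (r / 4)| <= r / 2.
  by rewrite ger0_norm; nra.
rewrite mulrCA; apply/(graph_shift ch vr t4).
have t00 : `|(0 : R)| <= r / 2 by rewrite normr0 divr_ge0// ltW.
have /iffLR := graph_shift ch vr t00; rewrite mulr0 scale0r !addr0 => /(_ Ov) v0.
by rewrite ltr_wpDr// mulr_ge0// divr_ge0// ltW.
Qed.

End Control.

(** The mass of [u - a] on the base cube is bounded by [box_poincare], and [controlled_closure]
    spreads the bound over [Om]. *)
Lemma poincare : exists2 C : R, 0 <= C & forall u du, H1 u du ->
  exists a : R, vol_int Om (fun x => (u x - a) ^+ 2) <= C * dirichlet Om du.
Proof.
have [_ _ [x1 Ox1] _ _] := hOm.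
have /nbhs_cube[r1 r10 x1O] : nbhs x1 Om by exact: open_nbhs_nbhs.
have [W [mW OW [C C0 CP]]] := controlled_closure r10 x1O.
have [D D0 DP] := box_poincare oOm bOm r10 x1O.
exists (C * (D + 1)) => [|u du Hu]; first by rewrite mulr_ge0// addr_ge0.
have [a le] := DP u du Hu; exists a.
have Ha := H1_add oOm bOm Hu (H1_cst oOm bOm (- a)).
have dE : dirichlet Om (fun i x => du i x + 0) = dirichlet Om du.
  by congr dirichlet; apply/funext => i; apply/funext => x; rewrite addr0.
have := CP _ _ Ha; rewrite dE (_ : W `&` Om = Om); last first.
  by apply/seteqP; split=> [x []//|x Ox]; split=> //; apply: OW; exact: subset_closure.
move=> /le_trans; apply; rewrite -mulrA ler_wpM2l// [leRHS]mulrDl mul1r.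
by rewrite lerD2r.
Qed.

End Poincare.

(** * Picone's identity and the variational characterization of the eigenvalue *)

Lemma surf_int_ext (R : realType) (n : nat) (A : set 'rV[R]_n.+1) (f g : 'rV[R]_n.+1 -> R) :
  (forall x, A x -> f x = g x) -> surf_int A f = surf_int A g.
Proof.
move=> fg; rewrite /surf_int /integral.
suff -> : (EFin \o f) \_ A = (EFin \o g) \_ A by [].
by apply/funext => x; rewrite !patchE; case: ifPn => // /set_mem Ax /=; rewrite fg.
Qed.

Section Picone.
Context {R : realType} {n : nat}.
Local Notation N := n.+1.
Implicit Types (u v g phi psi beta V : 'rV[R]_N -> R) (x y : 'rV[R]_N) (s t r d eps : R).
Variable Om : set 'rV[R]_N.
Hypotheses (oOm : open Om) (bOm : bounded_set Om).
Implicit Types (du dv dg dphi dpsi p q : 'I_N -> 'rV[R]_N -> R).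

Local Notation leb := (@lebesgue_rV R N : set (borel_rV R N) -> \bar R).
Local Notation H1 := (H1_continuous Om).
Local Notation I := (vol_int Om).
Local Notation Sf := (surf_int (boundary Om)).
Let mOm := domain_measurable oOm.
Let fOm := domain_finite oOm bOm.

Let bndry x : boundary Om x -> closure Om x. Proof. by case. Qed.

Definition drift p g dg : R := \sum_i I (fun x => p i x * g x * dg i x).

Definition weight p g : R := \sum_i I (fun x => (p i x * g x) ^+ 2).

(** This is phi grad(g / phi), which measures how far [g] is from a multiple of [phi]. *)
Definition log_defect phi dphi g dg : 'I_N -> 'rV[R]_N -> R :=
  fun i x => dg i x - g x / phi x * dphi i x.

Lemma weak_eigen beta D alpha p V lambda phi dphi psi dpsi :
  (forall i, Linf Om (p i)) ->
  robin_eigenpair Om beta D (fun i x => 2 * alpha * p i x) V lambda phi dphi ->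
  H1 psi dpsi ->
  D * (\sum_i I (fun x => dphi i x * dpsi i x))
  - 2 * alpha * (\sum_i I (fun x => p i x * dphi i x * psi x))
  + I (fun x => V x * phi x * psi x) + D * Sf (fun x => beta x * phi x * psi x)
  = lambda * I (fun x => phi x * psi x).
Proof.
move=> Lp [Hphi _ E] Hpsi; rewrite -(E _ _ Hpsi).
have Lpsi := H1_Linf oOm bOm Hpsi.
rewrite (vol_int_sum mOm); last by move=> i; apply: (L2_mul mOm); [exact: H1_L2 Hphi|exact: H1_L2 Hpsi].
congr (_ - _ + _ + _).
have L i : L1 Om (fun x => p i x * dphi i x * psi x).
  have L2p := L2_Linf mOm (Lp i) (H1_L2 i Hphi).
  exact: (L2_mul mOm L2p (Linf_in_L2 mOm fOm Lpsi)).
rewrite -(vol_int_sum mOm)// -(vol_intZ mOm); last exact: (L1_sum mOm).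
apply: vol_int_ext => x _; rewrite mulr_sumr mulr_suml.
by apply: eq_bigr => i _; rewrite !mulrA.
Qed.

Lemma log_defect_L2 phi dphi g dg i : (forall x, closure Om x -> 0 < phi x) ->
  H1 phi dphi -> H1 g dg -> L2 Om (log_defect phi dphi g dg i).
Proof.
move=> phi0 Hphi Hg; apply: (L2B mOm); first exact: H1_L2 Hg.
have Lg := H1_Linf oOm bOm Hg; have Li := H1_Linf oOm bOm (H1_inv oOm bOm phi0 Hphi).
exact: (L2_Linf mOm (LinfM Lg Li) (H1_L2 i Hphi)).
Qed.

(* The test function g^2/phi: on each coordinate
   dphi . d(g^2/phi) = dg^2 - (dg - g dphi/phi)^2. *)
Lemma picone beta D alpha p V lambda phi dphi g dg :
  (forall i, Linf Om (p i)) ->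
  positive_eigenpair Om beta D (fun i x => 2 * alpha * p i x) V lambda phi dphi ->
  H1 g dg ->
  let q := log_defect phi dphi g dg in
  lambda * I (fun x => g x ^+ 2) =
  D * (dirichlet Om dg - dirichlet Om q) - 2 * alpha * (drift p g dg - drift p g q) +
  I (fun x => V x * g x ^+ 2) + D * Sf (fun x => beta x * g x ^+ 2).
Proof.
move=> Lp [E phi0] Hg q; have [Hphi _ _] := E.
have phiO x : Om x -> phi x != 0 by move=> Ox; rewrite gt_eqF// phi0//; exact: subset_closure.
have phiB x : boundary Om x -> phi x != 0 by move=> /bndry clx; rewrite gt_eqF// phi0.
have Hpsi := H1_mul oOm bOm (H1_sqr oOm bOm Hg) (H1_inv oOm bOm phi0 Hphi).
have L2q i : L2 Om (q i) := log_defect_L2 i phi0 Hphi Hg.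
have L2g i : L2 Om (dg i) := H1_L2 i Hg.
have Lg := H1_Linf oOm bOm Hg.
have e1 : I (fun x => phi x * (g x ^+ 2 * (phi x)^-1)) = I (fun x => g x ^+ 2).
  by apply: vol_int_ext => x Ox; have := phiO x Ox => h; field.
have e2 : I (fun x => V x * phi x * (g x ^+ 2 * (phi x)^-1)) = I (fun x => V x * g x ^+ 2).
  by apply: vol_int_ext => x Ox; have := phiO x Ox => h; field.
have e3 : Sf (fun x => beta x * phi x * (g x ^+ 2 * (phi x)^-1)) = Sf (fun x => beta x * g x ^+ 2).
  by apply: surf_int_ext => x Ox; have := phiB x Ox => h; field.
rewrite -e1 -(weak_eigen Lp E Hpsi) e2 e3; congr (_ * _ - _ * _ + _ + _).
  rewrite -sumrB; apply: eq_bigr => i _.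
  rewrite -(vol_intB mOm (L2_mul mOm (L2g i) (L2g i)) (L2_mul mOm (L2q i) (L2q i))).
  apply: vol_int_ext => x Ox; have := phiO x Ox => h.
  by rewrite /q /log_defect; field.
rewrite -sumrB; apply: eq_bigr => i _.
have Lpg := Linf_in_L2 mOm fOm (LinfM (Lp i) Lg).
rewrite -(vol_intB mOm (L2_mul mOm Lpg (L2g i)) (L2_mul mOm Lpg (L2q i))).
apply: vol_int_ext => x Ox; have := phiO x Ox => h.
by rewrite /q /log_defect; field.
Qed.

(** In [picone] the terms in q = [log_defect] satisfy -D q^2 + 2 alpha p g q <= (alpha^2 / D) (p
    g)^2 by completing the square. *)
Lemma picone_le beta D alpha p V lambda phi dphi g dg :
  0 < D -> (forall i, Linf Om (p i)) ->
  positive_eigenpair Om beta D (fun i x => 2 * alpha * p i x) V lambda phi dphi ->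
  H1 g dg ->
  lambda * I (fun x => g x ^+ 2) <=
  D * dirichlet Om dg - 2 * alpha * drift p g dg + alpha ^+ 2 / D * weight p g +
  I (fun x => V x * g x ^+ 2) + D * Sf (fun x => beta x * g x ^+ 2).
Proof.
move=> D0 Lp E Hg; rewrite (picone Lp E Hg).
have [[Hphi _ _] phi0] := E.
set q := log_defect _ _ _ _; set S := Sf _; set IV := I _.
have L2q i : L2 Om (q i) := log_defect_L2 i phi0 Hphi Hg.
have Lg := H1_Linf oOm bOm Hg.
suff : 2 * alpha * drift p g q <= D * dirichlet Om q + alpha ^+ 2 / D * weight p g by lra.
rewrite /drift /dirichlet /weight !mulr_sumr -big_split; apply: ler_sum => i _ /=.
have Lpg := Linf_in_L2 mOm fOm (LinfM (Lp i) Lg).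
have I1 := L2_mul mOm Lpg (L2q i); have I2 := L2_mul mOm (L2q i) (L2q i).
have I3 := L2_mul mOm Lpg Lpg.
rewrite -(vol_intZ mOm _ I1) -(vol_intZ mOm _ I2) -(vol_intZ mOm _ I3).
have J1 := L1Z mOm (2 * alpha) I1; have J2 := L1Z mOm D I2.
have J3 := L1Z mOm (alpha ^+ 2 / D) I3.
rewrite -(vol_intD mOm J2 J3); apply: (vol_int_le mOm J1 (L1D mOm J2 J3)) => x _.
set a := p i x * g x; set b := q i x.
have -> : D * (b * b) + alpha ^+ 2 / D * (a * a) = 2 * alpha * (a * b) + (D * b - alpha * a) ^+ 2 / D.
  by field; rewrite gt_eqF.
by rewrite lerDl divr_ge0 ?sqr_ge0// ltW.
Qed.

(* Equality holds for g = exp(alpha m / D) phi, which conjugates the operator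
   to a self-adjoint one. *)
Lemma picone_eq beta D alpha p V lambda phi dphi mu :
  0 < D -> (forall i, Linf Om (p i)) -> H1 mu p ->
  positive_eigenpair Om beta D (fun i x => 2 * alpha * p i x) V lambda phi dphi ->
  exists g dg, [/\ H1 g dg, forall x, closure Om x -> 0 < g x &
  lambda * I (fun x => g x ^+ 2) =
  D * dirichlet Om dg - 2 * alpha * drift p g dg + alpha ^+ 2 / D * weight p g +
  I (fun x => V x * g x ^+ 2) + D * Sf (fun x => beta x * g x ^+ 2)].
Proof.
move=> D0 Lp Hmu [E phi0]; have [Hphi _ _] := E.
have Dn0 : D != 0 by rewrite gt_eqF.
have He := H1_exp oOm bOm (H1_scale oOm bOm (alpha / D) Hmu).
set e := fun x => expR (alpha / D * mu x).
have Hg := H1_mul oOm bOm He Hphi.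
(* The eigenvalue equation is tested with [e ^+ 2 * phi], where e^2 = exp(2 alpha m / D) is the
   density that symmetrizes the operator. *)
have Hpsi := H1_mul oOm bOm (H1_sqr oOm bOm He) Hphi.
set g := fun x => e x * phi x.
set dg : 'I_N -> 'rV[R]_N -> R := fun i x => e x * dphi i x + phi x * (e x * (alpha / D * p i x)).
exists g, dg; split=> [//|x clx|]; first by rewrite mulr_gt0 ?expR_gt0// phi0.
have Lg := H1_Linf oOm bOm Hg; have Le := H1_Linf oOm bOm He.
have L2g i : L2 Om (dg i) := H1_L2 i Hg.
have L2e i : L2 Om (fun x => e x * dphi i x) := L2_Linf mOm Le (H1_L2 i Hphi).
have -> : I (fun x => g x ^+ 2) = I (fun x => phi x * (e x ^+ 2 * phi x)).
  by apply: vol_int_ext => x _; rewrite /g; ring.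
rewrite -(weak_eigen Lp E Hpsi).
have -> : I (fun x => V x * phi x * (e x ^+ 2 * phi x)) = I (fun x => V x * g x ^+ 2).
  by apply: vol_int_ext => x _; rewrite /g; ring.
have -> : Sf (fun x => beta x * phi x * (e x ^+ 2 * phi x)) = Sf (fun x => beta x * g x ^+ 2).
  by apply: surf_int_ext => x _; rewrite /g; ring.
congr (_ + _ + _).
rewrite /drift /dirichlet /weight !mulr_sumr -!sumrB -big_split; apply: eq_bigr => i _ /=.
have Lpg := Linf_in_L2 mOm fOm (LinfM (Lp i) Lg).
have I1 := L2_mul mOm (L2e i) (L2e i); have I2 := L2_mul mOm Lpg (L2e i).
have I3 := L2_mul mOm Lpg Lpg.
(* Both sides are expanded in the integrals of (e dphi)^2, p g e dphi and (p g)^2; the claim becomes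
   an identity in these three numbers. *)
have E1 : I (fun x => dphi i x * (e x ^+ 2 * dphi i x + phi x * (2 * e x * (e x * (alpha / D * p i x))))) =
    I (fun x => e x * dphi i x * (e x * dphi i x)) +
    2 * (alpha / D) * I (fun x => p i x * g x * (e x * dphi i x)).
  rewrite -(vol_intZ mOm _ I2) -(vol_intD mOm I1 (L1Z mOm _ I2)).
  by apply: vol_int_ext => x _; rewrite /g /e; set w := expR _; set c := alpha / D; ring.
have E2 : I (fun x => p i x * dphi i x * (e x ^+ 2 * phi x)) =
    I (fun x => p i x * g x * (e x * dphi i x)).
  by apply: vol_int_ext => x _; rewrite /g /e; set w := expR _; set c := alpha / D; ring.
have E3 : I (fun x => dg i x ^+ 2) = I (fun x => e x * dphi i x * (e x * dphi i x)) +
    2 * (alpha / D) * I (fun x => p i x * g x * (e x * dphi i x)) +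
    (alpha / D) ^+ 2 * I (fun x => p i x * g x * (p i x * g x)).
  rewrite -(vol_intZ mOm _ I2) -(vol_intZ mOm _ I3) -(vol_intD mOm I1 (L1Z mOm _ I2)).
  rewrite -(vol_intD mOm (L1D mOm I1 (L1Z mOm _ I2)) (L1Z mOm _ I3)).
  by apply: vol_int_ext => x _; rewrite /dg /g /e; set w := expR _; set c := alpha / D; ring.
have E4 : I (fun x => p i x * g x * dg i x) = I (fun x => p i x * g x * (e x * dphi i x)) +
    (alpha / D) * I (fun x => p i x * g x * (p i x * g x)).
  rewrite -(vol_intZ mOm _ I3) -(vol_intD mOm I2 (L1Z mOm _ I3)).
  by apply: vol_int_ext => x _; rewrite /dg /g /e; set w := expR _; set c := alpha / D; ring.
have -> : I (fun x => (p i x * g x) ^+ 2) = I (fun x => p i x * g x * (p i x * g x)) by [].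
rewrite E1 E2 E3 E4; set A := I _; set B := I _; set C := I _.
by field.
Qed.

(** Since 1/g is bounded, [g] is bounded below by a positive constant on a set of positive
    volume. *)
Lemma vol_int_gt0 g dg : Om !=set0 -> H1 g dg -> (forall x, closure Om x -> 0 < g x) ->
  0 < I g.
Proof.
move=> [x0 Ox0] Hg g0; have [mi [M iM]] := H1_Linf oOm bOm (H1_inv oOm bOm g0 Hg).
have Ig := Linf_in_L1 mOm fOm (H1_Linf oOm bOm Hg).
have gO x : Om x -> 0 < g x by move=> Ox; apply: g0; exact: subset_closure.
have M0 : 0 < M.
  by apply: lt_le_trans (iM _ Ox0); rewrite normr_gt0 invr_eq0 gt_eqF// gO.
have I1 := L1_cst mOm fOm 1.
have vol0 : 0 < I (fun=> 1).
  rewrite -lte_fin (EFin_vol_int mOm I1) (integral_cst leb mOm) mul1e.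
  by apply: (lebesgue_nbhs_gt0 mOm (c := x0)); exact: open_nbhs_nbhs.
rewrite -(pmulr_rgt0 _ M0); apply: lt_le_trans vol0 _.
rewrite -(vol_intZ mOm _ Ig); apply: (vol_int_le mOm I1 (L1Z mOm _ Ig)) => x Ox.
have := iM _ Ox; rewrite ger0_norm ?invr_ge0 ?(ltW (gO _ Ox))// => h.
by rewrite -(@mulVf _ (g x)) ?gt_eqF ?gO// ler_wpM2r// ltW// gO.
Qed.

End Picone.

(** * Bounds on the principal eigenvalue for large diffusion *)

Section Asymptotics.
Context {R : realType} {n : nat}.
Local Notation N := n.+1.
Implicit Types (u v f g k phi psi : 'rV[R]_N -> R) (x y : 'rV[R]_N) (s t r d eps : R).
Variable Om : set 'rV[R]_N.
Hypothesis hOm : bounded_smooth_domain Om.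
Implicit Types (du dv dg dk dphi dpsi q : 'I_N -> 'rV[R]_N -> R).

Local Notation leb := (@lebesgue_rV R N : set (borel_rV R N) -> \bar R).
Local Notation H1 := (H1_continuous Om).
Local Notation I := (vol_int Om).
Local Notation Sf := (surf_int (boundary Om)).
Let oOm : open Om. Proof. by case: hOm. Qed.
Let bOm : bounded_set Om. Proof. by case: hOm. Qed.
Let Om0 : Om !=set0. Proof. by case: hOm. Qed.
Let mOm := domain_measurable oOm.
Let fOm := domain_finite oOm bOm.

Let sqr_L1 u du : H1 u du -> L1 Om (fun x => u x ^+ 2).
Proof. by move=> /(H1_Linf oOm bOm) Lu; exact: (Linf_in_L1 mOm fOm (LinfM Lu Lu)). Qed.

Let I_sqr_ge0 u : 0 <= I (fun x => u x ^+ 2).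
Proof. by apply: vol_int_ge0 => x _; exact: sqr_ge0. Qed.

Lemma vol_int_Linf_sqr u : Linf Om u -> exists2 M, 0 <= M &
  forall f, L1 Om (fun x => f x ^+ 2) -> meas_on Om f ->
  I (fun x => (u x * f x) ^+ 2) <= M * I (fun x => f x ^+ 2).
Proof.
move=> Lu; have [mu [M uM]] := Lu; exists (M ^+ 2); first exact: sqr_ge0.
move=> f If mf; have [_ I1] := L2_Linf mOm Lu (conj mf If).
rewrite -(vol_intZ mOm _ If); apply: (vol_int_le mOm I1 (L1Z mOm _ If)) => x Ox.
rewrite exprMn ler_wpM2r ?sqr_ge0// -[leLHS]ger0_norm ?sqr_ge0// normrX.
have h := uM _ Ox.
by rewrite lerXn2r ?nnegrE// (le_trans _ h).
Qed.

Lemma weight_le p : (forall i, Linf Om (p i)) -> exists2 M, 0 <= M &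
  forall g dg, H1 g dg -> weight Om p g <= M * I (fun x => g x ^+ 2).
Proof.
move=> Lp; have /choice[M MP] : forall i, exists M, 0 <= M /\ forall f, L1 Om (fun x => f x ^+ 2) ->
    meas_on Om f -> I (fun x => (p i x * f x) ^+ 2) <= M * I (fun x => f x ^+ 2).
  by move=> i; have [M M0 h] := vol_int_Linf_sqr (Lp i); exists M.
exists (\sum_i M i); first by apply: sumr_ge0 => i _; have [] := MP i.
move=> g dg Hg; rewrite mulr_suml; apply: ler_sum => i _; have [_ ->//] := MP i.
  exact: sqr_L1 Hg.
by have [] := H1_Linf oOm bOm Hg.
Qed.

(** Picone's identity without drift and potential: the Robin energy exceeds its minimum by the
    energy of [log_defect]. *)
Lemma neumann_energy beta mu1 phi dphi g dg :
  positive_eigenpair Om beta 1 (fun _ _ => 0) (fun=> 0) mu1 phi dphi -> H1 g dg ->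
  mu1 * I (fun x => g x ^+ 2) =
  dirichlet Om dg - dirichlet Om (log_defect phi dphi g dg) + Sf (fun x => beta x * g x ^+ 2).
Proof.
pose z : 'I_N -> 'rV[R]_N -> R := fun _ _ => 0.
have -> : (fun (_ : 'I_N) (_ : 'rV[R]_N) => 0) = (fun i x => 2 * 0 * z i x).
  by apply/funext => i; apply/funext => x; rewrite mulr0.
move=> E Hg; rewrite (picone oOm bOm (p := z) _ E Hg); last by move=> i; exact: Linf_cst.
rewrite (@vol_int_ext _ _ _ (fun x => 0 * g x ^+ 2) (fun=> 0)); last by move=> x _; rewrite mul0r.
by rewrite vol_int0 mulr0 mul0r subr0 !mul1r addr0.
Qed.

Variables (alpha : R) (beta V mu : 'rV[R]_N -> R) (p : 'I_N -> 'rV[R]_N -> R).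
Variables (lambda : R -> R) (mu1 : R) (phi0 : 'rV[R]_N -> R) (dphi0 : 'I_N -> 'rV[R]_N -> R).
Hypotheses (Lp : forall i, Linf Om (p i)) (Hmu : H1 mu p) (LV : Linf Om V).
Hypothesis eigen : forall D, 0 < D -> exists phi dphi,
  positive_eigenpair Om beta D (fun i x => 2 * alpha * p i x) V (lambda D) phi dphi.
Hypothesis E0 : positive_eigenpair Om beta 1 (fun _ _ => 0) (fun=> 0) mu1 phi0 dphi0.

Let phi0_gt0 x : closure Om x -> 0 < phi0 x. Proof. by have [_] := E0; apply. Qed.
Let H0 : H1 phi0 dphi0. Proof. by have [[]] := E0. Qed.

Let G_gt0 g dg : H1 g dg -> (forall x, closure Om x -> 0 < g x) ->
  0 < I (fun x => g x ^+ 2).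
Proof.
move=> Hg g0; apply: (vol_int_gt0 oOm bOm Om0 (H1_sqr oOm bOm Hg)) => x clx.
by rewrite exprn_gt0// g0.
Qed.

(** The forms at D and at 1 are compared at the minimizer of the first. They differ by D - 1 times
    the Robin energy, which is at least mu1 times the squared norm, and by a bounded multiple of the
    weight. *)
Lemma principal_lower : exists c, forall D, 1 <= D -> (D - 1) * mu1 + c <= lambda D.
Proof.
have [M M0 MP] := weight_le Lp.
exists (lambda 1 - alpha ^+ 2 * M) => D D1; have D0 : 0 < D := lt_le_trans ltr01 D1.
have [phi [dphi ED]] := eigen D0.
have [g [dg [Hg g0 eq]]] := picone_eq oOm bOm D0 Lp Hmu ED.
have [phi1 [dphi1 ED1]] := eigen ltr01.
have le1 := picone_le oOm bOm ltr01 Lp ED1 Hg.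
have e0 := neumann_energy E0 Hg.
have G0 := G_gt0 Hg g0; have wG := MP _ _ Hg.
have W0 : 0 <= weight Om p g by apply: sumr_ge0 => i _; exact: (@I_sqr_ge0 (fun x => p i x * g x)).
have q0 := dirichlet_ge0 Om (log_defect phi0 dphi0 g dg).
rewrite -(ler_pM2r G0) eq; move: le1 e0 G0 wG q0 W0.
rewrite divr1 !mul1r.
set G := I _; set W := weight _ _ _; set E := dirichlet _ dg; set Q := dirichlet _ _.
set S := Sf _; set dr := drift _ _ _ _; set IV := I _ => le1 e0 G0 wG q0 W0.
have h1 : (D - 1) * (mu1 * G) <= (D - 1) * (E + S).
  by apply: ler_wpM2l; [rewrite subr_ge0|rewrite e0; lra].
have h2 : alpha ^+ 2 * W <= alpha ^+ 2 * (M * G) by rewrite ler_wpM2l ?sqr_ge0.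
have h3 : 0 <= alpha ^+ 2 / D * W.
  by rewrite mulr_ge0// divr_ge0 ?sqr_ge0// ltW.
lra.
Qed.

(** The trial function is [phi0], whose [log_defect] against itself vanishes. *)
Lemma principal_upper D : 0 < D -> lambda D * I (fun x => phi0 x ^+ 2) <=
  D * mu1 * I (fun x => phi0 x ^+ 2) + alpha ^+ 2 / D * weight Om p phi0 +
  (I (fun x => V x * phi0 x ^+ 2) - 2 * alpha * drift Om p phi0 dphi0).
Proof.
move=> D0; have [phi [dphi ED]] := eigen D0.
have le := picone_le oOm bOm D0 Lp ED H0.
have e0 := neumann_energy E0 H0.
have q0 : dirichlet Om (log_defect phi0 dphi0 phi0 dphi0) = 0.
  apply: big1 => i _; rewrite (@vol_int_ext _ _ _ _ (fun=> 0)) ?vol_int0// => x Ox.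
  rewrite /log_defect divff ?mul1r ?subrr ?expr0n// gt_eqF// phi0_gt0//.
  exact: subset_closure.
rewrite -[D * mu1 * _]mulrA e0 q0 subr0; move: le.
set F := I _; set E := dirichlet _ _; set S := Sf _; set IV := I _; lra.
Qed.

Hypotheses (mu10 : mu1 = 0) (phi0_1 : I (fun x => phi0 x ^+ 2) = 1).

(** The limit of the eigenvalue in the case [mu1 = 0]. *)
Definition ground_energy : R :=
  I (fun x => V x * phi0 x ^+ 2) - 2 * alpha * drift Om p phi0 dphi0.

(** Squared norms of the functions that are paired with [k] and with the defect [q] in the cross
    terms. *)
Let C3 := I (fun x => ((V x - ground_energy) * phi0 x) ^+ 2) +
  \sum_i (I (fun x => (alpha * p i x * phi0 x) ^+ 2) +
          I (fun x => (2 * alpha * p i x * dphi0 i x) ^+ 2)).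

Let C3_ge0 : 0 <= C3.
Proof.
apply: addr_ge0; first exact: (@I_sqr_ge0 (fun x => (V x - ground_energy) * phi0 x)).
apply: sumr_ge0 => i _; apply: addr_ge0.
  exact: (@I_sqr_ge0 (fun x => alpha * p i x * phi0 x)).
exact: (@I_sqr_ge0 (fun x => 2 * alpha * p i x * dphi0 i x)).
Qed.

(** The part of the quadratic form free of D, shifted so that it vanishes at [phi0]. *)
Definition tilted_form f (df : 'I_N -> 'rV[R]_N -> R) : R :=
  I (fun x => V x * f x ^+ 2) - 2 * alpha * drift Om p f df -
  ground_energy * I (fun x => f x ^+ 2).

(* Young's inequality on the cross terms at g = k + a phi0. *)
Lemma cross_terms g dg k dk a eps : H1 g dg -> 0 < eps ->
  k = (fun x => g x - a * phi0 x) -> dk = (fun i x => dg i x - a * dphi0 i x) ->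
  tilted_form k dk - eps * a ^+ 2 * C3 -
  eps^-1 * (dirichlet Om (log_defect phi0 dphi0 g dg) +
    (N%:R + 1) * I (fun x => k x ^+ 2)) <= tilted_form g dg.
Proof.
pose A := tilted_form.
move=> Hg eps0 kE dkE; rewrite -/(A k dk) -/(A g dg).
set q := log_defect _ _ _ _; set e := ground_energy.
have L2q i : L2 Om (q i) := log_defect_L2 oOm bOm i phi0_gt0 H0 Hg.
have Hk : H1 k dk.
  have := H1_add oOm bOm Hg (H1_scale oOm bOm (- a) H0).
  by rewrite kE dkE; apply: (H1_ext oOm) => [x _|i x _]; rewrite mulNr.
have Lk := H1_Linf oOm bOm Hk; have L0 := H1_Linf oOm bOm H0; have Lg := H1_Linf oOm bOm Hg.
have LW : Linf Om (fun x => V x - e) := LinfB LV (Linf_cst Om e).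
have AE f df : H1 f df -> A f df = I (fun x => (V x - e) * f x ^+ 2) - 2 * alpha * drift Om p f df.
  move=> Hf; have Lf := H1_Linf oOm bOm Hf.
  rewrite /A /tilted_form -/e -(vol_intZ mOm _ (sqr_L1 Hf)).
  have I1 := Linf_in_L1 mOm fOm (LinfM LV (LinfM Lf Lf)).
  rewrite addrAC -(vol_intB mOm I1 (L1Z mOm _ (sqr_L1 Hf))); congr (_ - _).
  by apply: vol_int_ext => x _; ring.
have A0 : A phi0 dphi0 = 0 by rewrite /A /tilted_form phi0_1 mulr1 /e /ground_energy subrr.
have ie0 : 0 < eps^-1 by rewrite invr_gt0.
have young (b c : R) : - (eps * b ^+ 2) - eps^-1 * c ^+ 2 <= 2 * (b * c).
  have := mulr_ge0 (ltW ie0) (sqr_ge0 (eps * b + c)).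
  have -> : eps^-1 * (eps * b + c) ^+ 2 = eps * b ^+ 2 + 2 * (b * c) + eps^-1 * c ^+ 2.
    by field; rewrite gt_eqF.
  by lra.
have -> : A g dg = A g dg - a ^+ 2 * A phi0 dphi0 by rewrite A0 mulr0 subr0.
rewrite !AE// /C3 -/e.
have k2 := sqr_L1 Hk.
have Vk := Linf_in_L1 mOm fOm (LinfM LW (LinfM Lk Lk)).
have V0 := Linf_in_L1 mOm fOm (LinfM LW (LinfM L0 L0)).
have Vg := Linf_in_L1 mOm fOm (LinfM LW (LinfM Lg Lg)).
have Lc := LinfM LW L0; have V20 := Linf_in_L1 mOm fOm (LinfM Lc Lc).
have P1 : I (fun x => (V x - e) * k x ^+ 2) - eps * a ^+ 2 * I (fun x => ((V x - e) * phi0 x) ^+ 2)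
    - eps^-1 * I (fun x => k x ^+ 2) <=
    I (fun x => (V x - e) * g x ^+ 2) - a ^+ 2 * I (fun x => (V x - e) * phi0 x ^+ 2).
  have J1 := L1B mOm Vk (L1Z mOm (eps * a ^+ 2) V20).
  have J2 := L1Z mOm (a ^+ 2) V0.
  rewrite -(vol_intZ mOm _ V20) -(vol_intZ mOm _ k2) -(vol_intZ mOm _ V0).
  rewrite -(vol_intB mOm Vk (L1Z mOm _ V20)) -(vol_intB mOm J1 (L1Z mOm _ k2)).
  rewrite -(vol_intB mOm Vg J2).
  apply: (vol_int_le mOm (L1B mOm J1 (L1Z mOm _ k2)) (L1B mOm Vg J2)) => x _.
  have := young (a * ((V x - e) * phi0 x)) (k x).
  by rewrite kE; set w := V x - e; set b := phi0 x; set c := g x; lra.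
have P2 i : - (2 * alpha * I (fun x => p i x * k x * dk i x)) - eps * a ^+ 2 *
    (I (fun x => (alpha * p i x * phi0 x) ^+ 2) + I (fun x => (2 * alpha * p i x * dphi0 i x) ^+ 2))
    - eps^-1 * (I (fun x => q i x ^+ 2) + I (fun x => k x ^+ 2)) <=
    - (2 * alpha * I (fun x => p i x * g x * dg i x)) +
    2 * alpha * a ^+ 2 * I (fun x => p i x * phi0 x * dphi0 i x).
  have Li f df : H1 f df -> L1 Om (fun x => p i x * f x * df i x).
    move=> Hf; have L := Linf_in_L2 mOm fOm (LinfM (Lp i) (H1_Linf oOm bOm Hf)).
    exact: (L2_mul mOm L (H1_L2 i Hf)).
  have Lap := LinfM (LinfM (Linf_cst Om alpha) (Lp i)) L0.
  have S1 := Linf_in_L1 mOm fOm (LinfM Lap Lap).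
  have La2 := LinfM (Linf_cst Om (2 * alpha)) (Lp i).
  have [_ S2] := L2_Linf mOm La2 (H1_L2 i H0).
  have [_ S3] := L2q i.
  have Z1 := L1Z mOm (- (2 * alpha)) (Li _ _ Hk).
  have Z2 := L1Z mOm (eps * a ^+ 2) (L1D mOm S1 S2).
  have Z3 := L1Z mOm eps^-1 (L1D mOm S3 k2).
  have Z4 := L1Z mOm (- (2 * alpha)) (Li _ _ Hg).
  have Z5 := L1Z mOm (2 * alpha * a ^+ 2) (Li _ _ H0).
  rewrite -[- (_ * I (fun x => p i x * k x * dk i x))]mulNr -[- (_ * I (fun x => p i x * g x * dg i x))]mulNr.
  rewrite -(vol_intZ mOm _ (Li _ _ Hk)) -(vol_intZ mOm _ (Li _ _ Hg)) -(vol_intZ mOm _ (Li _ _ H0)).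
  rewrite -(vol_intD mOm S1 S2) -(vol_intD mOm S3 k2).
  rewrite -(vol_intZ mOm _ (L1D mOm S1 S2)) -(vol_intZ mOm _ (L1D mOm S3 k2)).
  rewrite -(vol_intB mOm Z1 Z2) -(vol_intB mOm (L1B mOm Z1 Z2) Z3) -(vol_intD mOm Z4 Z5).
  apply: (vol_int_le mOm (L1B mOm (L1B mOm Z1 Z2) Z3) (L1D mOm Z4 Z5)) => x Ox.
  have f0 : phi0 x != 0 by rewrite gt_eqF// phi0_gt0//; exact: subset_closure.
  have := young (- (a * (alpha * p i x * phi0 x))) (q i x).
  have := young (- (a * (2 * alpha * p i x * dphi0 i x))) (k x).
  (* Eliminating [dg] in favour of [q] leaves only the norm of [q], not the full gradient, in the
     error. *)
  have dgE : dg i x = q i x + g x / phi0 x * dphi0 i x by rewrite /q /log_defect subrK.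
  rewrite dkE kE dgE.
  set P := p i x; set b := phi0 x; set db := dphi0 i x; set c := g x; set Q := q i x.
  have -> : c = (c - a * b) + a * b by ring.
  set K := c - a * b => y1 y2.
  have -> : - (2 * alpha) * (P * (K + a * b) * (Q + (K + a * b) / b * db)) =
    - (2 * alpha) * (P * K * (Q + (K + a * b) / b * db - a * db)) -
    2 * alpha * a * P * b * Q - 4 * alpha * a * P * K * db - 2 * alpha * a ^+ 2 * P * b * db.
    by field.
  by rewrite addrK; lra.
have {}P2 := @ler_sum R _ (index_enum 'I_N) xpredT _ _ (fun i _ => P2 i).
rewrite /drift /dirichlet; move: P1 P2.
rewrite !big_split /= !sumrN -!mulr_sumr !big_split /= sumr_const card_ord -mulr_natl.
by lra.
Qed.

(** At the minimizer [g] the term D H, with H the energy of [log_defect], dominates every error: by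
    Poincare's inequality the distance from [g] to the line of [phi0] is controlled by H. *)
Lemma principal_lower0 eps : 0 < eps -> exists D0, forall D, D0 <= D ->
  0 < D -> ground_energy - eps <= lambda D.
Proof.
move=> eps0; have [C Cge0 CP] := poincare hOm.
have Hi := H1_inv oOm bOm phi0_gt0 H0.
have [M1 M10 M1P] := vol_int_Linf_sqr (H1_Linf oOm bOm Hi).
have [M2 M20 M2P] := vol_int_Linf_sqr (H1_Linf oOm bOm H0).
have [M M0 MP] := weight_le Lp.
pose C1 := M2 * (C * M1); have C10 : 0 <= C1 by rewrite mulr_ge0 ?mulr_ge0.
pose C2 := 1 + (`|lambda 1| + alpha ^+ 2 * M + `|ground_energy|) * C1.
(* Young's parameter, chosen so that the error [2 * e * C3] per unit of squared norm is at most
   [eps]. *)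
pose e := eps / (2 * C3 + 1).
have e0 : 0 < e by rewrite divr_gt0// ltr_wpDl// mulr_ge0.
have eC3 : e * (2 * C3) <= eps.
  by rewrite /e mulrAC ler_pdivrMr ?ltr_wpDl ?mulr_ge0// ler_pM2l// lerDl.
(* The threshold collects the coefficients of H: [C2] from the form at [k], the rest from the cross
   terms and from the bound on [a ^+ 2]. *)
exists (C2 + 2 * e * C3 * C1 + e^-1 * (1 + (N%:R + 1) * C1)) => D D0D D0.
have [phi [dphi ED]] := eigen D0.
have [g [dg [Hg g0 eq]]] := picone_eq oOm bOm D0 Lp Hmu ED.
have [phi1 [dphi1 ED1]] := eigen ltr01.
have G0 := G_gt0 Hg g0.
set q := log_defect phi0 dphi0 g dg.
have L2q i : L2 Om (q i) := log_defect_L2 oOm bOm i phi0_gt0 H0 Hg.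
have Og := H1_mul oOm bOm Hg Hi; have [a Pa] := CP _ _ Og.
pose k x := g x - a * phi0 x; pose dk i x := dg i x - a * dphi0 i x.
have Hk : H1 k dk.
  have := H1_add oOm bOm Hg (H1_scale oOm bOm (- a) H0).
  by apply: (H1_ext oOm) => [x _|i x _]; rewrite mulNr.
have phiO x : Om x -> phi0 x != 0.
  by move=> Ox; rewrite gt_eqF// phi0_gt0//; exact: subset_closure.
have Hh := H1_add oOm bOm Og (H1_cst oOm bOm (- a)).
(* The defect is unchanged when a multiple of [phi0] is subtracted. *)
have qk : dirichlet Om (log_defect phi0 dphi0 k dk) = dirichlet Om q.
  apply: eq_bigr => i _; apply: vol_int_ext => x /phiO f0.
  by rewrite /q /log_defect /k /dk; field.
(* Here k = phi0 (g / phi0 - a) and q = phi0 grad(g / phi0); upper bounds for phi0 and 1/phi0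
   translate Poincare's inequality for g / phi0. *)
have Ik : I (fun x => k x ^+ 2) <= C1 * dirichlet Om q.
  apply: (@le_trans _ _ (M2 * I (fun x => (g x * (phi0 x)^-1 + - a) ^+ 2))).
    have := M2P _ (sqr_L1 Hh) (proj1 (H1_Linf oOm bOm Hh)); congr (_ <= _).
    by apply: vol_int_ext => x /phiO f0; rewrite /k; field.
  rewrite /C1 -!mulrA ler_wpM2l//; apply: le_trans Pa _; rewrite ler_wpM2l//.
  rewrite /dirichlet mulr_sumr; apply: ler_sum => i _; have [mq q2] := L2q i.
  have := M1P _ q2 mq; congr (_ <= _).
  by apply: vol_int_ext => x /phiO f0; rewrite /q /log_defect; field.
(* Because [phi0] is normalized and a phi0 = g - k. *)
have a2 : a ^+ 2 <= 2 * I (fun x => g x ^+ 2) + 2 * I (fun x => k x ^+ 2).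
  rewrite (_ : a ^+ 2 = a ^+ 2 * I (fun x => phi0 x ^+ 2)); last by rewrite phi0_1 mulr1.
  rewrite -(vol_intZ mOm _ (sqr_L1 H0)) -(vol_intZ mOm _ (sqr_L1 Hg)) -(vol_intZ mOm _ (sqr_L1 Hk)).
  have J1 := L1Z mOm 2 (sqr_L1 Hg); have J2 := L1Z mOm 2 (sqr_L1 Hk).
  rewrite -(vol_intD mOm J1 J2).
  apply: (vol_int_le mOm (L1Z mOm _ (sqr_L1 H0)) (L1D mOm J1 J2)) => x _.
  rewrite /k; set c := g x; set b := phi0 x.
  by have := sqr_ge0 (2 * c - a * b); rewrite !expr2; lra.
have cross := cross_terms Hg e0 (erefl k) (erefl dk).
(* The form at D = 1 is bounded below by [lambda 1] times the squared norm of [k], and its Robin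
   energy at [k] is H; this bounds [tilted_form] at [k] from below. *)
have le1 := picone_le oOm bOm ltr01 Lp ED1 Hk.
have ek := neumann_energy E0 Hk; have eg := neumann_energy E0 Hg.
have wk := MP _ _ Hk.
have W0 : 0 <= weight Om p g by apply: sumr_ge0 => i _; exact: (@I_sqr_ge0 (fun x => p i x * g x)).
have H0' := dirichlet_ge0 Om q; have K0 := I_sqr_ge0 k.
move: cross le1 ek eg wk eq W0 H0' K0 a2 Ik G0; rewrite qk mu10 !mul0r divr1 !mul1r /tilted_form -/q.
set G := I (fun x => g x ^+ 2); set K := I (fun x => k x ^+ 2); set H := dirichlet Om q.
set W := weight Om p g; set Wk := weight Om p k.
set E := dirichlet Om dg; set Ek := dirichlet Om dk.
set S := Sf (fun x => beta x * g x ^+ 2); set Sk := Sf (fun x => beta x * k x ^+ 2).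
set dr := drift Om p g dg; set drk := drift Om p k dk.
set IV := I (fun x => V x * g x ^+ 2); set IVk := I (fun x => V x * k x ^+ 2).
set J := ground_energy => cross le1 ek eg wk eq W0 H_ge0 K_ge0 a2 Ik Gpos.
have t1 : - (`|lambda 1| * (C1 * H)) <= lambda 1 * K.
  have : `|lambda 1| * K <= `|lambda 1| * (C1 * H) by rewrite ler_wpM2l.
  have : - (`|lambda 1| * K) <= lambda 1 * K.
    by rewrite -mulNr ler_wpM2r// lerNl -normrN ler_norm.
  by lra.
have t2 : J * K <= `|J| * (C1 * H).
  have : `|J| * K <= `|J| * (C1 * H) by rewrite ler_wpM2l.
  have : J * K <= `|J| * K by rewrite ler_wpM2r// ler_norm.
  by lra.
have t3 : alpha ^+ 2 * Wk <= alpha ^+ 2 * M * (C1 * H).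
  rewrite -mulrA ler_wpM2l ?sqr_ge0//; apply: le_trans wk _; exact: ler_wpM2l.
have t4 : 0 <= alpha ^+ 2 / D * W by rewrite mulr_ge0// divr_ge0 ?sqr_ge0// ltW.
have t5 : e * a ^+ 2 * C3 <= e * C3 * (2 * G + 2 * (C1 * H)).
  rewrite mulrAC; apply: ler_wpM2l; first exact: mulr_ge0 (ltW e0) C3_ge0.
  by lra.
have t6 : e^-1 * (H + (N%:R + 1) * K) <= e^-1 * (1 + (N%:R + 1) * C1) * H.
  rewrite -mulrA; apply: ler_wpM2l; first by rewrite invr_ge0 ltW.
  rewrite [leRHS]mulrDl mul1r lerD2l -mulrA.
  by rewrite ler_wpM2l// addr_ge0.
have t7 : (C2 + 2 * e * C3 * C1 + e^-1 * (1 + (N%:R + 1) * C1)) * H <= D * H.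
  exact: ler_wpM2r.
have t8 : e * (2 * C3) * G <= eps * G by rewrite ler_wpM2r// ltW.
rewrite -(ler_pM2r Gpos) eq.
have t9 : D * E + D * S = D * H by rewrite -mulrDr; congr (_ * _); lra.
move: t7; rewrite /C2; move: t1 t2 t3 t4 t5 t6 t8 t9 cross le1 ek.
set y := e^-1; set y' := (1 + (N%:R + 1) * C1).
lra.
Qed.

End Asymptotics.

(** * Hausdorff measure as a Borel measure *)

Section HausdorffOuter.
Context {R : realType} {N : nat} (s : nat).
Implicit Types (x y : 'rV[R]_N) (A B X : set 'rV[R]_N) (F : (set 'rV[R]_N)^nat) (d e : R).
Local Open Scope ereal_scope.

Lemma le_diameter A x y : A x -> A y -> (euclidean_dist x y)%:E <= diameter A.
Proof. by move=> Ax Ay; apply: ereal_sup_ubound; exists (x, y). Qed.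

Lemma diameter_ge0 A : A !=set0 -> 0 <= diameter A.
Proof.
by move=> [x Ax]; apply: le_trans (le_diameter Ax Ax); rewrite lee_fin sqrtr_ge0.
Qed.

Lemma diameter0 : diameter (set0 : set 'rV[R]_N) = -oo.
Proof.
rewrite /diameter (_ : [set _ | _ in _] = set0) ?ereal_sup0//.
by apply/seteqP; split=> // z [[a b] [] []].
Qed.

Lemma hausdorff_gauge0 : hausdorff_gauge s (set0 : set 'rV[R]_N) = 0.
Proof. by rewrite /hausdorff_gauge eqxx. Qed.

Lemma hausdorff_gauge_ge0 A : 0 <= hausdorff_gauge s A.
Proof.
rewrite /hausdorff_gauge; case: ifPn => // /set0P A0; apply: mule_ge0.
  exact: (measure_ge0 (@lebesgue_rV R s : set (borel_rV R s) -> \bar R)).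
by apply: expe_ge0; apply: mule_ge0; rewrite ?diameter_ge0// lee_fin invr_ge0.
Qed.

(** The discrete sigma-algebra, since arbitrary sets occur in the covers. *)
Let all_sets := g_sigma_algebraType [set: set 'rV[R]_N].

(** The value +oo encodes the diameter constraint, so that [hausdorff_delta] becomes a standard
    outer extension. *)
Let gauge (d : R) (A : set all_sets) : \bar R :=
  if diameter (A : set 'rV[R]_N) <= d%:E then hausdorff_gauge s (A : set 'rV[R]_N) else +oo.

Let gauge_ge0 d A : 0 <= gauge d A.
Proof. by rewrite /gauge; case: ifP => // _; exact: hausdorff_gauge_ge0. Qed.

Let gauge0 d : gauge d set0 = 0.
Proof.
by rewrite /gauge hausdorff_gauge0 diameter0 leNye.
Qed.

Lemma hausdorff_delta_mu_ext d A : hausdorff_delta s d A = mu_ext (gauge d) A.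
Proof.
apply/eqP; rewrite eq_le; apply/andP; split.
  apply: le_ereal_inf_tmp => _ [F [_ AF] <-].
  have [Fd|/existsNP[k Fk]] := pselect (forall k, diameter (F k : set 'rV[R]_N) <= d%:E).
    apply: ereal_inf_lbound; exists F => //; apply: eq_eseriesr => k _.
    by rewrite /gauge Fd.
  rewrite (@eseries_pinfty _ _ _ k) ?leey// => [i _|].
    by rewrite gt_eqF// (lt_le_trans _ (gauge_ge0 _ _)).
  by rewrite /gauge; case: ifP.
apply: le_ereal_inf_tmp => _ [F [Fd AF] <-]; apply: ereal_inf_lbound; exists F.
  by split=> // i; exact: sub_sigma_algebra.
by apply: eq_eseriesr => k _; rewrite /gauge Fd.
Qed.

Lemma hausdorff_delta_ge0 d A : 0 <= hausdorff_delta s d A.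
Proof. by rewrite hausdorff_delta_mu_ext; exact: mu_ext_ge0. Qed.

Lemma le_hausdorff_delta d : {homo (@hausdorff_delta R N s d) : A B / A `<=` B >-> A <= B}.
Proof. by move=> A B AB; rewrite !hausdorff_delta_mu_ext; exact: le_mu_ext. Qed.

Lemma hausdorff_delta_anti d e A : (d <= e)%R ->
  hausdorff_delta s e A <= hausdorff_delta s d A.
Proof.
move=> de; apply: le_ereal_inf_tmp => _ [F [Fd AF] <-]; apply: ereal_inf_lbound.
by exists F => //; split=> // k; apply: le_trans (Fd k) _; rewrite lee_fin.
Qed.

Lemma hausdorff_delta_le d A : (0 < d)%R -> hausdorff_delta s d A <= hausdorff s A.
Proof. by move=> d0; apply: ereal_sup_ubound; exists d. Qed.

Lemma hausdorff_le A z : (forall d, (0 < d)%R -> hausdorff_delta s d A <= z) ->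
  hausdorff s A <= z.
Proof. by move=> h; apply: ge_ereal_sup => _ [d d0 <-]; exact: h. Qed.

Lemma hausdorff0 : hausdorff s (set0 : set 'rV[R]_N) = 0.
Proof.
apply/eqP; rewrite eq_le; apply/andP; split.
  by apply: hausdorff_le => d _; rewrite hausdorff_delta_mu_ext mu_ext0//; exact: gauge_ge0.
by apply: le_trans (hausdorff_delta_le _ ltr01); exact: hausdorff_delta_ge0.
Qed.

Lemma hausdorff_ge0 A : 0 <= hausdorff s A.
Proof. by apply: le_trans (hausdorff_delta_le _ ltr01); exact: hausdorff_delta_ge0. Qed.

Lemma le_hausdorff : {homo @hausdorff R N s : A B / A `<=` B >-> A <= B}.
Proof.
move=> A B AB; apply: hausdorff_le => d d0.
by apply: le_trans (hausdorff_delta_le _ d0); exact: le_hausdorff_delta.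
Qed.

Lemma hausdorff_sigma_subadditive : sigma_subadditive (@hausdorff R N s).
Proof.
move=> F; apply: hausdorff_le => d d0; rewrite hausdorff_delta_mu_ext.
have sub := @mu_ext_sigma_subadditive _ _ _ (gauge d) (gauge_ge0 d) F.
apply: le_trans sub _.
apply: lee_nneseries => k *; rewrite -hausdorff_delta_mu_ext.
  exact: hausdorff_delta_ge0.
exact: (hausdorff_delta_le _ d0).
Qed.

End HausdorffOuter.

HB.instance Definition _ (R : realType) (N s : nat) :=
  isOuterMeasure.Build R 'rV[R]_N (@hausdorff R N s) (hausdorff0 s)
    (hausdorff_ge0 s) (@le_hausdorff R N s) (hausdorff_sigma_subadditive s).

Section Caratheodory.
Context {R : realType} {N : nat} (s : nat).
Implicit Types (x y : 'rV[R]_N) (A B X : set 'rV[R]_N) (F : (set 'rV[R]_N)^nat) (d e : R).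
Variable f : 'rV[R]_N -> R.
Hypothesis f1 : forall x y, `|f x - f y| <= euclidean_dist x y.
Local Open Scope ereal_scope.
Local Notation H := (@hausdorff R N s).
Local Notation Hd := (@hausdorff_delta R N s).

(** As [f] is 1-Lipschitz, a set of diameter at most [d] cannot meet both [A] and [B], so a cover of
    the union splits into two covers. *)
Let separated_delta A B (a b d : R) : (d < b - a)%R ->
  (forall x, A x -> (f x <= a)%R) -> (forall x, B x -> (b <= f x)%R) ->
  Hd d A + Hd d B <= Hd d (A `|` B).
Proof.
move=> dab Aa Bb; apply: le_ereal_inf_tmp => _ [F [Fd ABF] <-].
pose part (C : set 'rV[R]_N) k : set 'rV[R]_N := if pselect (F k `&` C !=set0) then F k else set0.
have cover C : C `<=` A `|` B -> Hd d C <= \sum_(k <oo) hausdorff_gauge s (part C k).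
  move=> CAB; apply: ereal_inf_lbound; exists (part C) => //; split.
    move=> k; rewrite /part; case: pselect => [?|?]; first exact: Fd.
    by rewrite diameter0 leNye.
  move=> x Cx; have [k _ Fkx] := ABF _ (CAB _ Cx); exists k => //.
  by rewrite /part; case: pselect => // nFC; exfalso; apply: nFC; exists x.
have cA := cover A (@subsetUl _ A B); have cB := cover B (@subsetUr _ A B).
apply: le_trans (leeD cA cB) _; rewrite -nneseriesD; try by move=> *; exact: hausdorff_gauge_ge0.
apply: lee_nneseries => k *; first by apply: adde_ge0; exact: hausdorff_gauge_ge0.
rewrite /part; case: pselect => [FA|?]; case: pselect => [FB|?];
  rewrite ?hausdorff_gauge0 ?adde0 ?add0e ?hausdorff_gauge_ge0//.
exfalso; have [x [Fx Ax]] := FA; have [y [Fy By]] := FB.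
have := le_trans (le_diameter Fx Fy) (Fd k); rewrite lee_fin => xy.
have h1 := Aa _ Ax; have h2 := Bb _ By; have := f1 x y; rewrite ler_norml => /andP[+ _].
lra.
Qed.

(** The scales for [A] and [B] are replaced by a common one below the gap [b - a]. *)
Lemma hausdorff_separated A B (a b : R) : (a < b)%R ->
  (forall x, A x -> (f x <= a)%R) -> (forall x, B x -> (b <= f x)%R) ->
  H A + H B <= H (A `|` B).
Proof.
move=> ab Aa Bb; have [->|Zoo] := eqVneq (H (A `|` B)) +oo; first exact: leey.
have fin C : C `<=` A `|` B -> H C \is a fin_num.
  move=> CAB; rewrite ge0_fin_numE ?hausdorff_ge0//.
  by apply: le_lt_trans (le_hausdorff s CAB) _; rewrite ltey.
have fA := fin A (@subsetUl _ A B); have fB := fin B (@subsetUr _ A B).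
have fd C d : (0 < d)%R -> H C \is a fin_num -> Hd d C \is a fin_num.
  move=> d0; rewrite !ge0_fin_numE ?hausdorff_ge0 ?hausdorff_delta_ge0//.
  by apply: le_lt_trans; exact: hausdorff_delta_le.
rewrite -leeBrDr//; apply: hausdorff_le => d d0; rewrite leeBrDr// addeC.
rewrite -leeBrDr ?fd//; apply: hausdorff_le => e e0; rewrite leeBrDr ?fd// addeC.
pose c := Num.min (Num.min d e) ((b - a) / 2)%R.
have c0 : (0 < c)%R by rewrite !lt_min d0 e0 divr_gt0// subr_gt0.
have cd : (c <= d)%R by rewrite !ge_min lexx.
have ce : (c <= e)%R by rewrite !ge_min lexx orbT.
have cab : (c < b - a)%R.
  have : (c <= (b - a) / 2)%R by rewrite ge_min lexx orbT.
  by move=> h; lra.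
apply: le_trans (leeD (hausdorff_delta_anti s A cd) (hausdorff_delta_anti s B ce)) _.
by apply: le_trans (separated_delta cab Aa Bb) _; exact: hausdorff_delta_le.
Qed.

(* Caratheodory's argument: the layers of X between consecutive level sets
   have summable measures, since every other one of them is separated. *)
Lemma caratheodory_lt c : (@hausdorff R N s).-caratheodory [set x | (f x < c)%R].
Proof.
apply: le_caratheodory_measurable => X.
suff main : H (X `&` [set x | (f x < c)%R]) + H (X `&` ~` [set x | (f x < c)%R]) <= H X by exact: main.
have [->|Xoo] := eqVneq (H X) +oo; first exact: leey.
pose h k : R := (c - k.+1%:R^-1)%R.
have hS k : (h k < h k.+1)%R.
  by rewrite /h ltrD2l ltrN2 ltf_pV2 ?posrE ?ltr_nat.
have hc k : (h k < c)%R by rewrite /h ltrBlDr ltrDl invr_gt0.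
pose E k := X `&` [set x | (f x <= h k)%R].
pose L k := X `&` [set x | (h k < f x <= h k.+1)%R].
have ES k : E k `<=` E k.+1 by move=> x [Xx /= fx]; split=> //=; apply: le_trans fx (ltW (hS k)).
have finH C : C `<=` X -> H C \is a fin_num.
  move=> CX; rewrite ge0_fin_numE ?hausdorff_ge0//.
  by apply: le_lt_trans (le_hausdorff s CX) _; rewrite ltey.
have layer m : H (E m) + H (L m.+1) <= H (E m.+2).
  apply: le_trans (@hausdorff_separated (E m) (L m.+1) (h m) (h m.+1) (hS m) _ _) _.
  - by move=> x [].
  - by move=> x [_ /= /andP[/ltW]].
  - apply: le_hausdorff => x [[Xx /= fx]|[Xx /= /andP[_ fx]]]; split=> //=.
    by apply: le_trans fx _; exact: ltW (lt_trans (hS _) (hS _)).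
(* Layers of one parity are summed by induction; two consecutive indices are carried because [layer]
   advances by two. *)
have odd_sum (b : bool) m : \sum_(k < m | odd k == b) H (L k) <= H (E m) /\
    \sum_(k < m.+1 | odd k == b) H (L k) <= H (E m.+1).
  have LE k : H (L k) <= H (E k.+1) by apply: le_hausdorff => x [Xx /andP[]].
  elim: m => [|m [IH1 IH2]].
    rewrite big_ord0 hausdorff_ge0; split=> //.
    rewrite big_mkcond big_ord1 /=; case: ifP => // _; exact: hausdorff_ge0.
  split=> //; rewrite big_mkcond big_ord_recr /= -big_mkcond /=; case: ifPn => mb; last first.
    by rewrite adde0; apply: le_trans IH2 _; apply: le_hausdorff; exact: ES.
  apply: le_trans (layer m); apply: leeD => //.
  rewrite big_mkcond big_ord_recr /= -big_mkcond /=.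
  by rewrite (_ : odd m == b = false) ?adde0//; move: mb => /= ; case: (odd m); case: (b).
have total m : \sum_(0 <= k < m) H (L k) <= H X + H X.
  rewrite big_mkord (bigID (fun k : 'I_m => odd k == true)) /=; apply: leeD.
    by have [h1 _] := odd_sum true m; apply: le_trans h1 _; apply: le_hausdorff => x [].
  rewrite (eq_bigl (fun k : 'I_m => odd k == false)); last by move=> k; case: (odd k).
  by have [h1 _] := odd_sum false m; apply: le_trans h1 _; apply: le_hausdorff => x [].
have fX : H X + H X < +oo by rewrite -ge0_fin_numE ?adde_ge0 ?hausdorff_ge0// fin_numD !finH.
have tot : \sum_(0 <= k <oo) H (L k) < +oo.
  apply: le_lt_trans fX; apply: lime_le; last exact: nearW.
  by apply: is_cvg_nneseries => k _ _; exact: hausdorff_ge0.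
have e_open (e : R) : (0 < e)%R -> nbhs 0 [set z : \bar R | z < e%:E].
  by move=> e0; apply: open_nbhs_nbhs; split; [exact: open_ereal_lt_ereal|rewrite /= lte_fin].
apply/lee_addgt0Pr => e e0.
have [m _ /(_ m (leqnn m)) /= tail] :=
  nneseries_tail_cvg tot (fun k _ => hausdorff_ge0 s (L k)) (e_open e e0).
have hm k j : (k <= j)%N -> (h k <= h j)%R.
  by move=> kj; rewrite /h lerD2l lerN2 lef_pV2 ?posrE ?ler_nat.
(* A point above level [h m] lies in the layer that ends at the first level reaching it. *)
have sub : X `&` [set x | (f x < c)%R] `<=` E m `|` \bigcup_(k in ~` `I_m) L k.
  move=> x [Xx /= fx]; have [fm|fm] := leP (f x) (h m); first by left.
  right; have [K0 fK0] := ltr_add_invr fx.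
  have ex : exists K, (f x <= h K)%R by exists K0; rewrite /h lerBrDr ltW.
  case: (ex_minnP ex) => -[|K] fK Kmin.
    by have := lt_le_trans fm (le_trans fK (hm 0%N m (leq0n _))); rewrite ltxx.
  have KfN : (h K < f x)%R.
    by rewrite ltNge; apply/negP => /Kmin; rewrite ltnn.
  exists K; last by split=> //=; rewrite KfN.
  rewrite /= => /= Km; have := lt_le_trans fm (le_trans fK (hm _ _ Km)).
  by rewrite ltxx.
have s1 : H (X `&` [set x | (f x < c)%R]) <= H (E m) + e%:E.
  apply: le_trans (le_hausdorff s sub) _; apply: le_trans (outer_measureU2 _ _ _) _.
  apply: leeD => //; apply: le_trans (outer_measure_sigma_subadditive_tail _ _ _) _.
  exact: ltW tail.
have s2 : H (E m) + H (X `&` ~` [set x | (f x < c)%R]) <= H X.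
  apply: le_trans (@hausdorff_separated _ _ (h m) c (hc m) _ _) _.
  - by move=> x [].
  - by move=> x [_ /= /negP]; rewrite -leNgt.
  - by apply: le_hausdorff => x [[]|[]].
by apply: le_trans (leeD s1 (lexx _)) _; rewrite addeAC; apply: leeD.
Qed.

End Caratheodory.
Section HausdorffBorel.
Context {R : realType} {N : nat} (s : nat).
Implicit Types (x y : 'rV[R]_N) (A B X : set 'rV[R]_N) (d e r : R).

Lemma coord_le_dist x y i : `|x 0 i - y 0 i| <= euclidean_dist x y.
Proof.
rewrite -sqrtr_sqr ler_wsqrtr// (bigD1 i)//= lerDl.
by apply: sumr_ge0 => j _; exact: sqr_ge0.
Qed.

Lemma dist_le_sum x y : euclidean_dist x y <= \sum_i `|x 0 i - y 0 i|.
Proof.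
set S := \sum_i _; have S0 : 0 <= S by apply: sumr_ge0.
rewrite -(ger0_norm S0) -sqrtr_sqr ler_wsqrtr// expr2 {1}/S mulr_suml.
apply: ler_sum => i _; rewrite -[leLHS]ger0_norm ?sqr_ge0// normrX expr2 ler_wpM2l//.
by rewrite /S (bigD1 i)//= lerDl; apply: sumr_ge0.
Qed.

Let U := caratheodory_type (@hausdorff R N s).

Let coord_lt (i : 'I_N) c : measurable ([set x | x 0 i < c] : set U).
Proof. by apply: (@caratheodory_lt R N s (fun x => x 0 i)) => x y; exact: coord_le_dist. Qed.

Let coord_gt (i : 'I_N) c : measurable ([set x | c < x 0 i] : set U).
Proof.
suff : (@hausdorff R N s).-caratheodory [set x : 'rV[R]_N | c < x 0 i] by [].
have -> : [set x : 'rV[R]_N | c < x 0 i] = [set x | - x 0 i < - c].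
  by apply/seteqP; split=> x /=; rewrite ltrN2.
apply: (@caratheodory_lt R N s (fun x => - x 0 i)) => x y.
by rewrite (_ : - x 0 i - - y 0 i = - (x 0 i - y 0 i)) ?normrN; [exact: coord_le_dist|ring].
Qed.

(** Coordinates and their negatives are 1-Lipschitz, so coordinate half-spaces, hence rational boxes
    and open sets, are Caratheodory measurable. *)
Lemma borel_caratheodory (A : set (borel_rV R N)) : measurable A ->
  measurable (A : set U).
Proof.
apply: (smallest_sub (sigma_algebra_measurable U)) => O oO.
rewrite (open_rat_boxes oO) bigcup_mkcond; apply: countable_bigcupT_measurable => [|q].
  exact: countableP.
case: ifP => // _.
have -> : rat_box q = \bigcap_(i in [set: 'I_N])
    ([set x : 'rV[R]_N | x 0 i < ratr (q.1 0 i) + ratr q.2] `&`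
     [set x : 'rV[R]_N | ratr (q.1 0 i) - ratr q.2 < x 0 i]).
  apply/seteqP; split=> x /= h.
    by move=> i _; have := h i; rewrite ltr_distl => /andP[].
  by move=> i; rewrite ltr_distl; have [/= -> ->] := h i Logic.I.
apply: fin_bigcap_measurable => [|i _]; first exact: finite_finset.
by apply: measurableI; [exact: coord_lt|exact: coord_gt].
Qed.

Local Notation haus := (@hausdorff R N s : set (borel_rV R N) -> \bar R).

Lemma hausdorff_sigma_additive : semi_sigma_additive haus.
Proof.
move=> F mF tF mUF.
apply: (@caratheodory_measure_sigma_additive _ _ (@hausdorff R N s)) => // [k|].
  exact: borel_caratheodory.
exact: borel_caratheodory.
Qed.

End HausdorffBorel.

HB.instance Definition _ (R : realType) (N s : nat) := isMeasure.Build _ _ _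
  (@hausdorff R N s : set (borel_rV R N) -> \bar R) (hausdorff0 s)
  (hausdorff_ge0 s) (@hausdorff_sigma_additive R N s).

(** * Lipschitz bounds and Hausdorff measure of graphs *)

Section Lipschitz.
Context {R : realType} {N : nat}.
Implicit Types (x y u v c : 'rV[R]_N) (h : 'rV[R]_N -> R) (r t L : R).

Lemma line_lipschitz h i u t L : smooth h -> 0 <= t ->
  (forall s, 0 <= s <= t -> `|partial i h (u - s *: delta_mx 0 i)| <= L) ->
  `|h (u - t *: delta_mx 0 i) - h u| <= L * t.
Proof.
move=> sh t0 hL.
have dh : forall y, derivable h y (delta_mx 0 i).
  by move=> y; have [_ /(_ i)[dm _]] := sh 1%N; exact: dm.
have dl s : is_derive s (1 : R) (fun s => h (u - s *: delta_mx 0 i))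
    (- partial i h (u - s *: delta_mx 0 i)) by exact: is_derive_line.
have [|b] := @MVT_segment R (fun s => h (u - s *: delta_mx 0 i))
  (fun s => - partial i h (u - s *: delta_mx 0 i)) 0 t t0 (fun s _ => dl s).
  by apply: derivable_within_continuous => s _; exact: (@ex_derive _ _ _ _ _ _ _ (dl s)).
rewrite in_itv /= => bt; rewrite !scale0r !subr0 => ->.
by rewrite normrM normrN (ger0_norm t0) ler_wpM2r// hL.
Qed.

(** The partial derivatives are bounded on the cube, and [x] is moved to [y] one coordinate at a
    time within it. *)
Lemma smooth_lipschitz h c r : smooth h -> exists2 L, 0 <= L &
  forall x y, cube c r x -> cube c r y -> `|h x - h y| <= L * \sum_i `|x 0 i - y 0 i|.
Proof.
move=> sh.
have /choice[M MP] : forall i, exists M : R, 0 <= M /\ forall x, cube c r x -> `|partial i h x| <= M.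
  move=> i; have cp : continuous (partial i h).
    by apply: (@Ck_continuous _ _ 0); have [_ /(_ i)[]] := sh 1%N.
  by have [M M0 hM] := continuous_cube_bounded c r cp; exists M.
pose L := \sum_i M i; have M0 i : 0 <= M i by have [] := MP i.
have L0 : 0 <= L by apply: sumr_ge0.
have hL i x : cube c r x -> `|partial i h x| <= L.
  have [_ h1] := MP i => /h1/le_trans; apply.
  by rewrite /L (bigD1 i)//= lerDl; apply: sumr_ge0.
have down i u t : 0 <= t -> cube c r u -> cube c r (u - t *: delta_mx 0 i) ->
    `|h (u - t *: delta_mx 0 i) - h u| <= L * t.
  move=> t0 cu cut; apply: line_lipschitz => // s /andP[s0 st]; apply: hL => j.
  have h1 := cu j; have := cut j; rewrite !mxE.
  have [_|_] := eqVneq j i; last by rewrite !mulr0.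
  rewrite eqxx /= !mulr1 => h2; move: h1 h2; rewrite !ler_distl => /andP[_ h1] /andP[h2 _].
  by apply/andP; split; lra.
have move1 i u t : cube c r u -> cube c r (u + t *: delta_mx 0 i) ->
    `|h (u + t *: delta_mx 0 i) - h u| <= L * `|t|.
  move=> cu cut; have [t0|t0] := leP 0 t.
    have := down i (u + t *: delta_mx 0 i) t t0 cut.
    by rewrite addrK distrC (ger0_norm t0); apply.
  have := down i u (- t); rewrite scaleNr opprK oppr_ge0 (ltr0_norm t0).
  by apply; first exact: ltW.
exists L => // x y cx cy.
pose z k : 'rV[R]_N := \row_j (if (j < k)%N then y 0 j else x 0 j).
have cz k : cube c r (z k) by move=> j; rewrite mxE; case: ifP.
have claim k : (k <= N)%N -> `|h (z k) - h x| <= L * \sum_(j : 'I_N | (j < k)%N) `|x 0 j - y 0 j|.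
  elim: k => [_|k IH kN].
    have -> : z 0%N = x by apply/rowP => j; rewrite mxE.
    by rewrite subrr normr0 mulr_ge0//; apply: sumr_ge0.
  pose i := Ordinal kN.
  have zE : z k.+1 = z k + (y 0 i - x 0 i) *: delta_mx 0 i.
    apply/rowP => j; rewrite !mxE eqxx /= ltnS leq_eqVlt.
    have [->|ji] := eqVneq j i; first by rewrite eqxx ltnn /= mulr1 addrC subrK.
    have -> : (j == k :> nat) = false by apply/negbTE; apply: contra ji => /eqP jk; exact/eqP/val_inj.
    by rewrite mulr0 addr0.
  have -> : h (z k.+1) - h x = (h (z k.+1) - h (z k)) + (h (z k) - h x) by ring.
  apply: le_trans (ler_normD _ _) _; rewrite (bigD1 i)//= mulrDr; apply: lerD.
    by rewrite [`|x 0 i - _|]distrC zE; apply: move1 => //; rewrite -zE.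
  apply: le_trans (IH (ltnW kN)) _; rewrite le_eqVlt; apply/orP; left; apply/eqP.
  congr (_ * _); apply: eq_bigl => j.
  have -> : (j < k.+1)%N = (j == k :> nat) || (j < k)%N by rewrite ltnS leq_eqVlt.
  have [->|ji] := eqVneq j i; first by rewrite ltnn andbF.
  have -> : (j == k :> nat) = false by apply/negbTE; apply: contra ji => /eqP jk; exact/eqP/val_inj.
  by rewrite andbT.
have := claim N (leqnn _); rewrite (_ : z N = y); last by apply/rowP => j; rewrite mxE ltn_ord.
by rewrite distrC (eq_bigl xpredT)// => j; rewrite ltn_ord.
Qed.

End Lipschitz.
Section Graph.
Context {R : realType} {n : nat}.
Local Notation N := n.+1.
Local Notation haus := (@hausdorff R N n : set (borel_rV R N) -> \bar R).
Local Notation lebn := (@lebesgue_rV R n : set (borel_rV R n) -> \bar R).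
Implicit Types (A B : set 'rV[R]_N) (d e r : R).
Local Open Scope ereal_scope.

(** The Euclidean ball contains a neighbourhood of 0 and lies in the cube of radius 1. *)
Lemma unit_ball_volumeE : exists2 w : R, (0 < w)%R & unit_ball_volume R n = w%:E.
Proof.
pose B : set (borel_rV R n) := [set x : 'rV[R]_n | (euclidean_dist x 0 <= 1)%R].
have mB : measurable B.
  have mg : measurable_fun setT (fun x : borel_rV R n => \sum_(i < n) ((x : 'rV[R]_n) 0 i - (0 : 'rV[R]_n) 0 i) ^+ 2 : R)%R.
    apply: measurable_sum => i; apply: measurable_funX; apply: measurable_funB => //.
    exact: measurable_coord.
  have := mg measurableT _ (measurable_itv `]-oo, 1%R : R]); rewrite setTI; congr measurable.
  have eqB (x : 'rV[R]_n) : (euclidean_dist x 0 <= 1)%R = (\sum_(i < n) (x 0 i - (0 : 'rV[R]_n) 0 i) ^+ 2 <= 1)%R.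
    by rewrite /euclidean_dist -[in leRHS]sqrtr1 ler_sqrt.
  by apply/seteqP; split=> x; rewrite /B /= in_itv /= eqB.
have B1 : B `<=` cube 0 1.
  by move=> x Bx i; apply: le_trans Bx; exact: coord_le_dist.
have fB : lebn B < +oo.
  apply: (@le_lt_trans _ _ (lebn (cube 0 1))); first by apply: le_measure; rewrite ?inE//; exact: measurable_cube.
  by rewrite lebesgue_cube// ltry.
have n0 : (0 < n%:R + 1 :> R)%R by rewrite ltr_wpDl.
have B0 : 0 < lebn B.
  apply: (lebesgue_nbhs_gt0 mB (c := 0%R)); apply/nbhs_rVP; exists (n%:R + 1)^-1%R; first by rewrite invr_gt0.
  move=> y hy; apply: (le_trans (dist_le_sum _ _)).
  apply: (@le_trans _ _ (\sum_(i < n) (n%:R + 1)^-1)%R); first by apply: ler_sum => i _; exact: ltW (hy i).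
  by rewrite sumr_const card_ord -[leLHS]mulr_natl ler_pdivrMr// mul1r lerDl.
exists (fine (lebn B)); first by rewrite fine_gt0// B0.
by rewrite fineK// ge0_fin_numE// ltW.
Qed.

Lemma hausdorff_gauge_le A d w : unit_ball_volume R n = w%:E -> (0 <= w)%R -> (0 <= d)%R ->
  diameter A <= d%:E -> hausdorff_gauge n A <= (w * (d / 2) ^+ n)%:E.
Proof.
move=> wE w0 d0 Ad; rewrite /hausdorff_gauge; case: ifPn => [_|/set0P A0].
  by rewrite lee_fin mulr_ge0 ?exprn_ge0 ?divr_ge0.
have D0 := diameter_ge0 A0; have [D DE] : exists D, diameter A = D%:E.
  exists (fine (diameter A)); rewrite fineK// ge0_fin_numE//.
  by apply: le_lt_trans Ad _; rewrite ltry.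
move: Ad D0; rewrite wE DE !lee_fin -EFinM -EFin_expe -EFinM lee_fin => Ad D0.
by rewrite ler_wpM2l// lerXn2r ?nnegrE ?divr_ge0// ler_wpM2r.
Qed.

Lemma hausdorff_delta_finite d A (I : finType) (P : I -> set 'rV[R]_N) (z : R) :
  (forall i, diameter (P i) <= d%:E) -> (forall i, hausdorff_gauge n (P i) <= z%:E) ->
  A `<=` \bigcup_i P i -> hausdorff_delta n d A <= (#|I|%:R * z)%:E.
Proof.
move=> Pd Pz AP; pose F k := nth set0 [seq P i | i <- enum I] k.
have szE : size [seq P i | i <- enum I] = #|I| by rewrite size_map -cardE.
apply: (@le_trans _ _ (\sum_(k <oo) hausdorff_gauge n (F k))).
  apply: ereal_inf_lbound; exists F => //; split.
    move=> k; rewrite /F; have [kI|kI] := ltnP k #|I|; last first.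
      by rewrite nth_default ?szE// diameter0 leNye.
    have i0 : I by apply: (enum_val (Ordinal kI)).
    by rewrite (nth_map i0) -?cardE.
  move=> x /AP[i _ Px]; exists (enum_rank i) => //.
  by rewrite /F (nth_map i) -?cardE// nth_enum_rank.
rewrite (nneseries_split _ #|I|); last by move=> *; exact: hausdorff_gauge_ge0.
rewrite eseries0 ?adde0; last first.
  by move=> k Ik _; rewrite /F nth_default ?szE// hausdorff_gauge0.
rewrite big_mkord; apply: (@le_trans _ _ (\sum_(k < #|I|) z%:E)).
  by apply: lee_sum => k _; rewrite /F (nth_map (enum_val k)) -?cardE.
by rewrite sumEFin lee_fin sumr_const card_ord mulr_natl.
Qed.

Lemma interval_cell (w t : R) m : (0 <= w)%R -> (0 <= t <= w * m.+1%:R)%R ->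
  exists a : 'I_m.+1, (w * a%:R <= t <= w * a%:R + w)%R.
Proof.
move=> w0; elim: m => [|m IH] /andP[t0 tw].
  by exists ord0; rewrite mulr0 add0r t0 -[leRHS]mulr1.
have [le|gt] := leP t (w * m.+1%:R)%R.
  have [|a ha] := IH; first by rewrite t0.
  by exists (widen_ord (leqnSn _) a).
exists ord_max; rewrite /= ltW//=; move: tw.
by rewrite [in (_ * m.+2%:R)%R]mulrSr mulrDr mulr1.
Qed.

(** A Lipschitz graph over an n-dimensional cube: cutting the base into (m+1)^n cells gives pieces
    of diameter at most C/(m+1), and the total gauge does not depend on m. *)
Lemma hausdorff_chart_lty (Om : set 'rV[R]_N) x0 i s h r : graph_chart Om x0 i s h r ->
  haus (boundary Om `&` cube x0 (r / 2)) < +oo.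
Proof.
move=> [sh r0 ch]; set A := _ `&` _; pose rho : R := (r / 2)%R.
have rho0 : (0 < rho)%R by rewrite divr_gt0.
have [L L0 hL] := smooth_lipschitz (col' i x0) rho sh.
have [w w0 wE] := unit_ball_volumeE.
pose C : R := ((1 + L) * (n%:R * (2 * rho)))%R.
have C0 : (0 <= C)%R by rewrite !mulr_ge0 ?addr_ge0// ltW.
have Acol (y : 'rV[R]_N) : A y -> cube (col' i x0) rho (col' i y).
  by move=> [_ yx] j; rewrite !mxE; exact: yx.
have Agr (y : 'rV[R]_N) : A y -> (y 0 i = h (col' i y))%R.
  move=> [By yx]; have yr j : (`|y 0 j - x0 0 j| < r)%R by have := yx j; lra.
  by have [_ /iffLR/(_ By)] := ch _ yr.
have Adist (y z : 'rV[R]_N) : A y -> A z ->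
    (euclidean_dist y z <= (1 + L) * \sum_j `|(col' i y) 0 j - (col' i z) 0 j|)%R.
  move=> Ay Az; apply: le_trans (dist_le_sum _ _) _.
  rewrite (bigD1_ord i)//= mulrDl mul1r addrC; apply: lerD.
    by apply: ler_sum => j _; rewrite !mxE.
  by rewrite (Agr _ Ay) (Agr _ Az); apply: hL; exact: Acol.
suff : haus A <= (w * (C / 2) ^+ n)%:E by move=> /le_lt_trans; apply; rewrite ltry.
apply: hausdorff_le => d d0.
have [m Cm] : exists m, (C / m.+1%:R <= d)%R.
  have := archi_boundP (divr_ge0 C0 (ltW d0)); set m := Num.bound _ => hm.
  exists m; rewrite ler_pdivrMr ?ltr0n// mulrC -ler_pdivrMr//.
  by apply: le_trans (ltW hm) _; rewrite ler_nat leqnSn.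
pose cw : R := (2 * rho / m.+1%:R)%R.
have cw0 : (0 <= cw)%R by rewrite divr_ge0 ?mulr_ge0// ltW.
pose base j : R := ((col' i x0) 0 j - rho)%R.
pose P (f : {ffun 'I_n -> 'I_m.+1}) : set 'rV[R]_N := [set y | A y /\
  forall j, (cw * (f j)%:R <= (col' i y) 0 j - base j <= cw * (f j)%:R + cw)%R].
have Pdiam f : diameter (P f) <= (C / m.+1%:R)%:E.
  apply: ge_ereal_sup => _ [[y z] [[/= Ay Py] [/= Az Pz]] <-]; rewrite lee_fin /=.
  apply: le_trans (Adist _ _ Ay Az) _; rewrite /C -mulrA ler_wpM2l ?addr_ge0//.
  apply: (@le_trans _ _ (\sum_(j < n) cw)%R).
    apply: ler_sum => j _; have /andP[h1 h2] := Py j; have /andP[h3 h4] := Pz j.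
    by rewrite ler_norml; apply/andP; split; lra.
  by rewrite sumr_const card_ord -[leLHS]mulr_natl /cw [leLHS]mulrA.
have Pgauge f : hausdorff_gauge n (P f) <= (w * (C / m.+1%:R / 2) ^+ n)%:E.
  by apply: hausdorff_gauge_le => //; [exact: ltW|rewrite divr_ge0].
have AP : A `<=` \bigcup_f P f.
  move=> y Ay.
  have /choice[f fP] : forall j, exists a : 'I_m.+1,
      (cw * a%:R <= (col' i y) 0 j - base j <= cw * a%:R + cw)%R.
    move=> j; apply: interval_cell => //; have := Acol _ Ay j; rewrite ler_distl /base /cw.
    by rewrite divfK ?pnatr_eq0// => /andP[h1 h2]; apply/andP; split; lra.
  by exists [ffun j => f j] => //; split=> // j; rewrite ffunE.
have Pd f : diameter (P f) <= d%:E by apply: le_trans (Pdiam f) _; rewrite lee_fin.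
apply: le_trans (hausdorff_delta_finite Pd Pgauge AP) _.
rewrite card_ffun !card_ord lee_fin le_eqVlt; apply/orP; left; apply/eqP.
rewrite natrX mulrCA; congr (_ * _)%R; rewrite -exprMn; congr (_ ^+ _)%R.
by have : (m.+1%:R != 0 :> R)%R by []; set M := m.+1%:R%R => M0; field.
Qed.

(** Dropping a coordinate does not increase distances, so a covering set of diameter D projects into
    a cube of half-side D; every cover therefore pays for the volume of the base cube. *)
Lemma hausdorff_projection_gt0 A (i : 'I_N) (c : 'rV[R]_n) r : (0 < r)%R ->
  (forall y, cube c r y -> exists2 x, A x & col' i x = y) -> 0 < haus A.
Proof.
move=> r0 Ac; have [w w0 wE] := unit_ball_volumeE.
(* Ratio of the cube volume (2 D)^n to the gauge w (D / 2)^n. *)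
pose kap : R := (4 ^+ n / w)%R.
have kap0 : (0 < kap)%R by rewrite divr_gt0 ?exprn_gt0.
suff le : ((2 * r) ^+ n / kap)%:E <= hausdorff_delta n 1 A.
  apply: lt_le_trans (hausdorff_delta_le n A ltr01); apply: lt_le_trans le.
  by rewrite lte_fin divr_gt0// exprn_gt0// mulr_gt0.
apply: le_ereal_inf_tmp => _ [F [Fd AF] <-].
have /choice[G GP] : forall k, exists G : set (borel_rV R n), [/\ measurable G,
    forall x, F k x -> G (col' i x) & lebn G <= kap%:E * hausdorff_gauge n (F k)].
  move=> k; have [[p Fp]|F0] := pselect (F k !=set0); last first.
    exists set0; split=> // [x Fx|]; first by apply: F0; exists x.
    by rewrite measure0 mule_ge0 ?hausdorff_gauge_ge0// lee_fin ltW.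
  have F0 : F k !=set0 by exists p.
  have D0 := diameter_ge0 F0; have [D DE] : exists D, diameter (F k) = D%:E.
    exists (fine (diameter (F k))); rewrite fineK// ge0_fin_numE//.
    by apply: le_lt_trans (Fd k) _; rewrite ltry.
  have {}D0 : (0 <= D)%R by rewrite -lee_fin -DE.
  exists (cube (col' i p) D); split; first exact: measurable_cube.
    move=> x Fx j; rewrite !mxE; apply: le_trans (coord_le_dist _ _ _) _.
    by have := le_diameter Fx Fp; rewrite DE lee_fin.
  rewrite lebesgue_cube// /hausdorff_gauge ifF; last by apply/negbTE/set0P.
  rewrite wE DE -EFinM -EFin_expe -!EFinM lee_fin le_eqVlt; apply/orP; left; apply/eqP.
  rewrite /kap mulrA divfK ?gt_eqF// -exprMn; congr (_ ^+ _)%R; by field.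
have mG k : measurable (G k) by have [] := GP k.
have cG : cube c r `<=` \bigcup_k G k.
  move=> y /Ac[x /AF[k _ Fx] <-]; exists k => //; have [_ h _] := GP k; exact: h.
have : lebn (cube c r) <= \sum_(k <oo) lebn (G k) :=
  measure_sigma_subadditive lebn mG (measurable_cube c r) cG.
rewrite lebesgue_cube ?(ltW r0)// => le.
have : ((2 * r) ^+ n)%:E <= kap%:E * \sum_(k <oo) hausdorff_gauge n (F k).
  apply: le_trans le _; rewrite -nneseriesZl; last by move=> *; exact: hausdorff_gauge_ge0.
  by apply: lee_nneseries => [k *|k _]; [exact: measure_ge0|have [] := GP k].
by move=> h; rewrite EFinM muleC lee_pdivrMl.
Qed.

End Graph.

(** * Positivity of surface integrals over the boundary *)

Lemma within_nbhs (T U : topologicalType) (A : set T) (f : T -> U) (O : set U) y :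
  {within A, continuous f} -> open O -> A y -> O (f y) ->
  nbhs y [set z | A z -> O (f z)].
Proof.
move=> cf oO Ay Oy; have : nbhs (y : subspace A) (f @^-1` O).
  by apply: (cf y); exact: open_nbhs_nbhs.
move=> /(nbhs_subspace_ex _ Ay)[V yV VE]; apply: filterS yV => z Vz Az.
by have : (V `&` A) z by []; rewrite -VE => -[].
Qed.

Section BoundaryMeasure.
Context {R : realType} {n : nat}.
Local Notation N := n.+1.
Local Notation haus := (@hausdorff R N n : set (borel_rV R N) -> \bar R).
Implicit Types (f : 'rV[R]_N -> R) (x y : 'rV[R]_N) (d e r : R).
Variable Om : set 'rV[R]_N.
Hypothesis hOm : bounded_smooth_domain Om.
Local Notation B := (boundary Om).
Let oOm : open Om. Proof. by case: hOm. Qed.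
Let bOm : bounded_set Om. Proof. by case: hOm. Qed.
Let sOm : smooth_boundary Om. Proof. by case: hOm. Qed.

Lemma closed_boundary : closed B.
Proof.
apply: closedI; first exact: closed_closure.
by apply: open_closedC; exact: open_interior.
Qed.

Lemma compact_boundary : compact B.
Proof.
apply: (subclosed_compact closed_boundary (compact_closure_domain bOm)).
by move=> x [].
Qed.

Lemma measurable_boundary : measurable (B : set (borel_rV R N)).
Proof. by apply: closed_measurable_rV; exact: closed_boundary. Qed.

Lemma boundary_lty : (haus B < +oo)%E.
Proof.
rewrite -[B]setIid.
apply: (compact_induction (P := fun A => haus (B `&` A) < +oo)%E compact_boundary).
- by rewrite setI0 hausdorff0.
- by move=> A C AC; apply: le_lt_trans; apply: le_hausdorff; exact: setIS.
- move=> A C Aoo Coo; rewrite setIUr.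
  apply: le_lt_trans (outer_measureU2 (@hausdorff R N n) _ _) _.
  by rewrite lte_add_pinfty.
- move=> x Bx; have [i [s [h [r ch]]]] := boundary_graph oOm sOm Bx.
  exists (cube x (r / 2)); last exact: hausdorff_chart_lty ch.
  by apply: cube_nbhs; case: ch => _ r0 _; rewrite divr_gt0.
Qed.

(** This piece of the boundary contains the graph over a small cube, onto which it projects. *)
Lemma boundary_nbhs_gt0 x e : B x -> 0 < e -> (0 < haus (B `&` cube x e))%E.
Proof.
move=> Bx e0; have [i [s [h [r [sh r0 ch]]]]] := boundary_graph oOm sOm Bx.
pose e1 := Num.min e (r / 2).
have e10 : 0 < e1 by rewrite lt_min e0 divr_gt0.
have e1e : e1 <= e by rewrite ge_min lexx.
have e1r : e1 <= r / 2 by rewrite ge_min lexx orbT.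
have xr j : `|x 0 j - x 0 j| < r by rewrite subrr normr0.
have hx : x 0 i = h (col' i x) by have [_ /iffLR/(_ Bx)] := ch _ xr.
have /nbhs_rVP[t t0 ht] : nbhs (col' i x) [set y | `|h y - h (col' i x)| < e1].
  have cth : continuous h := Ck_continuous (sh 0%N).
  apply: (cth (col' i x) [set z : R | `|z - h (col' i x)| < e1]).
  by apply/nbhs_ballP; exists e1 => // z; rewrite /ball /= distrC.
have eta0 : 0 < Num.min (t / 2) e1 by rewrite lt_min divr_gt0.
apply: (hausdorff_projection_gt0 (i := i) (c := col' i x) eta0) => y hy.
pose z : 'rV[R]_N := \row_j oapp (y 0) (h y) (unlift i j).
have zE : col' i z = y by apply/rowP => j; rewrite !mxE liftK.
have zi : z 0 i = h y by rewrite mxE unlift_none.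
have zx j : `|z 0 j - x 0 j| <= e1.
  case: (unliftP i j) => [k ->|->].
    have := hy k; rewrite le_min !mxE => /andP[_].
    by rewrite liftK.
  rewrite zi hx; apply: ltW; apply: ht => k.
  by have := hy k; rewrite le_min => /andP[+ _]; lra.
exists z => //; split; last by move=> j; apply: le_trans e1e.
have zr j : `|z 0 j - x 0 j| < r by have := zx j; lra.
by apply/(ch _ zr).2; rewrite zi zE.
Qed.

(** By continuity [f] exceeds [f x / 2] on a piece of the boundary of positive measure. *)
Lemma surf_int_gt0 f x : {within B, continuous f} -> (forall y, B y -> 0 <= f y) ->
  B x -> 0 < f x -> 0 < surf_int B f.
Proof.
move=> cf f0 Bx fx.
have near_in (O : set R) y := @within_nbhs _ _ B f O y cf.
have mf : measurable_fun (B : set (borel_rV R N)) (f : borel_rV R N -> measurableTypeR R).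
  apply: (measurability _ (measurable_realfun.RGenOpens.measurableE R)).
  move=> _ [_ [a [b ->]] <-].
  pose W := interior [set z | B z -> `]a, b[%classic (f z)].
  have -> : B `&` f @^-1` `]a, b[ = B `&` W.
    apply/seteqP; split=> y [By fy]; split=> //; last exact: (interior_subset fy By).
    by apply: near_in => //; exact: interval_open.
  apply: measurableI; first exact: measurable_boundary.
  by apply: open_measurable_rV; exact: open_interior.
have mB := measurable_boundary.
have mfE : measurable_fun (B : set (borel_rV R N)) (EFin \o f) by apply/measurable_EFinP.
have f0E (y : borel_rV R N) : (B : set (borel_rV R N)) y -> (0 <= (f y)%:E)%E.
  by rewrite lee_fin; exact: f0.
rewrite /surf_int; apply: fine_gt0; apply/andP; split.
  have /nbhs_cube[e e0 ef] := near_in _ x (@open_gt _ (f x / 2)) Bx (ltac:(rewrite /=; lra)).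
  pose C : set (borel_rV R N) := B `&` cube x e.
  have mC : measurable C by apply: measurableI => //; exact: measurable_cube.
  have CB : C `<=` B by move=> y [].
  apply: (@lt_le_trans _ _ (\int[haus]_(y in C) (f x / 2)%:E)%E); last first.
    apply: (@le_trans _ _ (\int[haus]_(y in C) (f y)%:E)%E).
      apply: (ge0_le_integral haus mC).
      - by move=> y _; rewrite lee_fin divr_ge0// ltW.
      - exact: measurable_cst.
      - exact: measurable_funS mfE.
      - by move=> y [By /ef] /(_ By) /= /ltW; rewrite lee_fin.
    exact: (ge0_subset_integral haus mC mB mfE f0E CB).
  rewrite (integral_cst haus mC) mule_gt0// ?lte_fin ?divr_gt0//.
  exact: boundary_nbhs_gt0.
(* Finiteness matters as well, because [fine] would send an infinite integral to 0. *)
have [M M0 fM] := compact_continuous_bounded compact_boundary cf.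
apply: (@le_lt_trans _ _ (\int[haus]_(y in B) M%:E)%E).
  apply: (ge0_le_integral haus mB f0E mfE); first exact: measurable_cst.
  by move=> y By; rewrite lee_fin; apply: le_trans (ler_norm _) (fM _ By).
by rewrite (integral_cst haus mB) lte_mul_pinfty// boundary_lty.
Qed.

End BoundaryMeasure.

(** * The sign of the eigenvalue of the second problem *)

Section Sign.
Context {R : realType} {n : nat}.
Local Notation N := n.+1.
Implicit Types (f g u psi : 'rV[R]_N -> R) (x y : 'rV[R]_N) (e r : R).
Variable Om : set 'rV[R]_N.
Hypothesis hOm : bounded_smooth_domain Om.
Local Notation B := (boundary Om).
Local Notation H1 := (H1_continuous Om).
Local Notation I := (vol_int Om).
Local Notation Sf := (surf_int B).
Let oOm : open Om. Proof. by case: hOm. Qed.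
Let bOm : bounded_set Om. Proof. by case: hOm. Qed.
Let Om0 : Om !=set0. Proof. by case: hOm. Qed.
Let mOm := domain_measurable oOm.
Let fOm := domain_finite oOm bOm.

Lemma smooth_bump_at x e : 0 < e -> exists psi, [/\ smooth psi, forall y, 0 <= psi y,
  0 < psi x & forall y, psi y != 0 -> forall i, `|y 0 i - x 0 i| < e].
Proof.
move=> e0; exists (fun y => \prod_i bump (e^-1 * y 0 i + - (e^-1 * x 0 i))); split.
- by apply: smooth_prod => i; exact: smooth_bump.
- by move=> y; apply: prodr_ge0 => i _; exact: bump_ge0.
- rewrite big1 ?ltr01// => i _; rewrite subrr.
  have := @sum_bump R 0 0; rewrite oppr0 lexx => /(_ isT).
  by move=> <-; rewrite big_ord1 /= addr0 subr0.
- move=> y /prodf_neq0 h i; have /bump_supp := h i isT.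
  by rewrite -mulrBr normrM gtr0_norm ?invr_gt0// -ltr_pdivlMl ?invr_gt0// invrK mulr1.
Qed.

(** The integral of (f + t g)^2 is nonnegative for all t and has no constant term, so its linear
    coefficient vanishes; t = -c/(K + 1) avoids dividing by a zero norm. *)
Lemma L2_orthogonal (A : set (borel_rV R N)) f g : measurable A -> L2 A f -> L2 A g ->
  vol_int A (fun x => f x ^+ 2) = 0 -> vol_int A (fun x => f x * g x) = 0.
Proof.
move=> mA Lf Lg f0; have [_ f2] := Lf; have [_ g2] := Lg.
have fg := L2_mul mA Lf Lg; set c := vol_int A (fun x => f x * g x).
set K := vol_int A (fun x => g x ^+ 2).
have K0 : 0 <= K by apply: vol_int_ge0 => x _; exact: sqr_ge0.
have quad t : 0 <= 2 * t * c + t ^+ 2 * K.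
  rewrite (_ : 2 * t * c = vol_int A (fun x => f x ^+ 2) + 2 * t * c); last by rewrite f0 add0r.
  rewrite /c /K -(vol_intZ mA _ fg) -(vol_intZ mA _ g2).
  have J1 := L1Z mA (2 * t) fg; have J2 := L1Z mA (t ^+ 2) g2.
  rewrite -(vol_intD mA f2 J1) -(vol_intD mA (L1D mA f2 J1) J2).
  apply: vol_int_ge0 => x _.
  rewrite (_ : _ + _ + _ = (f x + t * g x) ^+ 2) ?sqr_ge0//; by ring.
have K1 : 0 < K + 1 by rewrite ltr_wpDl.
have := quad (- c / (K + 1)).
have -> : 2 * (- c / (K + 1)) * c + (- c / (K + 1)) ^+ 2 * K =
    - (c ^+ 2 * (K + 2) / (K + 1) ^+ 2) by field; rewrite gt_eqF.
rewrite oppr_ge0 pmulr_lle0 ?invr_gt0 ?exprn_gt0// pmulr_lle0 ?ltr_wpDl//.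
by move=> c2; apply/eqP; rewrite -sqrf_eq0 eq_le c2 sqr_ge0.
Qed.

Variables (beta phi : 'rV[R]_N -> R) (dphi : 'I_N -> 'rV[R]_N -> R) (mu1 : R).
Hypothesis E : positive_eigenpair Om beta 1 (fun _ _ => 0) (fun=> 0) mu1 phi dphi.

Let phi0 x : closure Om x -> 0 < phi x. Proof. by have [_] := E; apply. Qed.
Let Hphi : H1 phi dphi. Proof. by have [[]] := E. Qed.
Let bndry x : B x -> closure Om x. Proof. by case. Qed.

Lemma robin_test psi dpsi : H1 psi dpsi ->
  \sum_i I (fun x => dphi i x * dpsi i x) + Sf (fun x => beta x * phi x * psi x) =
  mu1 * I (fun x => phi x * psi x).
Proof.
move=> Hpsi; have [+ _] := E.
pose z : 'I_N -> 'rV[R]_N -> R := fun _ _ => 0.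
have -> : (fun (_ : 'I_N) (_ : 'rV[R]_N) => 0) = (fun i x => 2 * 0 * z i x).
  by apply/funext => i; apply/funext => x; rewrite mulr0.
move=> E'; rewrite -(weak_eigen oOm bOm (p := z) _ E' Hpsi); last by move=> i; exact: Linf_cst.
rewrite (@vol_int_ext _ _ _ (fun x => 0 * phi x * psi x) (fun=> 0)); last by move=> x _; rewrite !mul0r.
by rewrite vol_int0 mulr0 mul0r subr0 !mul1r addr0.
Qed.

Let test1 : Sf (fun x => beta x * phi x) = mu1 * I phi.
Proof.
have := robin_test (H1_cst oOm bOm 1).
rewrite big1 ?add0r => [|i _]; last first.
  by rewrite (@vol_int_ext _ _ _ _ (fun=> 0)) ?vol_int0// => x _; rewrite mulr0.
rewrite (@vol_int_ext _ _ _ (fun x => phi x * 1) phi); last by move=> x _; rewrite mulr1.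
by move=> <-; apply: surf_int_ext => x _; rewrite mulr1.
Qed.

Let Iphi_gt0 : 0 < I phi. Proof. exact: (vol_int_gt0 oOm bOm Om0 Hphi phi0). Qed.

Lemma principal_eq0 : (forall x, B x -> beta x = 0) -> mu1 = 0.
Proof.
move=> b0; have := test1; rewrite (@surf_int_ext _ _ _ _ (fun=> 0)); last first.
  by move=> x Bx; rewrite b0// mul0r.
rewrite /surf_int (_ : integral _ _ _ = 0%E) /=; last by apply: integral0_eq.
by move=> /esym/eqP; rewrite mulf_eq0 (gt_eqF Iphi_gt0) orbF => /eqP.
Qed.

Hypothesis cbeta : {within B, continuous beta}.

Let cphi : {within B, continuous phi}.
Proof. by apply: continuous_subspaceW (proj1 Hphi) => x []. Qed.

Let cbphi : {within B, continuous (fun x => beta x * phi x)}.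
Proof. exact: (@continuous_mul R (subspace B)). Qed.

(** The test function 1 gives int beta phi = mu1 int phi. *)
Lemma principal_gt0 : (forall x, B x -> 0 <= beta x) ->
  (exists2 x, B x & beta x != 0) -> 0 < mu1.
Proof.
move=> b0 [x Bx bx]; rewrite -(pmulr_lgt0 _ Iphi_gt0) -test1.
apply: (surf_int_gt0 hOm cbphi _ Bx) => [y By|].
  by rewrite mulr_ge0 ?b0// ltW// phi0//; exact: bndry.
by rewrite mulr_gt0 ?phi0//; [rewrite lt_neqAle eq_sym bx b0|exact: bndry].
Qed.

(** The gradient of log phi. *)
Let w : 'I_N -> 'rV[R]_N -> R := fun i x => (phi x)^-1 * dphi i x.

Let Lw i : L2 Om (w i).
Proof. exact: (L2_Linf mOm (H1_Linf oOm bOm (H1_inv oOm bOm phi0 Hphi)) (H1_L2 i Hphi)). Qed.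

Let phiO x : Om x -> phi x != 0.
Proof. by move=> Ox; rewrite gt_eqF// phi0//; exact: subset_closure. Qed.

(** The test function is 1/phi, which removes phi from the boundary term. *)
Let test_inv : Sf beta = mu1 * I (fun=> 1) + dirichlet Om w.
Proof.
have := robin_test (H1_inv oOm bOm phi0 Hphi).
have -> : \sum_i I (fun x => dphi i x * (- (phi x) ^- 2 * dphi i x)) = - dirichlet Om w.
  rewrite -sumrN; apply: eq_bigr => i _; have [_ w2] := Lw i.
  rewrite -(vol_intN mOm w2); apply: vol_int_ext => x /phiO h.
  by rewrite /w; field.
rewrite (@vol_int_ext _ _ _ (fun x => phi x / phi x) (fun=> 1)); last first.
  by move=> x /phiO h; rewrite divff.
rewrite (@surf_int_ext _ _ _ (fun x => beta x * phi x / phi x) beta); last first.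
  by move=> x /bndry clx; rewrite mulfK// gt_eqF// phi0.
by lra.
Qed.

(* If mu1 = 0 and the integral of beta vanishes, then so does the gradient of
   phi, and the equation says that beta phi is orthogonal to every trace. *)
Lemma principal_lt0 : Sf beta < 0 \/ (Sf beta = 0 /\ exists2 x, B x & beta x != 0) ->
  mu1 < 0.
Proof.
have vol0 : 0 < I (fun=> 1) by apply: (vol_int_gt0 oOm bOm Om0 (H1_cst oOm bOm 1)).
have w0 := dirichlet_ge0 Om w; rewrite test_inv => -[neg|[zero [x Bx bx]]].
  by rewrite -(pmulr_llt0 _ vol0); lra.
rewrite lt_neqAle andbC -(pmulr_lle0 _ vol0) (_ : _ <= 0) /=; last by lra.
apply/eqP => mu0; move: zero; rewrite mu0 mul0r add0r => /eqP.
rewrite psumr_eq0; last by move=> i _; apply: vol_int_ge0 => y _; exact: sqr_ge0.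
move=> /allP wz.
have orth psi dpsi : H1 psi dpsi -> Sf (fun y => beta y * phi y * psi y) = 0.
  move=> Hpsi; have := robin_test Hpsi; rewrite mu0 mul0r big1 ?add0r// => i _.
  have /eqP wi : I (fun y => w i y ^+ 2) == 0 by apply: wz; rewrite mem_index_enum.
  have L := L2_Linf mOm (H1_Linf oOm bOm Hphi) (H1_L2 i Hpsi).
  rewrite -(L2_orthogonal mOm (Lw i) L wi); apply: vol_int_ext => y /phiO h.
  by rewrite /w; field.
have b0 : 0 < `|beta x| by rewrite normr_gt0.
(* Values within [|beta x|] of [beta x] have the same sign as [beta x]. *)
pose O := ball (beta x) `|beta x|.
have /nbhs_rVP[e e0 eU] : nbhs x [set y | B y -> O (beta y)].
  by apply: within_nbhs => //; [exact: ball_open|exact: ballxx].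
have near_x y : B y -> (forall i, `|y 0 i - x 0 i| < e) -> 0 < Num.sg (beta x) * beta y.
  move=> By /eU /(_ By); rewrite /O /ball /= distrC; have [bx0|bx0|bx0] := ltgtP (beta x) 0.
  - by rewrite ltr0_sg// ltr_distl ltr0_norm// => /andP[_]; lra.
  - by rewrite gtr0_sg// ltr_distl gtr0_norm// => /andP[+ _]; lra.
  - by rewrite bx0 eqxx in bx.
have [psi [spsi psi0 psix psie]] := smooth_bump_at x e0.
(* A bump at [x] times the sign of [beta x] makes the boundary integrand nonnegative, and positive
   at [x]. *)
have Hs := H1_scale oOm bOm (Num.sg (beta x)) (H1_smooth oOm bOm spsi).
have := orth _ _ Hs; apply/eqP; rewrite gt_eqF//.
apply: (surf_int_gt0 hOm _ _ Bx) => [|y By|].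
- apply: (@continuous_mul R (subspace B)) => //.
  by apply: continuous_subspaceW (proj1 Hs) => y [].
- have [->|py] := eqVneq (psi y) 0; first by rewrite !mulr0.
  have := near_x y By (psie y py); have := phi0 (bndry By); have := psi0 y.
  set a := Num.sg _; set b := beta y; set c := phi y; set d := psi y => d0 c0 ab.
  rewrite (_ : b * c * (a * d) = a * b * (c * d)); last by ring.
  by apply: mulr_ge0; [exact: ltW|apply: mulr_ge0 => //; exact: ltW].
- have := near_x x Bx; have := phi0 (bndry Bx); move: psix.
  set a := Num.sg _; set b := beta x; set c := phi x; set d := psi x => d0 c0 ab.
  rewrite (_ : b * c * (a * d) = a * b * (c * d)); last by ring.
  by apply: mulr_gt0; [apply: ab => i; rewrite subrr normr0|exact: mulr_gt0].
Qed.

End Sign.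

Unset Implicit Arguments.
Set Strict Implicit.
Set Printing Implicit Defensive.

Theorem theorem1p5 (R : realType) (n : nat) (Om : set 'rV[R]_n.+1)
    (alpha : R) (m V beta : 'rV[R]_n.+1 -> R) (lambda : R -> R) (mu1 : R)
    (hOm : bounded_smooth_domain Om)
    (halpha : 0 < alpha)
    (hm : Ck_closure 2 Om m)
    (hV : {within closure Om, continuous V})
    (hbeta : {within boundary Om, continuous beta})
    (hlambda : forall D : R, 0 < D ->
       principal_eigenvalue Om beta D (fun i x => 2 * alpha * partial i m x) V
         (lambda D))
    (hmu1 : principal_eigenvalue Om beta 1 (fun _ _ => 0) (fun _ => 0) mu1) :
  (* (i) *)
  (0 < mu1 -> lambda x @[x --> +oo] --> +oo) /\
  (* (ii) *)
  (mu1 < 0 -> lambda x @[x --> +oo] --> -oo) /\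
  (* (iii) *)
  (mu1 = 0 ->
   forall phi0 dphi0,
     positive_eigenpair Om beta 1 (fun _ _ => 0) (fun _ => 0) mu1 phi0 dphi0 ->
     vol_int Om (fun x => phi0 x ^+ 2) = 1 ->
     lambda x @[x --> +oo] -->
       vol_int Om (fun x => V x * phi0 x ^+ 2
         - 2 * alpha * phi0 x * \sum_(i < n.+1) partial i m x * dphi0 i x)) /\
  (* sufficient conditions for (i), (ii), (iii) *)
  ((forall x, boundary Om x -> 0 <= beta x) ->
   (exists2 x, boundary Om x & beta x != 0) -> 0 < mu1) /\
  (surf_int (boundary Om) beta < 0 \/
   (surf_int (boundary Om) beta = 0 /\
    exists2 x, boundary Om x & beta x != 0) -> mu1 < 0) /\
  ((forall x, boundary Om x -> beta x = 0) -> mu1 = 0).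
Proof.
have [oOm cOm Om0 bOm sOm] := hOm.
(* [mt] is the continuous extension of [m] to the closure, which takes part in the conjugation by
   exp(alpha m / D). *)
have [[mt cmt mE] _] := hm.
have Hmu : H1_continuous Om mt (fun i => partial i m).
  by apply: (H1_C2 oOm bOm cmt) => // x Ox; rewrite mE.
have Lp i : Linf Om (partial i m).
  have m1 : Ck_closure 1 Om (partial i m) by have [_ /(_ i)[]] := hm.
  exact: (Ck_closure_Linf oOm bOm m1).
have LV : Linf Om V := within_closure_Linf oOm bOm hV.
have mOm := domain_measurable oOm; have fOm := domain_finite oOm bOm.
have eigen D : 0 < D -> exists phi dphi,
    positive_eigenpair Om beta D (fun i x => 2 * alpha * partial i m x) V (lambda D) phi dphi.
  by move=> D0; have [] := hlambda D D0.
have [[phi [dphi E]] _] := hmu1.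
split; last split; last split; last split; last split.
- move=> mu0; have [c hc] := principal_lower hOm Lp Hmu eigen E.
  apply/cvgryPge => A; near=> D.
  have D1 : 1 <= D by near: D; apply: nbhs_pinfty_ge; exact: num_real.
  apply: le_trans (hc D D1); rewrite -lerBlDr -ler_pdivrMr// -lerBlDr opprK.
  by near: D; apply: nbhs_pinfty_ge; exact: num_real.
- move=> mu0; have up := principal_upper hOm Lp eigen E.
  have [[[cphi wphi] _ _] phi0] := E; have Hphi : H1_continuous Om phi dphi by [].
  have F0 : 0 < vol_int Om (fun x => phi x ^+ 2).
    apply: (vol_int_gt0 oOm bOm Om0 (H1_sqr oOm bOm Hphi)) => x clx.
    by rewrite exprn_gt0// phi0.
  apply/cvgrNyPle => A; near=> D.
  have D1 : 1 <= D by near: D; apply: nbhs_pinfty_ge; exact: num_real.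
  have D0 : 0 < D := lt_le_trans ltr01 D1.
  rewrite -(ler_pM2r F0); apply: le_trans (up D D0) _.
  have W0 : 0 <= weight Om (fun i => partial i m) phi.
    by apply: sumr_ge0 => i _; apply: vol_int_ge0 => x _; exact: sqr_ge0.
  set W := weight _ _ _ in W0 *; set F := vol_int Om (fun x => phi x ^+ 2) in F0 *.
  set J := (_ - _).
  have h1 : alpha ^+ 2 / D * W <= alpha ^+ 2 * W.
    by apply: ler_wpM2r => //; rewrite ler_pdivrMr// ler_peMr// sqr_ge0.
  (* The threshold at which the negative term [D * mu1 * F] brings the upper bound below [A * F]. *)
  have h2 : (alpha ^+ 2 * W + J - A * F) / (- mu1 * F) <= D.
    by near: D; apply: nbhs_pinfty_ge; exact: num_real.
  have mF : 0 < - mu1 * F by rewrite mulr_gt0// oppr_gt0.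
  by move: h2; rewrite ler_pdivrMr// => h2; lra.
- move=> mu0 phi0 dphi0 E0 n0.
  have up := principal_upper hOm Lp eigen E0.
  have low := principal_lower0 hOm Lp Hmu LV eigen E0 mu0 n0.
  have [[H0 _ _] _] := E0; have L0 := H1_Linf oOm bOm H0.
  set W := weight Om (fun i => partial i m) phi0 in up.
  set J := vol_int Om _.
  (* The single integral in the statement is [ground_energy], whose drift part is summed over
     coordinates. *)
  have JE : vol_int Om (fun x => V x * phi0 x ^+ 2) -
      2 * alpha * drift Om (fun i => partial i m) phi0 dphi0 = J.
    have Li i : L1 Om (fun x => partial i m x * phi0 x * dphi0 i x).
      have L := Linf_in_L2 mOm fOm (LinfM (Lp i) L0).
      exact: (L2_mul mOm L (H1_L2 i H0)).
    have I1 := Linf_in_L1 mOm fOm (LinfM LV (LinfM L0 L0)).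
    have I2 := L1_sum mOm (index_enum 'I_n.+1) Li.
    rewrite /drift -(vol_int_sum mOm _ Li) -(vol_intZ mOm _ I2) -(vol_intB mOm I1 (L1Z mOm _ I2)).
    apply: vol_int_ext => x _; congr (_ - _); rewrite -!mulrA; congr (_ * (_ * _)).
    by rewrite mulr_sumr; apply: eq_bigr => i _; rewrite mulrCA !mulrA.
  have W0 : 0 <= W.
    by apply: sumr_ge0 => i _; apply: vol_int_ge0 => x _; exact: sqr_ge0.
  apply/cvgrPdist_le => eps eps0; have [D0 hD0] := low _ eps0.
  near=> D.
  have D1 : 1 <= D by near: D; apply: nbhs_pinfty_ge; exact: num_real.
  have Dp : 0 < D := lt_le_trans ltr01 D1.
  have DD0 : D0 <= D by near: D; apply: nbhs_pinfty_ge; exact: num_real.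
  (* Makes the remaining weight term of the upper bound at most [eps]. *)
  have DW : alpha ^+ 2 * W / eps <= D by near: D; apply: nbhs_pinfty_ge; exact: num_real.
  have := hD0 D DD0 Dp; rewrite /ground_energy JE.
  have := up D Dp; rewrite JE n0 mu0 mulr0 !mulr1 add0r.
  have : alpha ^+ 2 / D * W <= eps.
    by rewrite mulrAC ler_pdivrMr// [leRHS]mulrC -ler_pdivrMr.
  by rewrite ler_distlC => h1 h2 h3; apply/andP; split; lra.
- exact: (principal_gt0 hOm E hbeta).
- exact: (principal_lt0 hOm E hbeta).
- exact: (principal_eq0 hOm E).
Unshelve. all: by end_near.
Qed.
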